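(* Let $\alpha=(\alpha_1,\alpha_2)$ be such that $1,\alpha_1,\alpha_2$ are linearly independent over $\mathbb Q$, and let $f:\mathbb T^2\to\mathbb T^2$, $f(\theta)=\theta+\alpha$. Let $\phi:\mathbb T^2\to\mathbb R$ be piecewise Hölder, and suppose that the Lyapunov exponent $L(E)$ is continuous in $E\in\mathbb R$ and $L(E)>0$ for every $E\in\mathbb R$. If $\alpha\in\bigcup_{\tau>1}WDC(\tau)$, then $\dim_H(\mu_\theta)=0$ for all $\theta\in\mathbb T^2$.
   Context: $\mathbb T^2=\mathbb R^2/\mathbb Z^2$ with the flat metric $\mathrm{dist}$ and Lebesgue measure $m$; $\|x\|_{\mathbb R/\mathbb Z}$ is the distance from $x$ to the nearest integer. Weak Diophantine condition: $(\alpha_1,\alpha_2)\in WDC(\tau)$ if there is $c>0$ with $\max\{\|h\alpha_1\|_{\mathbb R/\mathbb Z},\|h\alpha_2\|_{\mathbb R/\mathbb Z}\}\ge c|h|^{-\tau}$ for all $h\in\mathbb Z\setminus\{0\}$. Piecewise Hölder: for $\gamma>0$, $L_\gamma(\mathbb T^2)$ is the space of functions with $\|\phi\|_\infty+\sup_{\theta_1\ne\theta_2}\frac{|\phi(\theta_1)-\phi(\theta_2)|}{\mathrm{dist}(\theta_1,\theta_2)^\gamma}<\infty$. $\phi$ is piecewise Hölder if there are $\gamma>0$, $K\in\mathbb N$, $\phi_1,\dots,\phi_K\in L_\gamma(\mathbb T^2)$ and sets $S_1,\dots,S_K\subset\mathbb T^2$ whose boundaries $\partial S_j$ are smooth $1$-dimensional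 submanifolds of finite length, such that $\phi=\sum_{j=1}^K\chi_{S_j}\phi_j$. Operator: $H_\theta$ acts on $\ell^2(\mathbb Z)$ by $(H_\theta u)(n)=u(n+1)+u(n-1)+\phi(f^n\theta)u(n)$. $\mu_\theta$ is the spectral measure of $H_\theta$ at $\delta_0$: $\langle(H_\theta-z)^{-1}\delta_0,\delta_0\rangle=\int\frac{d\mu_\theta(x)}{x-z}$. For a Borel measure $\mu$ on $\mathbb R$, $\dim_H(\mu)=\inf\{\dim_H(S):S\subset\mathbb R\text{ Borel},\ \mu(\mathbb R\setminus S)=0\}$. Lyapunov exponent: $A(\theta,z)=\begin{pmatrix}z-\phi(\theta)&-1\\1&0\end{pmatrix}$, $A_k(\theta,z)=A(f^{k-1}\theta,z)\cdots A(\theta,z)$ for $k\ge1$, and $L(z)=\lim_{k\to\infty}\frac1k\int_{\mathbb T^2}\ln\|A_k(\theta,z)\|\,dm(\theta)$. *)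

(* Defs.v *)
From HB Require Import structures.
From mathcomp Require Import all_boot all_order all_algebra.
From mathcomp Require Import complex.
From mathcomp Require Import all_classical all_reals all_analysis.

Set Implicit Arguments.
Unset Strict Implicit.
Unset Printing Implicit Defensive.

Import Order.TTheory GRing.Theory Num.Theory.
Import numFieldNormedType.Exports.

Local Open Scope classical_set_scope.
Local Open Scope complex_scope.
Local Open Scope ring_scope.

(* The torus R^2/Z^2 is handled through its universal cover: a point is
   represented by any of its lifts in R * R, a function or a subset by its
   Z^2-periodic lift. *)

Section Torus.
Variable R : realType.
Implicit Types (x t : R) (p q alpha theta : R * R).

Definition dist_int x : R := inf (range (fun k : int => `|x - k%:~R|)).

Definition tdist p q : R :=
  Num.sqrt (dist_int (p.1 - q.1) ^+ 2 + dist_int (p.2 - q.2) ^+ 2).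

Definition lattice (k l : int) : R * R := (k%:~R, l%:~R).

Definition periodic_fun (T : Type) (g : R * R -> T) : Prop :=
  forall (k l : int) p, g (p + lattice k l) = g p.

Definition periodic_set (S : set (R * R)) : Prop :=
  forall (k l : int) p, S (p + lattice k l) <-> S p.

(* f^n for the rotation f by alpha, n an arbitrary integer. *)
Definition rot_iter alpha (n : int) theta : R * R := theta + alpha *~ n.

Definition rationally_independent alpha : Prop :=
  forall a b c : rat,
    ratr a + ratr b * alpha.1 + ratr c * alpha.2 = 0 ->
    [/\ a = 0, b = 0 & c = 0].

Definition WDC (tau : R) alpha : Prop :=
  exists2 c : R, 0 < c & forall h : int, h != 0 ->
    c * (`|h|%:~R `^ (- tau)) <=
    Num.max (dist_int (h%:~R * alpha.1)) (dist_int (h%:~R * alpha.2)).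

End Torus.

Section Hausdorff.
Variables (R : realType) (T : Type) (d : T -> T -> R).
Local Open Scope ereal_scope.

Definition diameter (U : set T) : \bar R :=
  ereal_sup [set (d p.1 p.2)%:E | p in U `*` U].

(* With [poweR x 0 = 1], the case s = 0 is the counting measure, which is why
   the empty set needs its own clause. *)
Definition diam_pow (s : R) (U : set T) : \bar R :=
  if U == set0 then 0 else poweR (diameter U) s.

Definition hausdorff_premeasure (s delta : R) (S : set T) : \bar R :=
  ereal_inf [set \sum_(i <oo) diam_pow s (U i) | U in
    [set U : nat -> set T |
      S `<=` \bigcup_i U i /\ forall i, diameter (U i) <= delta%:E]].

Definition hausdorff_measure (s : R) (S : set T) : \bar R :=
  ereal_sup [set hausdorff_premeasure s delta S | delta in
    [set delta : R | (0 < delta)%R]].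

Definition hausdorff_dim (S : set T) : \bar R :=
  ereal_inf [set s%:E | s in
    [set s : R | (0 <= s)%R /\ hausdorff_measure s S = 0]].

End Hausdorff.

Section MeasureDimension.
Variable R : realType.

Definition real_dist (x y : R) : R := `|x - y|.

Definition dimH_measure (mu : set (measurableTypeR R) -> \bar R) : \bar R :=
  ereal_inf [set hausdorff_dim real_dist S | S in
    [set S : set (measurableTypeR R) | measurable S /\ mu (~` S) = 0%E]].

End MeasureDimension.

Section Smooth.
Variable R : realType.

Fixpoint Ck_on (W : normedModType R) (n : nat) (U : set (R * R))
    (g : R * R -> W) : Prop :=
  (forall p, U p -> {for p, continuous g}) /\
  (if n is m.+1 then
     forall v : R * R,
       (forall p, U p -> derivable g p v) /\ Ck_on m U ('D_v g)
   else True).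

Definition smooth_on (W : normedModType R) (U : set (R * R))
    (g : R * R -> W) : Prop := forall n, Ck_on n U g.

(* Embedded submanifold without boundary, through slice charts.  For a periodic
   M this is the same as being a submanifold of the torus, the covering map
   being a local diffeomorphism. *)
Definition smooth_curve (M : set (R * R)) : Prop :=
  forall p, M p ->
    exists (U V : set (R * R)) (psi chi : R * R -> R * R),
      [/\ open U /\ U p, open V,
          smooth_on U psi /\ smooth_on V chi,
          (forall q, U q -> V (psi q) /\ chi (psi q) = q) /\
          (forall w, V w -> U (chi w) /\ psi (chi w) = w) &
          M `&` U = [set q | U q /\ (psi q).2 = 0]].

Definition boundary (S : set (R * R)) : set (R * R) :=
  closure S `\` interior S.

(* The length is the one-dimensional Hausdorff measure on the torus: [tdist]
   identifies the lifts of a point, so the periodic set [boundary S] is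
   measured as its image in the torus. *)
Definition admissible_piece (S : set (R * R)) : Prop :=
  [/\ periodic_set S, smooth_curve (boundary S) &
      (hausdorff_measure (@tdist R) 1 (boundary S) < +oo)%E].

Definition Holder_norm (gamma : R) (g : R * R -> R) : \bar R :=
  (ereal_sup [set `|g p|%:E | p in setT] +
   ereal_sup [set (`|g w.1 - g w.2| / (tdist w.1 w.2 `^ gamma))%R%:E | w in
     [set w : (R * R) * (R * R) | (tdist w.1 w.2 != 0)%R]])%E.

Definition Holder_space (gamma : R) (g : R * R -> R) : Prop :=
  periodic_fun g /\ (Holder_norm gamma g < +oo)%E.

Definition piecewise_Holder (phi : R * R -> R) : Prop :=
  exists (gamma : R) (K : nat) (S : 'I_K -> set (R * R))
         (g : 'I_K -> R * R -> R),
    [/\ 0 < gamma,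
        forall j, admissible_piece (S j),
        forall j, Holder_space gamma (g j) &
        forall p, phi p = \sum_(j < K) \1_(S j) p * g j p].

End Smooth.

Section Cocycle.
Variables (R : realType) (phi : R * R -> R) (alpha : R * R).

Definition norm2 (v : 'cV[R[i]]_2) : R :=
  Num.sqrt (\sum_i ComplexField.Normc.normc (v i 0) ^+ 2).

Definition opnorm (A : 'M[R[i]]_2) : R :=
  sup [set norm2 (A *m v) | v in [set v | norm2 v <= 1]].

Definition transfer (theta : R * R) (z : R[i]) : 'M[R[i]]_2 :=
  \matrix_(i, j)
    (if i == 0 then (if j == 0 then z - (phi theta)%:C else -1)
     else (if j == 0 then 1 else 0)).

Fixpoint cocycle (k : nat) (theta : R * R) (z : R[i]) : 'M[R[i]]_2 :=
  if k is l.+1 then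
    transfer (rot_iter alpha l%:Z theta) z *m cocycle l theta z
  else 1%:M.

Definition fundamental_domain : set (measurableTypeR R * measurableTypeR R) :=
  `[0, 1[%classic `*` `[0, 1[%classic.

(* A piecewise Hoelder [phi] is Lebesgue but possibly not Borel measurable, while
   the product measure lives on Borel sets.  The value is nevertheless the
   Lebesgue integral: the integrand is nonnegative (det = 1), and the integral
   of any nonnegative function is here the supremum of the integrals of the
   Borel simple functions below it. *)
Definition lyapunov (z : R[i]) : R :=
  limn (fun k : nat =>
    k%:R^-1 *
    Rintegral (lebesgue_measure \x lebesgue_measure)%E fundamental_domain
      (fun theta => ln (opnorm (cocycle k theta z)))).

End Cocycle.

Section Schroedinger.
Variable R : realType.
Local Notation seqZ := (int -> R[i]).

Definition l2 (u : seqZ) : Prop :=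
  (\esum_(n in [set: int]) (ComplexField.Normc.normc (u n) ^+ 2)%:E < +oo)%E.

(* On l2 the series converges absolutely, so symmetric partial sums suffice. *)
Definition inner (u v : seqZ) : R[i] :=
  let partial_sum (N : nat) : R[i] :=
    \sum_(k < N.*2.+1) u (k%:Z - N%:Z) * (v (k%:Z - N%:Z))^* in
  limn (fun N => complex.Re (partial_sum N)) +i*
  limn (fun N => complex.Im (partial_sum N)).

Definition delta0 : seqZ := fun n => (n == 0)%:R.

Definition schroedinger (phi : R * R -> R) (alpha theta : R * R)
    (u : seqZ) : seqZ :=
  fun n => u (n + 1) + u (n - 1) + (phi (rot_iter alpha n theta))%:C * u n.

Definition is_resolvent (H : seqZ -> seqZ) (z : R[i]) (G : seqZ -> seqZ) :
    Prop :=
  (forall v, l2 v -> l2 (G v) /\ (forall n, H (G v) n - z * G v n = v n)) /\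
  (forall u, l2 u -> forall n, G (fun m => H u m - z * u m) n = u n).

Definition stieltjes (mu : {measure set (measurableTypeR R) -> \bar R})
    (z : R[i]) : R[i] :=
  Rintegral mu setT (fun x : R => complex.Re ((x%:C - z)^-1)) +i*
  Rintegral mu setT (fun x : R => complex.Im ((x%:C - z)^-1)).

(* A finite Borel measure is determined by its Stieltjes transform off the
   real axis, so at most one measure satisfies this. *)
Definition is_spectral_measure (H : seqZ -> seqZ)
    (mu : {finite_measure set (measurableTypeR R) -> \bar R}) : Prop :=
  forall z : R[i], complex.Im z != 0 ->
    exists2 G : seqZ -> seqZ, is_resolvent H z G &
      inner (G delta0) delta0 = stieltjes mu z.

End Schroedinger.

(* Main.v *)
Require Import Defs.
From HB Require Import structures.
From mathcomp Require Import all_boot all_order all_algebra.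
From mathcomp Require Import complex ring lra zify.
From mathcomp Require Import all_classical all_reals all_analysis.
From mathcomp Require Import measurable_realfun.
Import Order.TTheory GRing.Theory Num.Theory.
Import numFieldNormedType.Exports.
Set Implicit Arguments.
Unset Strict Implicit.
Unset Printing Implicit Defensive.
Local Open Scope classical_set_scope.
Local Open Scope complex_scope.
Local Open Scope ring_scope.

(** Fix [theta], a large integer [D], and for a scale [n] put
[eps = n ^- (4 * D)].  By the Stieltjes transform, the mass that [mu] gives to
the interval of radius [eps] around [E] is at most [2 * eps] times the imaginary
part of the Green function [u] of [H_theta] at energy [E + i eps], taken at the
origin.  The proof shows that, at suitable scales [n], this imaginary part is
tiny unless [E] is within [n ^- D] of a set of polynomially many points, and
that the exponent of that polynomial does not depend on [D].

Positivity of the Lyapunov exponent at [E] gives a point of the torus from which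
the transfer matrices over about [ln n] steps have norm at least
[n ^+ (28 * D)]; the same holds on a whole box of side [1 / n] around it and for
all energies within [eps] of [E] ([transfer_growth]).  This stability needs a
bound on the cocycle that is uniform in the starting point and has nearly the
Lyapunov rate ([cocycle_upper_bound]).  The potential jumps along finitely many
curves, so no continuity of the cocycle is available; instead, those curves are
covered by [O(n)] boxes of side [1 / n] ([linear_covering_boundary]), and an
orbit cannot visit a box of that side much more often than [n ^ -2] of the time
([card_visit_set_le]).

By the Diophantine condition there are infinitely many scales [n] at which
[alpha] has no resonance of order up to [n ^ 3] ([nonresonant_scales]), and at
such a scale every orbit visits every box of side [1 / n] within [n ^ C'] steps
([orbit_hits]).  Hence both half-lines contain, at distance at most about
[n ^ C'] from the origin, a block on which the transfer matrices are huge.  Since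
the current of an [l2] solution is monotone, this block forces
[|u x| <= n ^- (8 * D)] beyond it ([green_decay]).  Restricted to a box of size
about [n ^ C'], [u] therefore solves the equation of the finite Hermitian box
Hamiltonian up to a bounded source; when [E] is [n ^- D]-far from the eigenvalues
of the box, the restriction has norm [O(n ^ D)] and the imaginary part of [u 0]
is [O(n ^- (2 * D))] ([Im_green_small]).

So at a good scale each energy is close to a box eigenvalue or is the centre of
an interval of mass [O(n ^- (6 * D))] ([ball_or_light]).  The light energies of
[[-n, n]] are covered by [O(n ^ (4 * D + 1))] intervals, of total mass
[O(n ^- (2 * D - 1))].  Along scales growing geometrically the Borel-Cantelli
lemma shows that almost every energy is, at all late scales, within [n ^- D] of
one of [O(n ^ (C' + 1))] eigenvalues.  Such a set has zero Hausdorff measure of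
dimension [s] as soon as [D * s >= C' + 2] ([hausdorff_null_support]), and [s] is
arbitrary. *)

(** * Diophantine arithmetic of the frequency *)

Section Arithmetic.
Variable R : realType.
Implicit Types (alpha : R * R).

Definition int_independent alpha : Prop := forall m1 m2 p : int,
  m1%:~R * alpha.1 + m2%:~R * alpha.2 + p%:~R = 0 -> m1 = 0 /\ m2 = 0.

(** A form of the weak Diophantine condition with a natural exponent and
without the distance to the integers, so that it can be tested on explicit
integer approximations. *)
Definition simult_dioph (c : R) (t : nat) alpha : Prop :=
  forall h k1 k2 : int, h != 0 ->
    c <= `|h%:~R| ^+ t *
         Num.max `|h%:~R * alpha.1 - k1%:~R| `|h%:~R * alpha.2 - k2%:~R|.

Definition nonresonant alpha (K : nat) (eta : R) : Prop :=
  forall m1 m2 p : int, (m1 != 0) || (m2 != 0) ->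
    `|m1%:~R : R| <= K%:R -> `|m2%:~R : R| <= K%:R ->
    eta <= `|m1%:~R * alpha.1 + m2%:~R * alpha.2 + p%:~R|.

Lemma intr_norm_lt1 (h : int) : `|h%:~R : R| < 1 -> h = 0.
Proof. by rewrite -intr_norm -[1]/(1%:~R) ltr_int; lia. Qed.

Lemma intr_norm_ge1 (h : int) : h != 0 -> 1 <= `|h%:~R : R|.
Proof. by rewrite -intr_norm -[X in X <= _]/(1%:~R) ler_int; lia. Qed.

Lemma nat_above (x : R) : exists n : nat, (0 < n)%N /\ x < n%:R.
Proof.
exists (Num.bound `|x|).+1; split=> //.
apply: (@le_lt_trans _ _ `|x|); first exact: ler_norm.
apply: (lt_trans (archi_boundP (normr_ge0 x))).
by rewrite ltr_nat.
Qed.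

Lemma pair_mulrn (x : R * R) k : (x *+ k).1 = x.1 *+ k /\ (x *+ k).2 = x.2 *+ k.
Proof. by elim: k => [|k [h1 h2]] //; rewrite !mulrS /= h1 h2. Qed.

Lemma int_independent_of_rational alpha :
  rationally_independent alpha -> int_independent alpha.
Proof.
move=> indep m1 m2 p e0.
have [|_ /eqP b0 /eqP c0] := indep p%:~R m1%:~R m2%:~R.
  by rewrite !ratr_int addrC addrA in e0 *; rewrite -e0; ring.
by move: b0 c0; rewrite !intr_eq0 => /eqP -> /eqP ->.
Qed.

Lemma dist_int_le (x : R) (k : int) : dist_int x <= `|x - k%:~R|.
Proof.
apply: ge_inf; last by exists k.
by exists 0 => _ [j _ <-]; exact: normr_ge0.
Qed.

(** Since [|h| >= 1], raising the exponent [tau] to an integer above it only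
weakens the condition. *)
Lemma simult_dioph_of_WDC alpha :
  (exists2 tau : R, 1 < tau & WDC tau alpha) ->
  exists c t, 0 < c /\ simult_dioph c t alpha.
Proof.
move=> [tau tau1 [c c0 wdc]].
have [t [_ taut]] := nat_above tau.
exists c, t; split=> // h k1 k2 h0.
have h1 := intr_norm_ge1 h0.
have {wdc} := wdc h h0.
rewrite -intr_norm in h1 *.
have hp : 0 < `|h|%:~R :> R by apply: lt_le_trans h1.
rewrite powRN -ler_pdivlMr ?invr_gt0 ?powR_gt0// invrK mulrC => le1.
apply: (le_trans le1); apply: ler_pM.
- exact: powR_ge0.
- rewrite le_max; apply/orP; left.
  apply: lb_le_inf; first by exists `|h%:~R * alpha.1 - 0%:~R|, 0.
  by move=> _ [k _ <-].
- by rewrite -powR_mulrn ?(ltW hp)// ler_powR// ltW.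
- by rewrite ge_max !le_max !dist_int_le orbT.
Qed.

(** Suppose that at every scale [Q >= Q0] there is a resonance, that is, an
integer vector [m Q] of size at most [Q ^ 3] for which the linear form [e Q]
is smaller than [Q ^- C]. The cross product of two consecutive resonances is
an integer vector [(h1, h2, h3)] of size [O(Q ^ 6)], and [h3 * alpha - (h1,
h2)] is a combination of [e Q] and [e (Q + 1)], hence of size [O(Q ^ 3 * Q ^-
C)]; by the Diophantine condition the cross product vanishes. Then all the
vectors [m Q] are proportional to [e Q], which is absurd because [e Q] tends
to zero while a nonzero integer vector has norm at least one. *)
Lemma nonresonant_scales alpha c t : 0 < c ->
  int_independent alpha -> simult_dioph c t alpha ->
  exists C : nat, forall Q0 : nat,
    exists Q : nat, (Q0 <= Q)%N /\ nonresonant alpha (Q ^ 3) (Q%:R ^- C).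
Proof.
move=> c0 indep dioph; set C := (6 * t + 4)%N.
exists C => Q0; apply: contrapT => /forallNP noQ.
have res Q : exists m : int * int * int, (Q0 <= Q)%N ->
    [/\ (m.1.1 != 0) || (m.1.2 != 0), `|m.1.1%:~R : R| <= (Q ^ 3)%:R,
     `|m.1.2%:~R : R| <= (Q ^ 3)%:R &
     `|m.1.1%:~R * alpha.1 + m.1.2%:~R * alpha.2 + m.2%:~R| < Q%:R ^- C].
  have [Q0Q|] := boolP (Q0 <= Q)%N; last by exists 0.
  apply: contrapT => /forallNP none; apply: (noQ Q); split=> // m1 m2 p m0 l1 l2.
  rewrite leNgt; apply/negP => lt.
  by apply: (none (m1, m2, p)) => _; split.
have {noQ res} [m resm] := choice res.
pose m1 Q : R := (m Q).1.1%:~R; pose m2 Q : R := (m Q).1.2%:~R.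
pose e Q := m1 Q * alpha.1 + m2 Q * alpha.2 + (m Q).2%:~R.
have e_neq0 Q : (Q0 <= Q)%N -> e Q != 0.
  move=> /resm [m0 _ _ _]; apply/eqP => /indep [z1 z2].
  by move: m0; rewrite z1 z2 eqxx.
have [Q1 [Q1_gt0 Q1_big]] := nat_above (Num.max (2 ^+ (7 * t + 4) / c) 16).
move: Q1_big; rewrite gt_max => /andP[Q1c Q1_16].
have step Q : (Q0 <= Q)%N -> (Q1 <= Q)%N ->
    e Q * m1 Q.+1 = e Q.+1 * m1 Q /\ e Q * m2 Q.+1 = e Q.+1 * m2 Q.
  move=> Q0Q Q1Q.
  have [_ a1 a2 ea] := resm Q Q0Q.
  have [_ b1 b2 eb] := resm Q.+1 (leqW Q0Q).
  rewrite -/(m1 Q) -/(m2 Q) -/(e Q) in a1 a2 ea.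
  rewrite -/(m1 Q.+1) -/(m2 Q.+1) -/(e Q.+1) in b1 b2 eb.
  have Qgt0 : (0 < Q)%N by apply: leq_trans Q1Q.
  have qgt0 : 0 < Q%:R :> R by rewrite ltr0n.
  set x := Q%:R : R in ea qgt0 *.
  have Q1x : Q1%:R <= x by rewrite ler_nat.
  have x1 : 1 <= x by rewrite ler1n.
  have A1 : `|m1 Q| <= 8 * x ^+ 3.
    by apply: (le_trans a1); rewrite natrX ler_peMl ?exprn_ge0 ?ltW// ltr1n.
  have A2 : `|m2 Q| <= 8 * x ^+ 3.
    by apply: (le_trans a2); rewrite natrX ler_peMl ?exprn_ge0 ?ltW// ltr1n.
  have S3 : (Q.+1 ^ 3)%:R <= 8 * x ^+ 3.
    have -> : 8 * x ^+ 3 = (2 * x) ^+ 3 by ring.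
    have q2 : Q.+1%:R <= 2 * x by rewrite -natrM ler_nat mul2n -addnn -addn1 leq_add2l.
    by rewrite natrX; apply: lerXn2r q2; rewrite nnegrE ?mulr_ge0 ?ler0n ?ltW.
  have B1 := le_trans b1 S3; have B2 := le_trans b2 S3.
  have eb' : `|e Q.+1| <= x ^- C.
    apply/ltW/(lt_le_trans eb); rewrite lef_pV2 ?posrE ?exprn_gt0//.
    by rewrite lerXn2r ?nnegrE ?ltW// ltr_nat.
  have ea' := ltW ea.
  have tiny (u v : R) : `|u| <= 8 * x ^+ 3 -> `|v| <= 8 * x ^+ 3 ->
      `|u * e Q - v * e Q.+1| <= 2 ^+ 4 * x ^- (6 * t).+1.
    move=> hu hv; apply: (le_trans (ler_normB _ _)); rewrite !normrM.
    have -> : 2 ^+ 4 * x ^- (6 * t).+1 = 8 * x ^+ 3 * x ^- C + 8 * x ^+ 3 * x ^- C.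
      rewrite /C addnS !addnS addn0 !exprS. field.
      by rewrite expf_neq0//= gt_eqF.
    by apply: lerD; apply: ler_pM.
  (* The cross product of [m Q] and [m Q.+1] annihilates both vectors; [E1] and
  [E2] express the defect of [alpha] in terms of [e Q] and [e Q.+1]. *)
  pose h3 := (m Q).1.1 * (m Q.+1).1.2 - (m Q).1.2 * (m Q.+1).1.1.
  pose h1 := (m Q).1.2 * (m Q.+1).2 - (m Q).2 * (m Q.+1).1.2.
  pose h2 := (m Q).2 * (m Q.+1).1.1 - (m Q).1.1 * (m Q.+1).2.
  have E1 : h3%:~R * alpha.1 - h1%:~R = m2 Q.+1 * e Q - m2 Q * e Q.+1.
    by rewrite /h3 /h1 /e /m1 /m2 !rmorphB/= !rmorphM/=; ring.
  have E2 : h3%:~R * alpha.2 - h2%:~R = m1 Q * e Q.+1 - m1 Q.+1 * e Q.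
    by rewrite /h3 /h2 /e /m1 /m2 !rmorphB/= !rmorphM/=; ring.
  have T1 := tiny _ _ B2 A2; rewrite -E1 in T1.
  have T2 := tiny _ _ B1 A1; rewrite -opprB -E2 normrN in T2.
  (* A nonzero [h3] would contradict the Diophantine condition; this is where
  the exponent [C = 6 * t + 4] comes from. *)
  have [h30|h30] := eqVneq h3 0; last first.
    exfalso; have := dioph _ h1 h2 h30; apply/negP; rewrite -ltNge.
    have H3 : `|h3%:~R : R| <= 2 ^+ 7 * x ^+ 6.
      rewrite /h3 rmorphB/= !rmorphM/=; apply: (le_trans (ler_normB _ _)).
      rewrite !normrM.
      have -> : 2 ^+ 7 * x ^+ 6 = 8 * x ^+ 3 * (8 * x ^+ 3) + 8 * x ^+ 3 * (8 * x ^+ 3) by ring.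
      by apply: lerD; apply: ler_pM.
    have M : Num.max `|h3%:~R * alpha.1 - h1%:~R| `|h3%:~R * alpha.2 - h2%:~R|
        <= 2 ^+ 4 * x ^- (6 * t).+1 by rewrite ge_max T1 T2.
    apply: (@le_lt_trans _ _ ((2 ^+ 7 * x ^+ 6) ^+ t * (2 ^+ 4 * x ^- (6 * t).+1))).
      apply: ler_pM => //; rewrite ?exprn_ge0// ?le_max ?normr_ge0//.
      by rewrite lerXn2r ?nnegrE// (le_trans _ H3).
    have -> : (2 ^+ 7 * x ^+ 6) ^+ t * (2 ^+ 4 * x ^- (6 * t).+1) = 2 ^+ (7 * t + 4) / x.
      rewrite exprMn -!exprM (exprD _ (7 * t)) (exprS x (6 * t)).
      have := expf_neq0 (6 * t) (lt0r_neq0 qgt0).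
      move: (2 ^+ (7 * t)) (x ^+ (6 * t)) => a b b0; field.
      by rewrite b0 lt0r_neq0.
    rewrite ltr_pdivrMr// mulrC -ltr_pdivrMr//.
    exact: lt_le_trans Q1x.
  have small : 2 ^+ 4 * x ^- (6 * t).+1 < 1.
    rewrite ltr_pdivrMr ?exprn_gt0// mul1r.
    apply: (@lt_le_trans _ _ x); last first.
      by rewrite exprS ler_peMr ?exprn_ege1 ?(ltW qgt0).
    have -> : 2 ^+ 4 = 16 :> R by ring.
    exact: lt_le_trans Q1x.
  move: E1 E2 T1 T2; rewrite h30 !mul0r !sub0r !normrN => E1 E2 T1 T2.
  have h10 := intr_norm_lt1 (le_lt_trans T1 small).
  have h20 := intr_norm_lt1 (le_lt_trans T2 small).
  move: E1 E2; rewrite h10 h20 !oppr0 => /esym/eqP E1 /esym/eqP E2.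
  split; rewrite mulrC [RHS]mulrC.
    by apply/esym/eqP; rewrite -subr_eq0.
  by apply/eqP; rewrite -subr_eq0.
(* Once consecutive resonances are proportional, all of them are proportional
to the one at scale [Q2]. *)
pose Q2 := maxn Q0 Q1.
have Q02 : (Q0 <= Q2)%N by rewrite leq_maxl.
have Q12 : (Q1 <= Q2)%N by rewrite leq_maxr.
have prop n : e Q2 * m1 (Q2 + n)%N = e (Q2 + n)%N * m1 Q2 /\
              e Q2 * m2 (Q2 + n)%N = e (Q2 + n)%N * m2 Q2.
  elim: n => [|n [i1 i2]]; first by rewrite addn0.
  have le0 : (Q0 <= Q2 + n)%N by rewrite (leq_trans Q02)// leq_addr.
  have [|s1 s2] := step (Q2 + n)%N le0; first by rewrite (leq_trans Q12)// leq_addr.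
  have en := e_neq0 _ le0.
  rewrite addnS; split; apply: (mulfI en).
    by rewrite mulrCA s1 [RHS]mulrCA -i1; ring.
  by rewrite mulrCA s2 [RHS]mulrCA -i2; ring.
have e2_gt0 : 0 < `|e Q2| by rewrite normr_gt0 e_neq0.
(* At a scale [Q2 + n] far beyond, [e (Q2 + n)] is too small for an integer
vector proportional to it. *)
have [n [n_gt0 nbig]] := nat_above ((Q2 ^ 3)%:R / `|e Q2|).
have Q0n : (Q0 <= Q2 + n)%N by rewrite (leq_trans Q02)// leq_addr.
have [p1 p2] := prop n.
have [nz _ _ en] := resm _ Q0n.
have [_ c1 c2 _] := resm _ Q02.
rewrite -/(m1 Q2) -/(m2 Q2) -/(e (Q2 + n)%N) in c1 c2 en.
have en' : `|e (Q2 + n)%N| <= n%:R^-1.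
  apply/ltW/(lt_le_trans en).
  rewrite lef_pV2 ?posrE ?exprn_gt0 ?ltr0n ?addn_gt0 ?n_gt0 ?orbT//.
  rewrite /C addnS exprS -natrX -natrM ler_nat.
  by apply: (@leq_trans (Q2 + n)); rewrite ?leq_addl// leq_pmulr// expn_gt0 addn_gt0 n_gt0 orbT.
suff : `|e Q2| <= n%:R^-1 * (Q2 ^ 3)%:R.
  apply/negP; rewrite -ltNge mulrC ltr_pdivrMr ?ltr0n// mulrC -ltr_pdivrMr//.
have [nz1|z1] := eqVneq (m (Q2 + n)%N).1.1 0; last first.
  apply: (@le_trans _ _ `|e Q2 * m1 (Q2 + n)%N|).
    by rewrite normrM ler_peMr// intr_norm_ge1.
  by rewrite p1 normrM ler_pM.
rewrite nz1 eqxx /= in nz.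
apply: (@le_trans _ _ `|e Q2 * m2 (Q2 + n)%N|).
  by rewrite normrM ler_peMr// intr_norm_ge1.
by rewrite p2 normrM ler_pM.
Qed.

End Arithmetic.

(** * Quantitative density of orbits *)

Section TrigEstimates.
Variable R : realType.
Implicit Types (alpha theta x : R * R) (u s : R).

(** The duplication formula reduces the claim to [v * cos v ^ 2 <= sin v * cos
v] with [v = pi * u / 2 <= pi / 4], where [cos v ^ 2 >= 1 / 2]. *)
Lemma sin_abs_ge u : 0 <= u <= 2^-1 -> u <= sin (pi * u).
Proof.
move=> /andP[u0 u1]; have [->|un0] := eqVneq u 0; first by rewrite mulr0 sin0.
have ugt0 : 0 < u by rewrite lt0r un0.
have pi2 : 2 <= pi :> R by exact: pi_ge2.
have pi0 : 0 < pi :> R by exact: pi_gt0.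
set v := pi * u / 2.
have v0 : 0 < v by rewrite divr_gt0// mulr_gt0.
have v1 : v <= pi / 2 / 2 by rewrite /v; nra.
have cc w : 0 <= w <= v -> 0 <= cos w.
  by move=> /andP[w0 w1]; apply: cos_ge0_pihalf; lra.
(* sin v >= v cos v by the mean value theorem, as cos decreases *)
have : v * cos v <= sin v.
  have sinC : {within `[0, v], continuous (@sin R)}.
    by apply: continuous_subspaceT => y; exact: continuous_sin.
  have [c] := MVT_segment (ltW v0) (fun y _ => is_derive_sin y) sinC.
  rewrite in_itv/= => /andP[c0 c1]; rewrite sin0 !subr0 => ->.
  rewrite mulrC ler_wpM2r ?(ltW v0)//.
  by rewrite leNgt ltr_cos ?in_itv/=; [rewrite -leNgt|lra|lra].
move=> sv.
have cv2 : 2^-1 <= cos v ^+ 2.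
  have : 0 <= cos (v *+ 2).
    by apply: cos_ge0_pihalf; rewrite [v *+ 2]mulr2n; lra.
  by rewrite cos_mulr2n; lra.
have -> : pi * u = v *+ 2 by rewrite [v *+ 2]mulr2n /v; field.
rewrite sin_mulr2n.
have cv0 : 0 <= cos v by apply: cc; rewrite lexx ltW.
apply: (@le_trans _ _ (v * cos v ^+ 2 *+ 2)).
  have : v * 2^-1 <= v * cos v ^+ 2 by rewrite ler_wpM2l// ltW.
  have : 2 * u <= pi * u by rewrite ler_wpM2r.
  by rewrite -mulr_natr; move: (cos v ^+ 2) => c; rewrite /v; lra.
by rewrite ler_wMn2r// expr2 mulrA [cos v * sin v]mulrC ler_wpM2r.
Qed.

Lemma norm_sinDint u (p : int) : `|sin (pi * (u + p%:~R))| = `|sin (pi * u)|.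
Proof.
have nat n w : `|sin (pi * (w + n%:R))| = `|sin (pi * w)|.
  elim: n => [|n <-]; first by rewrite addr0.
  by rewrite -natr1 addrA mulrDr mulr1 sinDpi normrN.
case: p => n; first by rewrite -pmulrn nat.
by rewrite NegzE mulrNz -pmulrn -[in RHS](subrK n.+1%:R u) nat.
Qed.

(** The zeros of [sin (pi * u)] are the integers, and between them it
dominates the distance to the nearest one. *)
Lemma dist_le_norm_sin u (eta : R) :
  (forall p : int, eta <= `|u + p%:~R|) -> eta <= `|sin (pi * u)|.
Proof.
move=> far; set p := Num.floor u.
have /andP[f1 f2] := mem_rg1_floor u.
have := far (- p); have := far (- p - 1).
rewrite -(norm_sinDint _ (- p)) rmorphB/= !rmorphN/= => far2 far1.
set w := u - p%:~R in far1 far2 *.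
have w0 : 0 <= w by rewrite /w; move: f1; rewrite /p; lra.
have w1 : w < 1 by rewrite /w; move: f2; rewrite /p; lra.
rewrite addrA -/w in far2.
rewrite ger0_norm// in far1; rewrite ler0_norm in far2; last by lra.
have [wh|wh] := leP w 2^-1.
  apply: (le_trans far1); apply: (le_trans _ (ler_norm _)).
  by apply: sin_abs_ge; rewrite w0.
have -> : pi * w = pi - pi * (1 - w) by ring.
have -> : sin (pi - pi * (1 - w)) = sin (pi * (1 - w)).
  by rewrite sinB sinpi cospi; ring.
apply: (@le_trans _ _ (1 - w)); first by move: far2; lra.
by apply: (le_trans _ (ler_norm _)); apply: sin_abs_ge; lra.
Qed.

(** The Fourier expansion of a power of the cosine. The factor [cos a] makes
the induction close up, and lets the two coordinates of a product kernel be
expanded one after the other. *)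
Lemma cos_pow_expand s (n : nat) (a : R) :
  cos s ^+ n * cos a =
  2 ^- n * \sum_(j < n.+1) 'C(n, j)%:R * cos (a + (n%:R - j%:R *+ 2) * s).
Proof.
elim: n a => [|n IH] a.
  by rewrite big_ord1 bin0 !expr0 invr1 !mul1r mul0rn subr0 mul0r addr0.
have -> : cos s ^+ n.+1 * cos a =
    2^-1 * (cos s ^+ n * cos (a + s) + cos s ^+ n * cos (a - s)).
  by rewrite exprS cosD cosB; field.
rewrite !IH -mulrDr mulrA -invfM -exprS; congr (_ * _).
pose f (j : nat) : R := cos (a + (n.+1%:R - j%:R *+ 2) * s).
transitivity (\sum_(j < n.+2) 'C(n, j)%:R * f j + \sum_(j < n.+1) 'C(n, j)%:R * f j.+1).
  congr (_ + _).
    rewrite [in RHS]big_ord_recr/= [in RHS]bin_small// mul0r addr0.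
    by apply: eq_bigr => j _; rewrite /f -natr1; congr (_ * cos _); ring.
  by apply: eq_bigr => j _; rewrite /f -!natr1; congr (_ * cos _); ring.
rewrite big_ord_recl [in RHS]big_ord_recl !bin0 -addrA; congr (_ + _).
rewrite -big_split/=; apply: eq_bigr => j _.
by rewrite /bump /= !add1n binS natrD mulrDl.
Qed.

Lemma central_bin_ge (K : nat) : (4 ^ K <= K.*2.+1 * 'C(K.*2, K))%N.
Proof.
elim: K => // K IH.
have e1 : (K.+1 * 'C(K.+1.*2, K.+1) = K.+1.*2 * 'C(K.*2.+1, K))%N.
  by rewrite doubleS -mul_bin_diag.
have e2 : (K.+1 * 'C(K.*2.+1, K) = K.*2.+1 * 'C(K.*2, K))%N.
  have := mul_bin_down K.*2.+1 K; rewrite /= -!addnn.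
  by rewrite subSn ?leq_addr// addnK => ->.
have e3 : ('C(K.+1.*2, K.+1) = 2 * 'C(K.*2.+1, K))%N.
  by apply/eqP; rewrite -(eqn_pmul2l (ltn0Sn K)) e1 -muln2; apply/eqP; ring.
rewrite expnS e3.
nia.
Qed.

(** A geometric sum, in real form: multiplied by [2 * sin (b / 2)] it
telescopes. *)
Lemma orbit_cos_sum (a b : R) (N : nat) :
  `|sin (b / 2)| * `|\sum_(n < N) cos (a + n%:R * b)| <= 1.
Proof.
have tele : 2 * sin (b / 2) * (\sum_(n < N) cos (a + n%:R * b)) =
    sin (a + (N%:R - 2^-1) * b) - sin (a - b / 2).
  rewrite mulr_sumr -(big_mkord xpredT (fun n => 2 * sin (b / 2) * cos (a + n%:R * b))).
  rewrite (telescope_sumr_eq (fun n => sin (a + (n%:R - 2^-1) * b)))//.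
    by congr (_ - sin _); field.
  move=> k _.
  have -> : a + (k.+1%:R - 2^-1) * b = (a + k%:R * b) + b / 2 by rewrite -natr1; field.
  have -> : a + (k%:R - 2^-1) * b = (a + k%:R * b) - b / 2 by field.
  by rewrite sinD sinB; ring.
rewrite -normrM.
have /(congr1 Num.norm) : sin (b / 2) * \sum_(n < N) cos (a + n%:R * b) =
  (sin (a + (N%:R - 2^-1) * b) - sin (a - b / 2)) / 2 by rewrite -tele; field.
move=> ->; rewrite normrM [`|2^-1|]ger0_norm//.
have le1 (y : R) : `|sin y| <= 1.
  by rewrite ler_norml sin_geN1 sin_le1.
have := ler_normB (sin (a + (N%:R - 2^-1) * b)) (sin (a - b / 2)).
have := le1 (a + (N%:R - 2^-1) * b); have := le1 (a - b / 2).
lra.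
Qed.

End TrigEstimates.

Section Hitting.
Variable R : realType.
Implicit Types (alpha theta x y : R * R).

(** Closeness in the torus for the maximum norm on the universal cover. Boxes
are more convenient than balls here, since the grid and the measure
computations are products. *)
Definition torus_near (r : R) x y : Prop := exists k l : int,
  `|x.1 - y.1 - k%:~R| <= r /\ `|x.2 - y.2 - l%:~R| <= r.

(** A nonnegative trigonometric polynomial of degree [K] with nonnegative
Fourier coefficients, concentrated near the lattice. *)
Definition cos_kernel (K : nat) y : R :=
  cos (pi * y.1) ^+ K.*2 * cos (pi * y.2) ^+ K.*2.

(** The Fourier coefficients of [cos (pi * y) ^ (2 * K)]. *)
Definition bin_weight (K : nat) (j : nat) : R := 2 ^- K.*2 * 'C(K.*2, j)%:R.

Lemma bin_weight_ge0 K j : 0 <= bin_weight K j.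
Proof. by rewrite mulr_ge0// invr_ge0 exprn_ge0. Qed.

Lemma sum_bin_weight K : \sum_(j < K.*2.+1) bin_weight K j = 1.
Proof.
rewrite /bin_weight -mulr_sumr -natr_sum.
have -> : (\sum_(j < K.*2.+1) 'C(K.*2, j) = 2 ^ K.*2)%N.
  rewrite -[2%N]/(1 + 1)%N expnDn; apply: eq_bigr => j _.
  by rewrite !exp1n !muln1.
by rewrite natrX mulVf// expf_neq0.
Qed.

Lemma central_weight_ge K : (K.*2.+1)%:R^-1 <= bin_weight K K.
Proof.
rewrite /bin_weight mulrC ler_pdivlMr ?exprn_gt0// mulrC ler_pdivrMr ?ltr0Sn//.
have -> : 2 ^+ K.*2 = (4 ^ K)%:R :> R by rewrite -mul2n exprM natrX; congr (_ ^+ _); ring.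
by rewrite -natrM ler_nat [leqRHS]mulnC central_bin_ge.
Qed.

Lemma cos_kernel_expand K y : cos_kernel K y =
  \sum_(j < K.*2.+1) \sum_(l < K.*2.+1) bin_weight K j * bin_weight K l *
    cos (((K.*2)%:R - j%:R *+ 2) * (pi * y.1) + ((K.*2)%:R - l%:R *+ 2) * (pi * y.2)).
Proof.
have c1 : cos (pi * y.1) ^+ K.*2 = cos (pi * y.1) ^+ K.*2 * cos 0 by rewrite cos0 mulr1.
rewrite /cos_kernel c1 cos_pow_expand mulr_sumr mulr_suml; apply: eq_bigr => j _.
rewrite add0r -!mulrA [cos _ * _]mulrC cos_pow_expand.
rewrite !mulr_sumr; apply: eq_bigr => l _; rewrite /bin_weight.
by rewrite !mulrA; congr (_ * _); ring.
Qed.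

(** The mean of the kernel contributes its constant coefficient at each step;
every other harmonic oscillates along the orbit, with a geometric sum bounded
by [eta^-1] by nonresonance, and the coefficients sum to one. *)
Lemma cos_kernel_orbit_sum alpha y K (eta : R) N : 0 < eta ->
  nonresonant alpha K eta ->
  (K.*2.+1)%:R ^- 2 * N%:R - eta^-1 <=
    \sum_(n < N) cos_kernel K (y + alpha *+ n).
Proof.
move=> eta0 nonres.
pose b (j l : nat) := ((K.*2)%:R - j%:R *+ 2) * (pi * alpha.1) +
                      ((K.*2)%:R - l%:R *+ 2) * (pi * alpha.2).
pose a (j l : nat) := ((K.*2)%:R - j%:R *+ 2) * (pi * y.1) +
                      ((K.*2)%:R - l%:R *+ 2) * (pi * y.2).
pose T j l := \sum_(n < N) cos (a j l + n%:R * b j l).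
have -> : \sum_(n < N) cos_kernel K (y + alpha *+ n) =
    \sum_(j < K.*2.+1) \sum_(l < K.*2.+1) bin_weight K j * bin_weight K l * T j l.
  under eq_bigr do rewrite cos_kernel_expand.
  rewrite exchange_big; apply: eq_bigr => j _.
  rewrite exchange_big; apply: eq_bigr => l _.
  rewrite /T mulr_sumr; apply: eq_bigr => n _; congr (_ * cos _).
  have -> : (y + alpha *+ n).1 = y.1 + n%:R * alpha.1.
    by rewrite /= mulr_natl; congr (_ + _); have [e1 e2] := pair_mulrn alpha n.
  have -> : (y + alpha *+ n).2 = y.2 + n%:R * alpha.2.
    by rewrite /= mulr_natl; congr (_ + _); have [e1 e2] := pair_mulrn alpha n.
  by rewrite /a /b; ring.
have dK : (K.*2)%:R = K%:R * 2 :> R by rewrite -muln2 natrM.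
have TK : T K K = N%:R.
  rewrite /T /a /b -muln2 natrM mulr_natr subrr !mul0r addr0.
  under eq_bigr do rewrite mulr0 addr0 cos0.
  by rewrite sumr_const card_ord.
have Tle (j l : 'I_K.*2.+1) : (val j != K) || (val l != K) -> - eta^-1 <= T j l.
  move=> jl; pose m1 : int := K%:Z - (val j)%:Z; pose m2 : int := K%:Z - (val l)%:Z.
  have m0 : (m1 != 0) || (m2 != 0) by rewrite !subr_eq0 ![K%:Z == _]eq_sym.
  have small (i : 'I_K.*2.+1) : `|(K%:Z - (val i)%:Z)%:~R : R| <= K%:R.
    rewrite -intr_norm -[K%:R]/(K%:Z%:~R) ler_int.
    by case: i => v hv /=; move: hv; rewrite -muln2; clear; lia.
  have sb : eta <= `|sin (b j l / 2)|.
    have -> : b j l / 2 = pi * (m1%:~R * alpha.1 + m2%:~R * alpha.2).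
      by rewrite /b /m1 /m2 !rmorphB/= dK; field.
    by apply: dist_le_norm_sin => p; apply: nonres => //; exact: small.
  have := orbit_cos_sum (a j l) (b j l) N; rewrite -/(T j l) => le1.
  rewrite lerNl; apply: (@le_trans _ _ `|T j l|); first by rewrite -normrN ler_norm.
  rewrite -[leRHS]mul1r ler_pdivlMr// mulrC.
  by apply: le_trans le1; rewrite ler_wpM2r.
pose c : R := N%:R + eta^-1.
have KK : (K < K.*2.+1)%N by rewrite ltnS -addnn leq_addr.
pose oK := Ordinal KK.
(* Bound the double sum termwise: the central term equals [N], all others are
at least [- eta^-1]. *)
apply: (@le_trans _ _ (\sum_(j < K.*2.+1) \sum_(l < K.*2.+1)
   bin_weight K j * bin_weight K l * ((if (j == oK) && (l == oK) then c else 0) - eta^-1))).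
  have -> : \sum_(j < K.*2.+1) \sum_(l < K.*2.+1)
     bin_weight K j * bin_weight K l * ((if (j == oK) && (l == oK) then c else 0) - eta^-1)
     = bin_weight K K ^+ 2 * c - eta^-1.
    transitivity (\sum_(j < K.*2.+1) (bin_weight K j * (if j == oK then bin_weight K K * c else 0) - bin_weight K j * eta^-1)).
      apply: eq_bigr => j _.
      under eq_bigr do rewrite mulrBr.
      rewrite sumrB; congr (_ - _).
        rewrite (bigD1 oK)//= big1 ?addr0 ?eqxx ?andbT.
          by case: ifP => _; rewrite ?mulr0 ?mulrA.
        by move=> i /negbTE ->; rewrite andbF mulr0.
      by rewrite -mulr_suml -mulr_sumr sum_bin_weight mulr1.
    rewrite sumrB -mulr_suml sum_bin_weight mul1r; congr (_ - _).
    rewrite (bigD1 oK)//= big1 ?addr0 ?eqxx; first by rewrite mulrA expr2.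
    by move=> i /negbTE ->; rewrite mulr0.
  rewrite lerB//; apply: (@le_trans _ _ (K.*2.+1%:R ^- 2 * c)).
    by rewrite ler_wpM2l ?invr_ge0 ?exprn_ge0// /c lerDl invr_ge0 ltW.
  rewrite ler_wpM2r ?addr_ge0 ?invr_ge0 ?(ltW eta0)//.
  by rewrite -exprVn lerXn2r ?nnegrE ?invr_ge0 ?bin_weight_ge0 ?central_weight_ge.
apply: ler_sum => j _; apply: ler_sum => l _.
rewrite ler_wpM2l ?mulr_ge0 ?bin_weight_ge0//.
case: ifP => [/andP[/eqP -> /eqP ->]|/negbT].
  by rewrite /c addrK TK.
by rewrite negb_and sub0r; exact: Tle.
Qed.

Lemma cos_kernel_far K r y : 0 <= r -> r <= 1 ->
  ~ torus_near r y 0 -> cos_kernel K y <= (1 - r ^+ 2) ^+ K.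
Proof.
move=> r0 r1 far.
have sq u : cos (pi * u) ^+ K.*2 = (1 - sin (pi * u) ^+ 2) ^+ K.
  by rewrite -muln2 mulnC exprM cos2sin2.
have sle (u : R) : sin (pi * u) ^+ 2 <= 1 by have := cos2Dsin2 (pi * u); have := sqr_ge0 (cos (pi * u)); lra.
have pos u : 0 <= (1 - sin (pi * u) ^+ 2) ^+ K.
  by rewrite exprn_ge0// subr_ge0.
have le1 u : (1 - sin (pi * u) ^+ 2) ^+ K <= 1.
  by rewrite exprn_ile1 ?subr_ge0// lerBlDr lerDl sqr_ge0.
have main (u : R) : (forall k : int, r <= `|u + k%:~R|) ->
    (1 - sin (pi * u) ^+ 2) ^+ K <= (1 - r ^+ 2) ^+ K.
  move=> h; have hs := dist_le_norm_sin h.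
  have h2 : r ^+ 2 <= sin (pi * u) ^+ 2 by rewrite -[leRHS]real_normK ?num_real// lerXn2r ?nnegrE.
  have r2 := le_trans h2 (sle u).
  by rewrite lerXn2r ?nnegrE ?subr_ge0 ?lerB.
rewrite /cos_kernel !sq.
have [h|/existsNP [k hk]] := pselect (forall k : int, r <= `|y.1 + k%:~R|).
  by apply: (le_trans _ (main _ h)); rewrite ler_piMr ?pos ?le1.
have [h|/existsNP [l hl]] := pselect (forall k : int, r <= `|y.2 + k%:~R|).
  by apply: (le_trans _ (main _ h)); rewrite ler_piMl ?pos ?le1.
exfalso; apply: far; exists (- k), (- l).
by rewrite /= !subr0 !rmorphN !opprK; split; rewrite ltW// ltNge; apply/negP.
Qed.

(** One term of the exponential series. *)
Lemma expR_beats_pow (n : nat) : exists x0 : nat, forall x : nat, (x0 <= x)%N ->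
  x%:R ^+ n <= expR (x%:R : R).
Proof.
exists (n.+1)`!%N => x hx.
apply: (@le_trans _ _ (1 + x%:R ^+ n.+1 / (n.+1)`!%:R)); last exact: expR_ge1Dxn.
rewrite -[leLHS]add0r lerD// exprS ler_pdivlMr ?ltr0n ?fact_gt0// mulrC.
by rewrite ler_wpM2r ?exprn_ge0// ler_nat.
Qed.

Lemma pow_one_sub_le (a : R) (n : nat) : a <= 1 ->
  (1 - a) ^+ n <= expR (- (n%:R * a)).
Proof.
move=> a1; rewrite -mulrN expRM_natl lerXn2r ?nnegrE ?expR_ge0 ?subr_ge0//.
exact: expR_ge1Dx.
Qed.

(** If no point of the orbit came close to [x], the kernel centred at [x] with
[K = Q ^ 3] would be exponentially small in [Q] along the orbit, whereas its
orbit average is at least about [Q ^- 6] by nonresonance. *)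
Lemma orbit_hits alpha (C : nat) : exists C' Q0 : nat, forall Q : nat, (Q0 <= Q)%N ->
  nonresonant alpha (Q ^ 3) (Q%:R ^- C) ->
  forall theta x, exists n : nat, (n < Q ^ C')%N /\
    torus_near (Q%:R^-1) (theta + alpha *+ n) x.
Proof.
have [x0 hx0] := expR_beats_pow 12.
exists (C + 12)%N, (maxn x0 2) => Q; rewrite geq_max => /andP[Qx0 Q2] nonres theta x.
apply: contrapT => /forallNP none.
have q2 : 2 <= Q%:R :> R by rewrite ler_nat.
set q := Q%:R : R in q2 *; have q0 : 0 < q by lra.
have q1 : 1 <= q by lra.
set N := (Q ^ (C + 12))%N in none.
have := @cos_kernel_orbit_sum alpha (theta - x) (Q ^ 3) (Q%:R ^- C) N.
rewrite invr_gt0 exprn_gt0// invrK => /(_ isT nonres); apply/negP; rewrite -ltNge.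
have up (n : 'I_N) : cos_kernel (Q ^ 3) (theta - x + alpha *+ n) <= q ^- 12.
  apply: (@le_trans _ _ ((1 - q^-1 ^+ 2) ^+ (Q ^ 3))).
    apply: cos_kernel_far; rewrite ?invr_ge0 ?(ltW q0)// ?invf_le1//.
    rewrite addrAC => -[k [l kl]]; apply: (none n); split=> //; exists k, l.
    by move: kl; rewrite /= !subr0.
  apply: (@le_trans _ _ (expR (- q))).
    have -> : - q = - ((Q ^ 3)%:R * q^-1 ^+ 2).
      by rewrite natrX -/q; clearbody q; field; exact: lt0r_neq0.
    apply: pow_one_sub_le; rewrite exprn_ile1 ?invr_ge0 ?(ltW q0)// invf_le1//.
  by rewrite expRN lef_pV2 ?posrE ?expR_gt0 ?exprn_gt0// hx0.
apply: (@le_lt_trans _ _ (N%:R * q ^- 12)).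
  by apply: (le_trans (ler_sum _ (fun n _ => up n))); rewrite sumr_const card_ord mulr_natl.
rewrite /N natrX -/q exprD mulfK ?expf_neq0 ?lt0r_neq0//.
have K10 : ((Q ^ 3).*2.+1)%:R ^+ 2 <= q ^+ 10.
  have -> : q ^+ 10 = (q ^+ 5) ^+ 2 by rewrite -exprM.
  rewrite lerXn2r ?nnegrE ?exprn_ge0 ?(ltW q0)//.
  rewrite -natrX ler_nat -muln2.
  have : (1 <= Q ^ 3)%N by rewrite expn_gt0 (leq_trans _ Q2).
  by rewrite -[(Q ^ 5)%N]/(Q ^ (3 + 2))%N expnD; move: (Q ^ 3)%N => A; nia.
apply: (@lt_le_trans _ _ (q ^- 10 * (q ^+ C * q ^+ 12) - q ^+ C)); last first.
  rewrite lerB// ler_wpM2r ?mulr_ge0 ?exprn_ge0 ?(ltW q0)//.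
  by rewrite lef_pV2 ?posrE ?exprn_gt0.
have -> : q ^- 10 * (q ^+ C * q ^+ 12) - q ^+ C = q ^+ C * (q ^+ 2 - 1).
  by field; exact: lt0r_neq0.
by rewrite ltr_pMr ?exprn_gt0// expr2; nra.
Qed.

End Hitting.

(** * How often an orbit visits a small box *)

Section Visits.
Variable R : realType.
Implicit Types (alpha theta x y z : R * R) (r s : R).

Lemma torus_near_sym r x y : torus_near r x y -> torus_near r y x.
Proof.
move=> [k [l [h1 h2]]]; exists (- k), (- l).
rewrite !rmorphN /=; split.
  by have -> : y.1 - x.1 - - k%:~R = - (x.1 - y.1 - k%:~R); [ring | rewrite normrN].
by have -> : y.2 - x.2 - - l%:~R = - (x.2 - y.2 - l%:~R); [ring | rewrite normrN].
Qed.

Lemma torus_near_trans r s x y z :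
  torus_near r x y -> torus_near s y z -> torus_near (r + s) x z.
Proof.
move=> [k [l [h1 h2]]] [k' [l' [h1' h2']]]; exists (k + k'), (l + l').
rewrite !rmorphD/=; split.
  have -> : x.1 - z.1 - (k%:~R + k'%:~R) = (x.1 - y.1 - k%:~R) + (y.1 - z.1 - k'%:~R) by ring.
  by apply: (le_trans (ler_normD _ _)); apply: lerD.
have -> : x.2 - z.2 - (l%:~R + l'%:~R) = (x.2 - y.2 - l%:~R) + (y.2 - z.2 - l'%:~R) by ring.
by apply: (le_trans (ler_normD _ _)); apply: lerD.
Qed.

Lemma torus_near_shift r x y z : torus_near r x y -> torus_near r (x + z) (y + z).
Proof.
move=> [k [l [h1 h2]]]; exists k, l.
by split; rewrite /= opprD addrACA subrr addr0.
Qed.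

Lemma torus_near_le r s x y : r <= s -> torus_near r x y -> torus_near s x y.
Proof.
by move=> rs [k [l [h1 h2]]]; exists k, l; split; apply: le_trans rs.
Qed.

Definition dense_orbits alpha : Prop := forall r, 0 < r -> exists N : nat,
  forall theta x, exists n : nat, (n < N)%N /\ torus_near r (theta + alpha *+ n) x.

(** At a nonresonant scale finer than [r], [orbit_hits] gives a uniform
hitting time. *)
Lemma orbit_dense alpha c t : 0 < c -> int_independent alpha ->
  simult_dioph c t alpha -> dense_orbits alpha.
Proof.
move=> c0 indep dioph r r0.
have [C scales] := nonresonant_scales c0 indep dioph.
have [C' [Q0 hits]] := orbit_hits alpha C.
have [Q1 [Q1gt0 Q1r]] := nat_above r^-1.
have [Q [QQ nonres]] := scales (maxn Q0 Q1).
move: QQ; rewrite geq_max => /andP[QQ0 QQ1].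
exists (Q ^ C')%N => theta x.
have [n [nQ near]] := hits Q QQ0 nonres theta x.
exists n; split=> //; apply: torus_near_le near.
have Q1x : Q1%:R <= Q%:R :> R by rewrite ler_nat.
have Qp : 0 < Q%:R :> R by rewrite ltr0n (leq_trans Q1gt0).
by rewrite -[leRHS]invrK lef_pV2 ?posrE ?invr_gt0// ltW// (lt_le_trans Q1r).
Qed.

Definition visit_set alpha theta (n : nat) x r : {set 'I_n} :=
  [set i : 'I_n | `[< torus_near r (theta + alpha *+ i) x >] ]%SET.

(** A box of radius [r] has [q ^ 2] translates, by the points of the grid of
mesh [1 / q], that stay disjoint when slightly enlarged. By density each
translation is nearly realized by a bounded time [j ab < J], so each visit to
the box yields one visit to each translate at a shifted time. Those [q ^ 2]
times the number of visits are distinct times below [n + J]. *)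
Lemma card_visit_set_le alpha (q : nat) r : dense_orbits alpha -> (0 < q)%N ->
  2 * r < q%:R^-1 -> exists J : nat, forall theta x n,
    (q ^ 2 * #|visit_set alpha theta n x r| <= n + J)%N.
Proof.
move=> dense q0 rq; pose s := (q%:R^-1 - 2 * r) / 4.
have s0 : 0 < s by rewrite divr_gt0 ?subr_gt0.
have [J hJ] := dense s s0.
pose g (ab : 'I_q * 'I_q) : R * R := (ab.1%:R / q%:R, ab.2%:R / q%:R).
have /choice [j hj] : forall ab, exists n : nat, (n < J)%N /\ torus_near s (alpha *+ n) (g ab).
  by move=> ab; have [n] := hJ 0 (g ab); rewrite add0r => ?; exists n.
exists J => theta x n.
set A := visit_set alpha theta n x r.
have ltJ (i : 'I_n) ab : (i + j ab < n + J)%N.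
  by rewrite -addnS; apply: leq_add; [exact: ltnW|exact: (hj ab).1].
pose f (w : 'I_n * ('I_q * 'I_q)) : 'I_(n + J) := Ordinal (ltJ w.1 w.2).
have qp : 0 < q%:R :> R by rewrite ltr0n.
have sep (a b : 'I_q) (k : int) :
    `|a%:R / q%:R - b%:R / q%:R - k%:~R| < q%:R^-1 :> R -> a = b.
  move=> h.
  have : `|(a%:Z - b%:Z - k * q%:Z)%:~R : R| < 1.
    have -> : (a%:Z - b%:Z - k * q%:Z)%:~R =
              (a%:R / q%:R - b%:R / q%:R - k%:~R) * q%:R :> R.
      by rewrite !rmorphB/= rmorphM/=; field; exact: lt0r_neq0.
    by rewrite normrM [`|q%:R|]ger0_norm// -ltr_pdivlMr// mul1r.
  move/intr_norm_lt1 => e; apply/val_inj => /=.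
  case: a b e {h} => a la [b lb] /= e.
  move: la lb e; clear; move=> la lb e.
  have k0 : k = 0 by nia.
  by move: e; rewrite k0; lia.
have finj : {in finset.setX A (finset.setT : {set 'I_q * 'I_q}) &, injective f}.
  move=> [i ab] [i' ab']; rewrite !inE !andbT => /= /asboolP hi /asboolP hi' /(congr1 val)/= e.
  have near (k : 'I_n) (cd : 'I_q * 'I_q) : torus_near r (theta + alpha *+ k) x ->
      torus_near (r + s) (theta + alpha *+ (k + j cd)) (x + g cd).
    move=> hk; rewrite mulrnDr addrA.
    apply: torus_near_trans (torus_near_shift _ hk) _.
    rewrite [x + _]addrC [x + _]addrC; apply: torus_near_shift; exact: (hj cd).2.
  have h1 := near i ab hi; have h2 := near i' ab' hi'.
  rewrite e in h1.
  have [k [l [nk nl]]] := torus_near_trans (torus_near_sym h1) h2.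
  have sm : r + s + (r + s) < q%:R^-1 by rewrite /s; lra.
  have eab : ab = ab'.
    rewrite /= opprD addrACA subrr add0r in nk.
    rewrite /= opprD addrACA subrr add0r in nl.
    case: ab ab' {hi hi' e h1 h2} nk nl => a b [a' b'] /= nk nl.
    by rewrite (sep _ _ _ (le_lt_trans nk sm)) (sep _ _ _ (le_lt_trans nl sm)).
  by rewrite eab in e *; congr (_, _); apply/val_inj => /=; move/addIn: e.
have := card_in_imset finj; rewrite cardsX cardsT card_prod card_ord => e.
rewrite mulnC -mulnn -e.
by rewrite -[X in (_ <= X)%N](card_ord (n + J)) max_card.
Qed.

End Visits.

(** * Economical coverings of smooth boundaries *)

Section BoundaryCovering.
Variable R : realType.
Implicit Types (x y p q : R * R) (M : set (R * R)).

(** A quantitative form of being at most one-dimensional in the torus: the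
covering number at scale [1 / n] is [O(n)]. *)
Definition linear_covering M : Prop := exists C : nat, forall n : nat, (0 < n)%N ->
  exists ps : seq (R * R), (size ps <= C * n)%N /\
    forall x, M x -> exists2 p, p \in ps & torus_near n%:R^-1 x p.

Lemma linear_covering0 : linear_covering set0.
Proof. by exists 0%N => n _; exists [::]; split. Qed.

Lemma linear_coveringU M M' : linear_covering M -> linear_covering M' ->
  linear_covering (M `|` M').
Proof.
move=> [C h] [C' h']; exists (C + C')%N => n n0.
have [ps [s c]] := h n n0; have [ps' [s' c']] := h' n n0.
exists (ps ++ ps'); split; first by rewrite size_cat mulnDl leq_add.
move=> x [/c|/c'] [p pin near]; exists p => //; by rewrite mem_cat pin ?orbT.
Qed.

Lemma linear_coveringS M M' : M `<=` M' -> linear_covering M' -> linear_covering M.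
Proof.
move=> sub [C h]; exists C => n n0; have [ps [s c]] := h n n0.
by exists ps; split=> // x /sub /c.
Qed.

(** The sets whose removal leaves a linearly covered rest form a filter, and a
cluster point of it would contradict the local coverings. *)
Lemma linear_covering_compact M : compact M ->
  (forall p, M p -> exists2 U, nbhs p U & linear_covering (M `&` U)) ->
  linear_covering M.
Proof.
move=> cM loc; apply: contrapT => nM.
pose F : set_system (R * R) := [set A | linear_covering (M `\` A)].
have FF : ProperFilter F.
  apply: Build_ProperFilter; first by rewrite /F/= setD0.
  split.
  - by rewrite /F/= setDT; exact: linear_covering0.
  - by move=> A B hA hB; rewrite /F/= setDIr; exact: linear_coveringU.
  - by move=> A B AB; apply: linear_coveringS; exact: setDS.
have [|p [Mp cp]] := cM F FF.
  by rewrite /F/= setDv; exact: linear_covering0.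
have [U Up cU] := loc p Mp.
have FU : F (~` U) by rewrite /F/= setDE setCK.
by have [x []] := cp _ _ FU Up.
Qed.

Lemma linear_covering_periodic M : periodic_set M ->
  linear_covering (M `&` (`[0, 1]%classic `*` `[0, 1]%classic)) -> linear_covering M.
Proof.
move=> per [C h]; exists C => n n0; have [ps [s c]] := h n n0.
exists ps; split=> // x Mx.
pose k := Num.floor x.1; pose l := Num.floor x.2.
have /andP[k1 k2] := mem_rg1_floor x.1; have /andP[l1 l2] := mem_rg1_floor x.2.
have [|p pin [k' [l' [h1 h2]]]] := c (x + lattice R (- k) (- l)).
  split; first by apply/per.
  split; rewrite /= in_itv/= !rmorphN/= -/k -/l in k1 k2 l1 l2 *; lra.
exists p => //; exists (k' + k), (l' + l); rewrite /lattice /= !rmorphN/= in h1 h2.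
by rewrite !rmorphD/= !opprD; split; [apply: le_trans h1|apply: le_trans h2];
   rewrite le_eqVlt; apply/orP; left; apply/eqP; congr Num.norm; ring.
Qed.

Lemma boundary_periodic M : periodic_set M -> periodic_set (boundary M).
Proof.
move=> per.
have shift k l p : boundary M p -> boundary M (p + lattice R k l).
  have cont : continuous (fun q : R * R => q + lattice R k l).
    by move=> q; apply: cvgD; [exact: cvg_id|exact: cvg_cst].
  move=> [cl ni]; split.
    move=> B nB; have [y [My By]] := cl _ (cont p B nB).
    by exists (y + lattice R k l); split=> //; apply/per.
  move=> int; apply: ni.
  rewrite /interior /= in int *.
  have H : nbhs p ((fun q => q + lattice R k l) @^-1` M) := cont p _ int.
  by apply: filterS H => q /= /per.
move=> k l p; split; last exact: shift.
move=> /(shift (- k) (- l)).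
suff -> : p + lattice R k l + lattice R (- k) (- l) = p by [].
by rewrite /lattice !rmorphN -addrA; case: p => a b; congr (_, _) => /=; ring.
Qed.

(** The mean value theorem for the two coordinates of a slice [u -> chi (u,
s)], written for an abstract projection [pr]. *)
Lemma curve_lipschitz (chi : R * R -> R * R) (L a b s : R) :
  (forall u, a <= u <= b -> derivable chi (u, s) (1, 0)) ->
  (forall u, a <= u <= b -> `|'D_(1, 0) chi (u, s)| <= L) ->
  forall u v, a <= u <= b -> a <= v <= b ->
    `|(chi (u, s)).1 - (chi (v, s)).1| <= L * `|u - v| /\
    `|(chi (u, s)).2 - (chi (v, s)).2| <= L * `|u - v|.
Proof.
move=> der bound.
have diff_cvg u : a <= u <= b ->
   h^-1 *: (chi (h + u, s) - chi (u, s)) @[h --> 0^'] --> 'D_(1, 0) chi (u, s).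
  move=> /der; rewrite /derivable => /cvgP; apply: cvg_trans.
  apply: near_eq_cvg; near=> h.
  suff -> : (chi \o shift (u, s)) (h *: (1, 0)) = chi (h + u, s) by [].
  rewrite /= /shift /=; congr chi; apply: injective_projections => /=.
    by rewrite -[h *: 1]/(h * 1) mulr1.
  by rewrite scaler0 add0r.
have lip (pr : R * R -> R) : (forall x, continuous_at x pr) -> 
  (forall x y, pr (x - y) = pr x - pr y) -> (forall (h : R) x, pr (h *: x) = h *: pr x) ->
  (forall x, `|pr x| <= `|x|) -> forall u v, a <= u <= b -> a <= v <= b -> u <= v ->
  `|pr (chi (u, s)) - pr (chi (v, s))| <= L * `|u - v|.
  move=> prc prB prZ prn u v hu hv uv.
  pose c t := pr (chi (t, s)).
  have isd t : a <= t <= b -> is_derive t 1 c (pr ('D_(1, 0) chi (t, s))).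
    move=> ht.
    have cv : h^-1 *: ((c \o shift t) (h *: 1) - c t) @[h --> 0^'] --> pr ('D_(1, 0) chi (t, s)).
      have := cvg_comp _ _ (diff_cvg t ht) (prc _).
      apply: cvg_trans; apply: near_eq_cvg; near=> h.
      by rewrite /= prZ prB /c [h *: 1]mulr1.
    by apply: DeriveDef; [apply/cvg_ex; eexists; exact: cv|exact: cvg_lim cv].
  have [] := @MVT_segment R c (fun t => pr ('D_(1, 0) chi (t, s))) u v uv.
  - move=> t; rewrite in_itv/= => /andP[t1 t2]; apply: isd; lra.
  - apply: derivable_within_continuous => t; rewrite in_itv/= => ht.
    by apply: ex_derive; apply: isd; lra.
  move=> t; rewrite in_itv/= => ht e.
  rewrite distrC -/(c v) -/(c u) e normrM distrC [`|u - v|]distrC ler_wpM2r//.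
  by apply: (le_trans (prn _)); apply: bound; lra.
have n1 x : `|x.1| <= `|x| by rewrite prod_normE le_max lexx.
have n2 x : `|x.2| <= `|x| by rewrite prod_normE le_max lexx orbT.
move=> u v hu hv; split.
  have [uv|vu] := leP u v.
    by apply: (lip fst) => //; move=> x; exact: cvg_fst.
  rewrite distrC [`|u - v|]distrC.
  by apply: (lip fst) => //; [move=> x; exact: cvg_fst|exact: ltW].
have [uv|vu] := leP u v.
  by apply: (lip snd) => //; move=> x; exact: cvg_snd.
rewrite distrC [`|u - v|]distrC.
by apply: (lip snd) => //; [move=> x; exact: cvg_snd|exact: ltW].
Unshelve. all: by end_near. Qed.

(** A Lipschitz image of a segment is covered by the images of a subdivision
whose number of points is proportional to [n]. *)
Lemma linear_covering_curve (chi : R * R -> R * R) (L a b s : R) M : a <= b ->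
  (forall u v, a <= u <= b -> a <= v <= b ->
    `|(chi (u, s)).1 - (chi (v, s)).1| <= L * `|u - v| /\
    `|(chi (u, s)).2 - (chi (v, s)).2| <= L * `|u - v|) ->
  (forall x, M x -> exists2 t, a <= t <= b & x = chi (t, s)) ->
  linear_covering M.
Proof.
move=> ab lip param.
have [C [C0 CL]] := nat_above (`|L| * (b - a)).
exists C.+1 => n n0; pose m := (C * n)%N.
have m0 : 0 < m%:R :> R by rewrite ltr0n muln_gt0 C0.
pose h := (b - a) / m%:R.
have h0 : 0 <= h by rewrite divr_ge0 ?subr_ge0// ltW.
exists [seq chi (a + i%:R * h, s) | i <- iota 0 m.+1]; split.
  by rewrite size_map size_iota mulSn -addn1 addnC leq_add.
move=> x /param [t /andP[at_ tb] ->].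
have [i [im ti]] : exists i : nat, (i <= m)%N /\ 0 <= t - (a + i%:R * h) <= h.
  have bam : b - a = m%:R * h by rewrite /h mulrC divfK// gt_eqF.
  have [h00|hn0] := eqVneq h 0.
    exists 0%N; split=> //; move: bam; rewrite h00 !mulr0 addr0; lra.
  have hp : 0 < h by rewrite lt0r hn0.
  pose i := Num.truncn ((t - a) / h).
  have x0 : 0 <= (t - a) / h by rewrite divr_ge0 ?subr_ge0.
  have /andP[i1 i2] := truncn_itv x0.
  rewrite -/i ler_pdivlMr// in i1; rewrite -/i ltr_pdivrMr// -natr1 in i2.
  exists i; split; last by lra.
  rewrite -(ler_nat R) -(ler_pM2r hp) -bam; lra.
exists (chi (a + i%:R * h, s)).
  by apply/mapP; exists i; rewrite // mem_iota add0n ltnS.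
have /andP[t1 t2] := ti.
have ih0 : 0 <= i%:R * h by rewrite mulr_ge0.
have ihm : i%:R * h <= b - a.
  have -> : b - a = m%:R * h by rewrite /h mulrC divfK// gt_eqF.
  by rewrite ler_wpM2r// ler_nat.
have [] := lip t (a + i%:R * h); [by rewrite at_|lra|move=> l1 l2].
exists 0, 0; rewrite !subr0.
suff small : L * `|t - (a + i%:R * h)| <= n%:R^-1 by split; apply: le_trans small.
apply: (@le_trans _ _ (`|L| * h)).
  rewrite ger0_norm//; apply: (@le_trans _ _ (`|L| * (t - (a + i%:R * h)))).
    by rewrite ler_wpM2r// ler_norm.
  by rewrite ler_wpM2l.
by rewrite /h mulrA ler_pdivrMr// /m natrM mulrCA mulVf ?mulr1 ?ltW// pnatr_eq0 -lt0n.
Qed.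

(** By periodicity and compactness only a neighbourhood of each boundary point
matters; there the inverse of a slice chart parametrizes the boundary by a
segment, with bounded derivative. *)
Lemma linear_covering_boundary M : periodic_set M -> smooth_curve (boundary M) ->
  linear_covering (boundary M).
Proof.
move=> per smooth; apply: linear_covering_periodic; first exact: boundary_periodic.
apply: linear_covering_compact.
  have cptI : compact (`[0, 1]%classic `*` `[0, 1]%classic : set (R * R)).
    by apply: compact_setX; exact: segment_compact.
  have clB : closed (boundary M).
    rewrite /boundary setDE; apply: closedI; first exact: closed_closure.
    exact/open_closedC/open_interior.
  have clI : closed (`[0, 1]%classic `*` `[0, 1]%classic : set (R * R)).
    by apply: compact_closed => //; exact: norm_hausdorff.
  exact: subclosed_compact (closedI clB clI) cptI (@subIsetr _ _ _).
move=> p [bp _].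
have [U [V [psi [chi [[oU Up] oV [spsi schi] [UV VU] eqM]]]]] := smooth p bp.
have [Vw chiw] := UV p Up.
have := bp; rewrite -[X in X -> _]/(boundary M p) => bp'.
have psip2 : psi p = ((psi p).1, 0).
  have : (boundary M `&` U) p by []; rewrite eqM => -[_ e].
  by rewrite -e; case: (psi p).
set w := psi p in Vw chiw psip2 *.
have [_ /(_ (1, 0))[chider [chicont _]]] := schi 1%N.
pose L := `|'D_(1, 0) chi w| + 1.
have nV : nbhs w (V `&` [set y | `|'D_(1, 0) chi y| <= L]).
  apply: filterI; first exact: open_nbhs_nbhs.
  have : `|'D_(1, 0) chi y| @[y --> w] --> `|'D_(1, 0) chi w|.
    by apply: cvg_norm; exact: chicont.
  move=> /cvgrPdist_lt /(_ 1 ltr01); apply: filterS => y /=.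
  by move=> /ltW; rewrite distrC ler_distl /L => /andP[].
have [eta /= eta0 ballV] : exists2 eta : R, 0 < eta & ball w eta `<=` V `&` [set y | `|'D_(1, 0) chi y| <= L].
  by move/nbhs_ballP: nV => -[e e0 h]; exists e.
exists (U `&` psi @^-1` (ball w (eta / 2))).
  apply: filterI; first exact: open_nbhs_nbhs.
  have := (spsi 0%N).1 p Up; apply.
  by apply: nbhsx_ballx; rewrite divr_gt0.
have inball u : w.1 - eta / 2 <= u <= w.1 + eta / 2 -> ball w eta (u, 0).
  move=> /andP[u1 u2]; split => /=; rewrite /ball /=.
    by rewrite ltr_distl; lra.
  by rewrite psip2 /= subrr normr0.
apply: (@linear_covering_curve chi L (w.1 - eta / 2) (w.1 + eta / 2) 0); first by lra.
  apply: curve_lipschitz => u /inball /ballV [Vu Lu] //; exact: chider.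
move=> x [[bx _] [Ux bl]].
have : (boundary M `&` U) x by []; rewrite eqM => -[_ e].
exists (psi x).1; last by rewrite -{1}(UV x Ux).2 -e; case: (psi x).
have [/=] := bl; rewrite /ball /= ltr_distl => /andP[]; lra.
Qed.

End BoundaryCovering.

(** * Norms of two by two matrices *)

Section MatrixNorm.
Variable R : realType.
Local Notation C := R[i].
Local Notation normc := (@ComplexField.Normc.normc R).
Implicit Types (A B : 'M[C]_2) (z w : C).

Lemma normc_ge0 z : 0 <= normc z.
Proof. by case: z => a b; exact: sqrtr_ge0. Qed.

Lemma normcD z w : normc (z + w) <= normc z + normc w.
Proof. exact: (@le_normcD R z w). Qed.

Lemma normcB z w : normc (z - w) = normc (w - z).
Proof. by rewrite -opprB (@normcN R). Qed.

Lemma normc_real (x : R) : normc x%:C = `|x|.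
Proof. by rewrite /= expr0n addr0 sqrtr_sqr. Qed.

Lemma normcM z w : normc (z * w) = normc z * normc w.
Proof. exact: ComplexField.Normc.normcM. Qed.

Lemma normc_sum (I : Type) (s : seq I) (P : pred I) (F : I -> C) :
  normc (\sum_(i <- s | P i) F i) <= \sum_(i <- s | P i) normc (F i).
Proof.
elim/big_ind2: _ => [|x1 x2 y1 y2 h1 h2|//]; first by rewrite ComplexField.Normc.normc0.
by apply: (le_trans (normcD _ _)); apply: lerD.
Qed.

Lemma normc_Re z : `|complex.Re z| <= normc z.
Proof.
case: z => a b /=; rewrite -sqrtr_sqr ler_sqrt ?addr_ge0 ?sqr_ge0//.
by rewrite lerDl sqr_ge0.
Qed.

Lemma normc_Im z : `|complex.Im z| <= normc z.
Proof.
case: z => a b /=; rewrite -sqrtr_sqr ler_sqrt ?addr_ge0 ?sqr_ge0//.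
by rewrite lerDr sqr_ge0.
Qed.

(** The sum of the absolute values of the entries: submultiplicative and
comparable to the operator norm, but computable. *)
Definition mnorm A : R := \sum_i \sum_j normc (A i j).

Lemma mnorm_ge0 A : 0 <= mnorm A.
Proof. by apply: sumr_ge0 => i _; apply: sumr_ge0 => j _; exact: normc_ge0. Qed.

Lemma mnormD A B : mnorm (A + B) <= mnorm A + mnorm B.
Proof.
rewrite /mnorm -big_split/=; apply: ler_sum => i _.
by rewrite -big_split/=; apply: ler_sum => j _; rewrite mxE normcD.
Qed.

Lemma mnormB A B : mnorm (A - B) = mnorm (B - A).
Proof.
by apply: eq_bigr => i _; apply: eq_bigr => j _; rewrite !mxE normcB.
Qed.

Lemma mnorm_le_add A B : mnorm A <= mnorm B + mnorm (A - B).
Proof. by apply: le_trans (mnormD _ _); rewrite addrC subrK. Qed.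

Lemma mnormM A B : mnorm (A *m B) <= mnorm A * mnorm B.
Proof.
rewrite /mnorm mulr_suml; apply: ler_sum => i _.
rewrite mulr_suml; apply: (@le_trans _ _ (\sum_j \sum_k normc (A i k) * normc (B k j))).
  apply: ler_sum => j _; rewrite mxE; apply: (le_trans (normc_sum _ _ _)).
  by apply: ler_sum => k _; rewrite normcM.
rewrite exchange_big/=; apply: ler_sum => k _.
rewrite -mulr_sumr; apply: ler_wpM2l; first exact: normc_ge0.
rewrite [leRHS](bigD1 k)//= lerDl; apply: sumr_ge0 => l _.
by apply: sumr_ge0 => j _; exact: normc_ge0.
Qed.

Lemma mnorm1 : mnorm 1%:M = 2.
Proof.
rewrite /mnorm !big_ord_recl !big_ord0 !mxE/=.
by rewrite !expr1n !expr0n !addr0 sqrtr1 sqrtr0; ring.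
Qed.

Lemma normc_le_norm2 (v : 'cV[C]_2) i : normc (v i 0) <= norm2 v.
Proof.
rewrite -[leLHS]ger0_norm ?normc_ge0// -sqrtr_sqr ler_sqrt ?sumr_ge0//.
rewrite (bigD1 i)//= lerDl sumr_ge0// => k _; exact: sqr_ge0.
by move=> k _; exact: sqr_ge0.
Qed.

(** The Euclidean norm is at most the sum of the coordinates. *)
Lemma norm2_mul_le A v : norm2 v <= 1 -> norm2 (A *m v) <= mnorm A.
Proof.
move=> v1.
have e i : normc ((A *m v) i 0) <= \sum_j normc (A i j).
  rewrite mxE; apply: (le_trans (normc_sum _ _ _)); apply: ler_sum => j _.
  rewrite normcM ler_piMr ?normc_ge0//.
  exact: le_trans (normc_le_norm2 _ _) v1.
rewrite -[leRHS]ger0_norm ?mnorm_ge0// -sqrtr_sqr ler_sqrt ?sqr_ge0//.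
rewrite /mnorm !big_ord_recl big_ord0 addr0.
set i0 := ord0; set i1 := lift ord0 ord0.
have := e i0; have := e i1; rewrite !big_ord_recl !big_ord0.
have := normc_ge0 ((A *m v) i0 0); have := normc_ge0 ((A *m v) i1 0).
move: (normc ((A *m v) i0 0)) (normc ((A *m v) i1 0)) => a b.
rewrite !addr0.
have := normc_ge0 (A i0 ord0); have := normc_ge0 (A i0 (lift ord0 ord0)).
have := normc_ge0 (A i1 ord0); have := normc_ge0 (A i1 (lift ord0 ord0)).
move: (_ + _) (_ + _) => c d.
nra.
Qed.

Lemma opnorm_has_sup A : has_sup [set norm2 (A *m v) | v in [set v | norm2 v <= 1]].
Proof.
split.
  exists (norm2 (A *m 0)), 0 => //=.
  by rewrite /norm2 big1 ?sqrtr0// => i _; rewrite mxE ComplexField.Normc.normc0 expr0n.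
by exists (mnorm A) => _ [v v1 <-]; exact: norm2_mul_le.
Qed.

Lemma opnorm_le_mnorm A : opnorm A <= mnorm A.
Proof.
apply: ge_sup; first exact: (opnorm_has_sup A).1.
by move=> _ [v v1 <-]; exact: norm2_mul_le.
Qed.

Lemma norm2_col_le_opnorm A j : norm2 (A *m delta_mx j 0) <= opnorm A.
Proof.
apply: ub_le_sup; first exact: (opnorm_has_sup A).2.
exists (delta_mx j 0) => //=; rewrite /norm2 (bigD1 j)//= big1 => [|i ij].
  by rewrite mxE !eqxx ComplexField.Normc.normc1 expr1n addr0 sqrtr1.
by rewrite mxE (negbTE ij) ComplexField.Normc.normc0 expr0n.
Qed.

Lemma entry_le_opnorm A i j : normc (A i j) <= opnorm A.
Proof.
apply: le_trans (norm2_col_le_opnorm A j).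
apply: le_trans (normc_le_norm2 _ i).
rewrite mxE (bigD1 j)//= big1 => [|k kj]; first by rewrite mxE !eqxx mulr1 addr0.
by rewrite mxE (negbTE kj) mulr0.
Qed.

Lemma mnorm_le_opnorm A : mnorm A <= 4 * opnorm A.
Proof.
rewrite /mnorm !big_ord_recl !big_ord0 !addr0.
have e i j := entry_le_opnorm A i j.
have := e ord0 ord0; have := e ord0 (lift ord0 ord0).
have := e (lift ord0 ord0) ord0; have := e (lift ord0 ord0) (lift ord0 ord0).
lra.
Qed.

Lemma det_mx2 A (i1 := lift ord0 ord0 : 'I_2) :
  \det A = A ord0 ord0 * A i1 i1 - A ord0 i1 * A i1 ord0.
Proof.
rewrite (expand_det_row A ord0) !big_ord_recl big_ord0 addr0 /cofactor !det_mx11 !mxE /=.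
have -> : lift (lift ord0 ord0 : 'I_2) (0 : 'I_1) = ord0 by apply/val_inj.
have -> : lift (ord0 : 'I_2) (0 : 'I_1) = i1 by apply/val_inj.
by rewrite /bump /= !addn0 expr0 expr1 mul1r mulN1r mulrN.
Qed.

(** The columns have norm below one if the operator norm is, and then the
determinant has modulus below one. *)
Lemma opnorm_ge1 A : \det A = 1 -> 1 <= opnorm A.
Proof.
move=> detA; rewrite leNgt; apply/negP => lt1.
set o0 : 'I_2 := ord0; set o1 : 'I_2 := lift ord0 ord0.
have col j : normc (A o0 j) ^+ 2 + normc (A o1 j) ^+ 2 < 1.
  have lt := le_lt_trans (norm2_col_le_opnorm A j) lt1.
  have e i : (A *m (delta_mx j 0 : 'cV_2)) i 0 = A i j.
    rewrite mxE (bigD1 j)//= big1 => [|k kj]; first by rewrite mxE !eqxx mulr1 addr0.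
    by rewrite mxE (negbTE kj) mulr0.
  move: lt; rewrite /norm2 !big_ord_recl big_ord0 !e addr0 -/o0 -/o1 => lt.
  have s0 : 0 <= normc (A o0 j) ^+ 2 + normc (A o1 j) ^+ 2 by rewrite addr_ge0 ?sqr_ge0.
  by rewrite -[ltLHS]sqr_sqrtr// expr_lt1 ?sqrtr_ge0.
have := detA; rewrite det_mx2 -/o0 -/o1 => det1.
have : normc (A o0 o0 * A o1 o1 - A o0 o1 * A o1 o0) = 1.
  by rewrite -[RHS](@ComplexField.Normc.normc1 R) -det1.
have := normcD (A o0 o0 * A o1 o1) (- (A o0 o1 * A o1 o0)).
rewrite (@normcN R) !normcM => le e; rewrite e in le.
have := col o0; have := col o1.
move: (normc (A o0 o0)) (normc (A o0 o1)) (normc (A o1 o0)) (normc (A o1 o1)) le.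
move=> a b c d le h1 h2.
have := sqr_ge0 (a - d); have := sqr_ge0 (b - c); rewrite !sqrrB; lra.
Qed.

End MatrixNorm.

(** * The transfer cocycle and its perturbations *)

Section Cocycles.
Variables (R : realType) (phi : R * R -> R) (alpha : R * R).
Local Notation C := R[i].
Local Notation normc := (@ComplexField.Normc.normc R).
Implicit Types (theta : R * R) (z : C).
Local Notation T := (transfer phi).
Local Notation A := (cocycle phi alpha).

Lemma rot_iter_nat theta (n : nat) : rot_iter alpha n%:Z theta = theta + alpha *+ n.
Proof. by rewrite /rot_iter -pmulrn. Qed.

Lemma cocycleS k theta z : A k.+1 theta z = T (theta + alpha *+ k) z *m A k theta z.
Proof. by rewrite /= rot_iter_nat. Qed.

Lemma cocycleD k l theta z :
  A (k + l)%N theta z = A k (theta + alpha *+ l) z *m A l theta z.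
Proof.
elim: k => [|k IH]; first by rewrite add0n /= mul1mx.
by rewrite addSn !cocycleS IH mulmxA -addrA -mulrnDr [(l + k)%N]addnC.
Qed.

Lemma det_transfer theta z : \det (T theta z) = 1.
Proof. by rewrite det_mx2 !mxE /= mulr0 mulr1 sub0r opprK. Qed.

Lemma det_cocycle k theta z : \det (A k theta z) = 1.
Proof.
elim: k => [|k IH]; first by rewrite /= det1.
by rewrite cocycleS det_mulmx det_transfer IH mulr1.
Qed.

Lemma mnorm_cocycle_ge1 k theta z : 1 <= mnorm (A k theta z).
Proof. by apply: le_trans (opnorm_le_mnorm _); exact/opnorm_ge1/det_cocycle. Qed.

Lemma mnorm_mx22 (M : 'M[C]_2) : mnorm M =
  normc (M ord0 ord0) + normc (M ord0 (lift ord0 ord0)) +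
  (normc (M (lift ord0 ord0) ord0) + normc (M (lift ord0 ord0) (lift ord0 ord0))).
Proof. by rewrite /mnorm !big_ord_recl !big_ord0 !addr0. Qed.

Lemma mnorm_transfer theta z : mnorm (T theta z) <= normc z + `|phi theta| + 2.
Proof.
rewrite mnorm_mx22 !mxE /= oppr0 sqrrN !expr1n !expr0n !addr0 sqrtr0 sqrtr1.
have := normcD z (- (phi theta)%:C); rewrite (@normcN R) normc_real; lra.
Qed.

Lemma mnorm_transferB theta theta' z z' :
  mnorm (T theta z - T theta' z') <= normc (z - z') + `|phi theta - phi theta'|.
Proof.
rewrite mnorm_mx22 !mxE /= ?(subrr, oppr0, expr0n, addr0, sqrtr0).
have -> : z - (phi theta)%:C - (z' - (phi theta')%:C) =
          (z - z') + (- (phi theta - phi theta')%:C).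
  by rewrite rmorphB/=; ring.
by apply: (le_trans (normcD _ _)); rewrite (@normcN R) normc_real.
Qed.

Lemma mnorm_cocycle_le (B : R) k theta z :
  (forall theta, mnorm (T theta z) <= B) -> mnorm (A k theta z) <= 2 * B ^+ k.
Proof.
move=> hB; elim: k => [|k IH]; first by rewrite /= mnorm1 expr0 mulr1.
rewrite cocycleS exprS mulrCA; apply: (le_trans (mnormM _ _)).
by apply: ler_pM; rewrite ?mnorm_ge0.
Qed.

(** Replace the factors of one product by those of the other one at a time. *)
Lemma cocycle_telescope n theta theta' z z' :
  A n theta' z' - A n theta z = \sum_(j < n)
    A (n - j.+1)%N (theta + alpha *+ j.+1) z *m
    (T (theta' + alpha *+ j) z' - T (theta + alpha *+ j) z) *m A j theta' z'.
Proof.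
elim: n => [|n IH]; first by rewrite big_ord0 subrr.
rewrite !cocycleS big_ord_recr/= subnn /= mul1mx.
have -> : T (theta' + alpha *+ n) z' *m A n theta' z' - T (theta + alpha *+ n) z *m A n theta z
  = T (theta + alpha *+ n) z *m (A n theta' z' - A n theta z) +
    (T (theta' + alpha *+ n) z' - T (theta + alpha *+ n) z) *m A n theta' z'.
  by rewrite mulmxBr mulmxBl [RHS]addrC addrA subrK.
congr (_ + _); rewrite IH mulmx_sumr; apply: eq_bigr => j _.
rewrite !mulmxA; congr (_ *m _ *m _).
rewrite subSn// cocycleS -addrA -mulrnDr.
by rewrite subnKC.
Qed.

(** In the telescoping sum the factors on the left are bounded by hypothesis;
those on the right belong to the perturbed cocycle and are controlled by the
induction itself. The sum is geometric with ratio [1 + M * d]. *)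
Lemma cocycle_perturb (M Lam d : R) k theta theta' z z' :
  1 <= Lam -> 1 <= M -> 0 <= d ->
  (forall n theta, mnorm (A n theta z) <= M * Lam ^+ n) ->
  (forall j, (j < k)%N ->
    mnorm (T (theta' + alpha *+ j) z' - T (theta + alpha *+ j) z) <= d) ->
  mnorm (A k theta' z' - A k theta z) <= M * Lam ^+ k * ((1 + M * d) ^+ k - 1).
Proof.
move=> L1 M1 d0 up close.
have M0 : 0 <= M by lra.
have L0 : 0 <= Lam by lra.
have Md : 0 <= M * d by rewrite mulr_ge0.
have main n : (n <= k)%N ->
    mnorm (A n theta' z' - A n theta z) <= M * Lam ^+ n * ((1 + M * d) ^+ n - 1).
  elim/ltn_ind: n => n IH nk.
  have geo : (1 + M * d) ^+ n - 1 = \sum_(j < n) M * d * (1 + M * d) ^+ j.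
    rewrite -mulr_sumr subrX1; congr (_ * _); ring.
  rewrite cocycle_telescope geo mulr_sumr.
  elim/big_ind2: _ => [|x1 x2 y1 y2 h1 h2|j _].
  - by rewrite /mnorm big1// => i _; rewrite big1// => j _; rewrite mxE ComplexField.Normc.normc0.
  - by apply: (le_trans (mnormD _ _)); exact: lerD.
  have jn := ltn_ord j.
  have Aj : mnorm (A j theta' z') <= M * Lam ^+ j * (1 + M * d) ^+ j.
    apply: (le_trans (mnorm_le_add _ (A j theta z))).
    have := IH j jn (ltnW (leq_trans jn nk)); have := up j theta.
    by rewrite mulrBr mulr1; lra.
  apply: (le_trans (mnormM _ _)); apply: (@le_trans _ _
     (M * Lam ^+ (n - j.+1) * d * (M * Lam ^+ j * (1 + M * d) ^+ j))).
    apply: ler_pM; rewrite ?mnorm_ge0//.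
    apply: (le_trans (mnormM _ _)); apply: ler_pM; rewrite ?mnorm_ge0//.
    by apply: close; exact: leq_trans nk.
  have -> : M * Lam ^+ (n - j.+1) * d * (M * Lam ^+ j * (1 + M * d) ^+ j) =
     (Lam ^+ (n - j.+1) * Lam ^+ j) * (M * (M * d * (1 + M * d) ^+ j)) by ring.
  have -> : M * Lam ^+ n * (M * d * (1 + M * d) ^+ j) =
     Lam ^+ n * (M * (M * d * (1 + M * d) ^+ j)) by ring.
  rewrite ler_wpM2r ?mulr_ge0 ?exprn_ge0 ?addr_ge0//.
  rewrite -exprD ler_weXn2l//.
  by rewrite -[leqRHS](subnK jn) addnS leqW.
exact: main.
Qed.

End Cocycles.

(** * Upper and lower sums for integrals on the torus *)

Section StepIntegral.
Context d (T : measurableType d) (R : realType) (mu : {measure set T -> \bar R}).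
Variables (D : set T) (mD : measurable D).
Local Open Scope ereal_scope.

(** The integral of a nonnegative function is a supremum over the simple
functions below it, so monotonicity holds for arbitrary functions. *)
Lemma ge0_integral_mono (f g : T -> \bar R) : (forall x, D x -> 0 <= f x) ->
  (forall x, D x -> f x <= g x) ->
  \int[mu]_(x in D) f x <= \int[mu]_(x in D) g x.
Proof.
move=> f0 fg; rewrite !ge0_integralE//; last first.
  by move=> x Dx; exact: le_trans (f0 x Dx) (fg x Dx).
apply: ereal_sup_le => _ [h hf <-]; exists h => // x.
apply: (le_trans (hf x)); rewrite !patchE; case: ifPn => //.
by rewrite inE; exact: fg.
Qed.

Lemma integral_step (I : Type) (s : seq I) (c : I -> R) (B : I -> set T) :
  (forall i, (0 <= c i)%R) -> (forall i, measurable (B i)) ->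
  \int[mu]_(x in D) (\sum_(i <- s) c i * \1_(B i) x)%:E =
  \sum_(i <- s) (c i)%:E * mu (B i `&` D).
Proof.
move=> c0 mB.
have mI i : measurable_fun D (EFin \o (\1_(B i) : T -> R)).
  by apply/measurable_EFinP; exact: measurable_indic.
have mf i : measurable_fun D (EFin \o (fun x => c i * \1_(B i) x)%R).
  by apply/measurable_EFinP; apply: measurable_funM => //; exact: measurable_indic.
under eq_integral do rewrite -sumEFin.
rewrite (ge0_integral_sum mu mD mf); last first.
  by move=> i x _; rewrite lee_fin mulr_ge0.
apply: eq_bigr => i _.
under eq_integral do rewrite /= EFinM.
rewrite ge0_integralZl//.
- by rewrite integral_indic.
- exact: mI.
- by rewrite lee_fin.
Qed.

(** Integrals of functions that need not be measurable are compared with step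
functions, from above here and from below in [Rintegral_ge_step]. *)
Lemma Rintegral_le_step (I : Type) (s : seq I) (c b : I -> R) (B : I -> set T)
    (f : T -> R) :
  (forall i, (0 <= c i)%R) -> (forall i, measurable (B i)) ->
  (forall i, mu (B i `&` D) <= (b i)%:E) ->
  (forall x, D x -> (0 <= f x)%R) ->
  (forall x, D x -> (f x <= \sum_(i <- s) c i * \1_(B i) x)%R) ->
  (Rintegral mu D f <= \sum_(i <- s) c i * b i)%R.
Proof.
move=> c0 mB muB f0 fle.
have up : \int[mu]_(x in D) (f x)%:E <= (\sum_(i <- s) c i * b i)%:E.
  apply: (@le_trans _ _ (\int[mu]_(x in D) (\sum_(i <- s) c i * \1_(B i) x)%:E)).
    by apply: ge0_integral_mono => x Dx; rewrite lee_fin; [exact: f0|exact: fle].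
  rewrite integral_step// -sumEFin; apply: lee_sum => i _.
  by rewrite EFinM; apply: lee_wpmul2l; rewrite ?lee_fin.
have lo : 0 <= \int[mu]_(x in D) (f x)%:E.
  by apply: integral_ge0 => x Dx; rewrite lee_fin f0.
have fin : \int[mu]_(x in D) (f x)%:E \is a fin_num.
  by rewrite ge0_fin_numE// (le_lt_trans up)// ltry.
by rewrite -lee_fin /Rintegral fineK.
Qed.

Lemma Rintegral_ge_step (I : Type) (s : seq I) (c b : I -> R) (B : I -> set T)
    (f : T -> R) (M : R) :
  (forall i, (0 <= c i)%R) -> (forall i, measurable (B i)) ->
  (forall i, (b i)%:E <= mu (B i `&` D)) -> mu D < +oo ->
  (forall x, D x -> (f x <= M)%R) ->
  (forall x, D x -> (\sum_(i <- s) c i * \1_(B i) x <= f x)%R) ->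
  (\sum_(i <- s) c i * b i <= Rintegral mu D f)%R.
Proof.
move=> c0 mB muB muD fM fge.
have s0 x : (0 <= \sum_(i <- s) c i * \1_(B i) x)%R.
  by apply: sumr_ge0 => i _; rewrite mulr_ge0.
have lo : (\sum_(i <- s) c i * b i)%:E <= \int[mu]_(x in D) (f x)%:E.
  apply: (@le_trans _ _ (\int[mu]_(x in D) (\sum_(i <- s) c i * \1_(B i) x)%:E)); last first.
    by apply: ge0_integral_mono => x Dx; rewrite lee_fin//; exact: fge.
  rewrite integral_step// -sumEFin; apply: lee_sum => i _.
  by rewrite EFinM; apply: lee_wpmul2l; rewrite ?lee_fin.
have f0 x : D x -> 0 <= (f x)%:E by move=> Dx; rewrite lee_fin (le_trans (s0 x))// fge.
have up : \int[mu]_(x in D) (f x)%:E <= M%:E * mu D.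
  rewrite -integral_cst//; apply: ge0_integral_mono => x Dx; first exact: f0.
  by rewrite lee_fin fM.
have fin : \int[mu]_(x in D) (f x)%:E \is a fin_num.
  rewrite ge0_fin_numE ?integral_ge0// (le_lt_trans up)//.
  have [D0|Dn0] := eqVneq D set0; first by rewrite D0 measure0 mule0 ltry.
  have /set0P[x Dx] := Dn0.
  apply: lte_mul_pinfty => //.
  by rewrite lee_fin (le_trans (s0 x))// (le_trans (fge x Dx))// fM.
by rewrite -lee_fin /Rintegral fineK.
Qed.

End StepIntegral.

Section TorusIntegral.
Variable R : realType.
Implicit Types (p : R * R) (r : R).
Local Notation mu := (lebesgue_measure \x lebesgue_measure)%E.
Local Notation D := (@fundamental_domain R).
Local Notation T := (measurableTypeR R * measurableTypeR R)%type.

Lemma measurable_rect (i j : interval R) :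
  measurable ([set` i] `*` [set` j] : set T).
Proof. by apply: measurableX; exact: measurable_itv. Qed.

Lemma mu_rect (i j : interval R) :
  mu ([set` i] `*` [set` j] : set T) = (lebesgue_measure [set` i] * lebesgue_measure [set` j])%E.
Proof. by rewrite product_measure1E//; exact: measurable_itv. Qed.

Lemma mu_fundamental_domain : mu D = 1%E.
Proof. by rewrite mu_rect lebesgue_measure_itv/= lte_fin ltr01 sube0 mule1. Qed.

Lemma measurable_fundamental_domain : measurable (D : set T).
Proof. exact: measurable_rect. Qed.

Definition closed_box p r : set T :=
  `[p.1 - r, p.1 + r]%classic `*` `[p.2 - r, p.2 + r]%classic.

Lemma mu_closed_box p r : 0 <= r -> (mu (closed_box p r `&` D) <= ((2 * r) ^+ 2)%:E)%E.
Proof.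
move=> r0; apply: (@le_trans _ _ (mu (closed_box p r))).
  apply: le_measure; rewrite ?inE.
  - by apply: measurableI; [exact: measurable_rect|exact: measurable_fundamental_domain].
  - exact: measurable_rect.
  - exact: subIsetl.
have len (x : R) : lebesgue_measure (`[x - r, x + r]%classic : set (measurableTypeR R)) = (2 * r)%:E.
  rewrite lebesgue_measure_itv/= lte_fin; case: ltP => h.
    by rewrite -EFinB; congr _%:E; ring.
  by congr _%:E; lra.
by rewrite mu_rect !len -EFinM expr2.
Qed.

Lemma closed_boxP p r x : closed_box p r x <-> `|x.1 - p.1| <= r /\ `|x.2 - p.2| <= r.
Proof.
rewrite /closed_box /= !in_itv/= !ler_distl.
by split=> -[] /andP[? ?] /andP[? ?]; split; apply/andP; split; lra.
Qed.

(** The function is at most [c] outside small boxes, whose total area is at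
most [size s * (2 * r) ^ 2]. *)
Lemma torus_Rintegral_le (s : seq (R * R)) (r c M : R) (f : R * R -> R) :
  0 <= r -> 0 <= c -> 0 <= M ->
  (forall x, 0 <= f x) -> (forall x, f x <= c + M) ->
  (forall x, D x -> (forall p, p \in s -> ~ closed_box p r x) -> f x <= c) ->
  Rintegral mu D f <= c + M * (size s)%:R * (2 * r) ^+ 2.
Proof.
move=> r0 c0 M0 f0 fM fc.
pose cc (o : option (R * R)) : R := if o is Some _ then M else c.
pose B (o : option (R * R)) : set T := if o is Some p then closed_box p r else D.
pose b (o : option (R * R)) : R := if o is Some _ then (2 * r) ^+ 2 else 1.
have -> : c + M * (size s)%:R * (2 * r) ^+ 2 = \sum_(o <- None :: map Some s) cc o * b o.
  rewrite big_cons big_map /= mulr1; congr (_ + _).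
  by rewrite big_const_seq count_predT iter_addr_0 -mulr_natr; ring.
apply: (@Rintegral_le_step _ _ _ _ _ measurable_fundamental_domain _ _ cc b B).
- by case.
- by case=> [p|]; [exact: measurable_rect|exact: measurable_fundamental_domain].
- by case=> [p|] /=; [exact: mu_closed_box|rewrite setIid mu_fundamental_domain].
- by move=> x _; exact: f0.
move=> x Dx; rewrite big_cons big_map /= indicE mem_set// mulr1.
have pos : 0 <= \sum_(j <- s) M * \1_(closed_box j r) x by apply: sumr_ge0 => i _; rewrite mulr_ge0.
have [none|/existsNP[p /not_implyP[ps /contrapT bx]]] := pselect (forall p, p \in s -> ~ closed_box p r x).
  by apply: (le_trans (fc x Dx none)); rewrite lerDl.
apply: (le_trans (fM x)); rewrite lerD2l (big_rem _ ps)/= indicE mem_set// mulr1 lerDl.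
by apply: sumr_ge0 => i _; rewrite mulr_ge0.
Qed.

Definition grid_square (n a b : nat) : set T :=
  `[a%:R / n%:R, a.+1%:R / n%:R[%classic `*` `[b%:R / n%:R, b.+1%:R / n%:R[%classic.

Lemma grid_interval_uniq (n a a' : nat) (x : R) : (0 < n)%N ->
  a%:R / n%:R <= x < a.+1%:R / n%:R -> a'%:R / n%:R <= x < a'.+1%:R / n%:R -> a = a'.
Proof.
move=> n0 /andP[h1 h2] /andP[h3 h4].
have n0' : 0 < n%:R^-1 :> R by rewrite invr_gt0 ltr0n.
have := le_lt_trans h1 h4; have := le_lt_trans h3 h2.
by rewrite !ltr_pM2r// !ltr_nat; clear; lia.
Qed.

Lemma torus_Rintegral_ge (n : nat) (c : 'I_n * 'I_n -> R) (M : R) (f : R * R -> R) :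
  (0 < n)%N -> (forall ab, 0 <= c ab) ->
  (forall x, 0 <= f x) -> (forall x, f x <= M) ->
  (forall (ab : 'I_n * 'I_n) x, grid_square n ab.1 ab.2 x -> c ab <= f x) ->
  \sum_(ab : 'I_n * 'I_n) c ab * n%:R ^- 2 <= Rintegral mu D f.
Proof.
move=> n0 c0 f0 fM cf.
have np : 0 < n%:R :> R by rewrite ltr0n.
have sub (a : 'I_n) (y : R) : a%:R / n%:R <= y < a.+1%:R / n%:R -> 0 <= y < 1.
  move=> /andP[h1 h2]; apply/andP; split.
    by apply: le_trans h1; rewrite divr_ge0.
  apply: (lt_le_trans h2); rewrite ler_pdivrMr// mul1r ler_nat; exact: ltn_ord.
have len (a : nat) : lebesgue_measure (`[a%:R / n%:R, a.+1%:R / n%:R[%classic : set (measurableTypeR R)) = (n%:R^-1)%:E.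
  rewrite lebesgue_measure_itv/= lte_fin ltr_pM2r ?invr_gt0// ltr_nat ltnSn.
  by rewrite -EFinB -natr1; congr _%:E; ring.
apply: (@Rintegral_ge_step _ _ _ _ _ measurable_fundamental_domain _ _ c
   (fun _ => n%:R ^- 2) (fun ab : 'I_n * 'I_n => grid_square n ab.1 ab.2) f M).
- by [].
- by move=> ab; exact: measurable_rect.
- move=> ab; have -> : grid_square n ab.1 ab.2 `&` D = grid_square n ab.1 ab.2.
    apply/setIidPl => x [/= h1 h2]; rewrite !in_itv/= in h1 h2.
    by split; rewrite /= in_itv/=; [exact: sub h1|exact: sub h2].
  have e : mu (grid_square n ab.1 ab.2) = (n%:R ^- 2)%:E.
    by rewrite mu_rect !len -EFinM -invfM expr2.
  by rewrite -e.
- have := mu_fundamental_domain => e; apply: le_lt_trans (ltry 1%R); rewrite -e; exact: lexx.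
- by move=> x _; exact: fM.
move=> x Dx.
have [[ab hab]|none] := pselect (exists ab : 'I_n * 'I_n, grid_square n ab.1 ab.2 x).
  rewrite (bigD1 ab)//= big1 => [|ab' ne].
    by rewrite indicE mem_set// mulr1 addr0 cf.
  rewrite indicE memNset ?mulr0// => hab'; move/eqP: ne; apply.
  move: hab hab'; rewrite /grid_square /= !in_itv/= => -[h1 h2] [h3 h4].
  have e1 := grid_interval_uniq n0 h3 h1; have e2 := grid_interval_uniq n0 h4 h2.
  by apply: injective_projections; apply/val_inj.
rewrite big1 => [|ab _]; first exact: f0.
by rewrite indicE memNset ?mulr0// => hab; apply: none; exists ab.
Qed.

End TorusIntegral.

(** * Regularity of the potential away from its jumps *)

Section Regularity.
Variable R : realType.
Implicit Types (p q x y : R * R) (S : set (R * R)) (phi : R * R -> R).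

(** A segment from [S] to its complement would otherwise be split into two
relatively clopen pieces. *)
Lemma boundary_crossing S p q : S p -> ~ S q ->
  exists t : R, 0 <= t <= 1 /\ boundary S (p + t *: (q - p)).
Proof.
move=> Sp nSq; apply: contrapT => none.
pose c (t : R) := p + t *: (q - p).
have cc : continuous c.
  by move=> t; apply: cvgD; [exact: cvg_cst|exact: scalel_continuous].
have nb t : 0 <= t <= 1 -> closure S (c t) -> interior S (c t).
  by move=> ht cl; apply: contrapT => ni; apply: none; exists t.
have eqI : `[0, 1]%classic `&` c @^-1` S = `[0, 1]%classic.
  apply: (@segment_connected R 0 1).
  - by exists 0; split; rewrite /= ?in_itv/= ?lexx ?ler01// /c scale0r addr0.
  - exists (c @^-1` interior S).
      by apply: open_comp; [move=> t _; exact: cc|exact: open_interior].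
    apply/seteqP; split=> t /= [t01 h]; split=> //; last exact: interior_subset h.
    by apply: nb; [rewrite in_itv/= in t01|exact: subset_closure].
  - exists (c @^-1` closure S).
      by apply: preimage_closed; [move=> t _; exact: cc|exact: closed_closure].
    apply/seteqP; split=> t /= [t01 h]; split=> //; first exact: subset_closure.
    by apply: interior_subset; apply: nb; [rewrite in_itv/= in t01|].
have : (`[0, 1]%classic `&` c @^-1` S) 1 by rewrite eqI /= in_itv/= ler01 lexx.
by move=> [_]; rewrite /= /c scale1r addrC subrK.
Qed.

Lemma dist_int_small (x : R) : `|x| <= 2^-1 -> dist_int x = `|x|.
Proof.
move=> x2; apply/eqP; rewrite eq_le; apply/andP; split.
  by have := dist_int_le x 0; rewrite subr0.
apply: lb_le_inf; first by exists `|x - 0%:~R|, 0.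
move=> _ [k _ <-].
have [->|k0] := eqVneq k 0; first by rewrite subr0.
have := @intr_norm_ge1 R _ k0; have := ler_normD (k%:~R - x) x; rewrite subrK.
rewrite [`|k%:~R - x|]distrC; lra.
Qed.

Lemma tdist_small p q : `|p.1 - q.1| <= 2^-1 -> `|p.2 - q.2| <= 2^-1 ->
  tdist p q = Num.sqrt ((p.1 - q.1) ^+ 2 + (p.2 - q.2) ^+ 2).
Proof.
by move=> h1 h2; rewrite /tdist !dist_int_small// -!normrX !ger0_norm ?sqr_ge0.
Qed.

(** A single constant for both terms of the norm. The difference bound is
restricted to distinct points of the torus because the power function takes
the value one at exponent zero. *)
Lemma Holder_space_bounds (gamma : R) g : Holder_space gamma g -> exists H : R,
  [/\ 0 <= H, forall p, `|g p| <= H &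
   forall p q, tdist p q != 0 -> `|g p - g q| <= H * tdist p q `^ gamma].
Proof.
move=> [_]; rewrite /Holder_norm.
set s1 := ereal_sup _; set s2 := ereal_sup _ => fin.
pose w : R * R := (2^-1, 0).
have w0 : tdist w 0 != 0.
  rewrite tdist_small; [|by rewrite /w/= subr0 ger0_norm ?invr_ge0|
                         by rewrite /w/= subr0 normr0 invr_ge0].
  by rewrite /w/= !subr0 gt_eqF// sqrtr_gt0 expr0n addr0 exprn_gt0 ?invr_gt0.
have s10 : (0 <= s1)%E.
  by apply: (le_trans _ (ereal_sup_ubound _)); last (exists 0; reflexivity); rewrite lee_fin.
have s20 : (0 <= s2)%E.
  apply: (le_trans _ (ereal_sup_ubound _)); last (exists (w, 0); [exact: w0|reflexivity]).
  by rewrite lee_fin divr_ge0// powR_ge0.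
have s1fin : (s1 < +oo)%E by apply: le_lt_trans fin; rewrite leeDl.
have s2fin : (s2 < +oo)%E by apply: le_lt_trans fin; rewrite leeDr.
have f1 : s1 \is a fin_num by rewrite ge0_fin_numE.
have f2 : s2 \is a fin_num by rewrite ge0_fin_numE.
exists (fine s1 + fine s2); split.
- by rewrite addr_ge0// fine_ge0.
- move=> p; apply: (@le_trans _ _ (fine s1)); last by rewrite lerDl fine_ge0.
  by rewrite -lee_fin fineK//; apply: ereal_sup_ubound; exists p.
move=> p q pq; apply: (@le_trans _ _ (fine s2 * tdist p q `^ gamma)).
  have tp : 0 < tdist p q `^ gamma.
    by rewrite powR_gt0// lt0r pq sqrtr_ge0.
  rewrite -ler_pdivrMr// -lee_fin fineK//; apply: ereal_sup_ubound.
  by exists (p, q).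
by rewrite ler_wpM2r ?powR_ge0// lerDr fine_ge0.
Qed.

(** What is used of a piecewise Hoelder potential: it is bounded, and it is
Hoelder at the scale [r] at all points that are [r]-far from a jump set [Sg]
of linear covering numbers. *)
Definition piecewise_regular phi (gamma H : R) (Sg : set (R * R)) : Prop :=
  [/\ forall p, `|phi p| <= H,
      linear_covering Sg &
      forall r p p', 0 < r -> r <= 4^-1 -> torus_near r p' p ->
        (forall y, Sg y -> ~ torus_near r p y) ->
        `|phi p' - phi p| <= H * r `^ gamma].

(** The jump set is the union of the boundaries of the pieces. A point and a
nearby one that are separated by a piece have a boundary point on the segment
joining them, so away from the jump set the indicators agree and only the
Hoelder factors vary. The exponent is lowered to at most one. *)
Lemma piecewise_Holder_regular phi : periodic_fun phi -> piecewise_Holder phi ->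
  exists gamma H Sg, [/\ 0 < gamma, gamma <= 1, 0 < H & piecewise_regular phi gamma H Sg].
Proof.
move=> per [gamma [K [S [g [gamma0 adm hol phiE]]]]].
have [h hP] := choice (fun j => Holder_space_bounds (hol j)).
pose H0 := \sum_(j < K) h j.
have h0 j : 0 <= h j by have [] := hP j.
have H00 : 0 <= H0 by apply: sumr_ge0 => j _.
pose H := H0 * (1 + 2 `^ gamma) + 1.
have p2 : 0 <= 2 `^ gamma :> R by exact: powR_ge0.
have H0H : H0 <= H by rewrite /H; have := mulr_ge0 H00 p2; lra.
pose Sg := \big[setU/set0]_(j < K) boundary (S j).
exists (Num.min gamma 1), H, Sg; split.
- by rewrite lt_min gamma0 ltr01.
- by rewrite ge_min lexx orbT.
- by rewrite ltr_wpDl// mulr_ge0// addr_ge0.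
split.
- move=> p; apply: le_trans H0H; rewrite phiE.
  apply: (le_trans (ler_norm_sum _ _ _)); apply: ler_sum => j _.
  have [_ hb _] := hP j.
  rewrite normrM; apply: le_trans (hb p); rewrite ler_piMl//.
  by rewrite indicE; case: (_ \in _); rewrite ?normr1 ?normr0 ?ler01.
- rewrite /Sg; elim/big_ind: _ => [|X Y|j _].
  + exact: linear_covering0.
  + exact: linear_coveringU.
  + by have [Sper Ssm _] := adm j; exact: linear_covering_boundary.
move=> r p p' r0 r4 [k [l [near1 near2]]] avoid.
pose q := p' - lattice R k l.
have -> : phi p' = phi q by rewrite -(per k l q) /q subrK.
have q1 : `|q.1 - p.1| <= r by rewrite /q /= addrAC.
have q2 : `|q.2 - p.2| <= r by rewrite /q /= addrAC.
have same j : \1_(S j) q = \1_(S j) p :> R.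
  have onSg y : boundary (S j) y -> Sg y by move=> yb; rewrite /Sg (bigD1 j)//=; left.
  have seg t a b : 0 <= t <= 1 -> `|b - a| <= r -> `|a - (a + t * (b - a))| <= r.
    move=> /andP[t0 t1] ab; rewrite opprD addNKr normrN normrM ger0_norm//.
    by apply: le_trans ab; rewrite ler_piMl.
  have seg' t a b : 0 <= t <= 1 -> `|b - a| <= r -> `|a - (b + t * (a - b))| <= r.
    move=> /andP[t0 t1] ab; have -> : a - (b + t * (a - b)) = (1 - t) * (a - b) by ring.
    rewrite normrM ger0_norm ?subr_ge0// distrC; apply: le_trans ab; rewrite ler_piMl//; lra.
  rewrite !indicE; have [Sq|nSq] := pselect (S j q); have [Sp|nSp] := pselect (S j p).
  + by rewrite !mem_set.
  + exfalso; have [t [t01 bt]] := boundary_crossing Sq nSp.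
    apply: (avoid _ (onSg _ bt)); exists 0, 0; rewrite !subr0 /=.
    by split; exact: seg'.
  + exfalso; have [t [t01 bt]] := boundary_crossing Sp nSq.
    apply: (avoid _ (onSg _ bt)); exists 0, 0; rewrite !subr0 /=.
    by split; exact: seg.
  + by rewrite !memNset.
rewrite !phiE -sumrB.
have gdiff j : `|g j q - g j p| <= h j * (2 `^ gamma * r `^ Num.min gamma 1).
  have [_ _ hl] := hP j.
  have [e|ne] := eqVneq (tdist q p) 0.
    have : q = p.
      move: e; rewrite tdist_small; [|lra|lra] => /eqP; rewrite sqrtr_eq0 => le0.
      have s1 := sqr_ge0 (q.1 - p.1); have s2 := sqr_ge0 (q.2 - p.2).
      have z1 : (q.1 - p.1) ^+ 2 = 0 by lra.
      have z2 : (q.2 - p.2) ^+ 2 = 0 by lra.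
      move/eqP: z1; rewrite sqrf_eq0 subr_eq0 => /eqP z1.
      move/eqP: z2; rewrite sqrf_eq0 subr_eq0 => /eqP z2.
      exact: injective_projections.
    by move=> ->; rewrite subrr normr0 mulr_ge0// mulr_ge0// powR_ge0.
  apply: (le_trans (hl q p ne)); apply: ler_wpM2l => //.
  apply: (@le_trans _ _ ((2 * r) `^ gamma)).
    apply: ge0_ler_powR; rewrite ?nnegrE ?(ltW gamma0) ?sqrtr_ge0 ?mulr_ge0 ?(ltW r0)//.
    rewrite tdist_small; [|lra|lra].
    rewrite -[leRHS]ger0_norm ?mulr_ge0 ?(ltW r0)// -sqrtr_sqr ler_sqrt ?sqr_ge0//.
    have s1 : (q.1 - p.1) ^+ 2 <= r ^+ 2 by rewrite -[leLHS]real_normK ?num_real// lerXn2r ?nnegrE ?(ltW r0).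
    have s2 : (q.2 - p.2) ^+ 2 <= r ^+ 2 by rewrite -[leLHS]real_normK ?num_real// lerXn2r ?nnegrE ?(ltW r0).
    by have := sqr_ge0 r; rewrite exprMn; lra.
  rewrite powRM ?(ltW r0)// ler_wpM2l ?powR_ge0//.
  by rewrite ger_powR ?r0 ?(le_trans r4) ?ge_min ?lexx// invf_le1 ?ler1n.
apply: (@le_trans _ _ (\sum_(j < K) h j * (2 `^ gamma * r `^ Num.min gamma 1))).
  apply: (le_trans (ler_norm_sum _ _ _)); apply: ler_sum => j _.
  rewrite same -mulrBr normrM; apply: le_trans (gdiff j); rewrite ler_piMl//.
  by rewrite indicE; case: (_ \in _); rewrite ?normr1 ?normr0 ?ler01.
rewrite -mulr_suml mulrA ler_wpM2r ?powR_ge0//.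
by rewrite /H -/H0; have := H00; lra.
Qed.

End Regularity.

(** * A uniform upper bound with the Lyapunov rate *)

Section LogEstimates.
Variable R : realType.

Lemma ln_add_le (x e : R) : 1 <= x -> 0 <= e -> ln (x + e) <= ln x + e.
Proof.
move=> x1 e0; have x0 : 0 < x by lra.
have -> : x + e = x * (1 + e / x) by field; exact: lt0r_neq0.
have ex : 0 <= e / x by rewrite divr_ge0// ltW.
rewrite lnM ?posrE//; last by lra.
rewrite lerD2l; apply: (@le_trans _ _ (e / x)).
  by apply: le_ln1Dx; lra.
by rewrite ler_pdivrMr// ler_peMr.
Qed.

Lemma pow1D_le_fixed (x : R) (m : nat) : 0 <= x -> x <= 1 ->
  (1 + x) ^+ m - 1 <= x * (m%:R * 2 ^+ m).
Proof.
move=> x0 x1; rewrite subrX1 addrC addKr; apply: ler_wpM2l => //.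
rewrite mulr_natl -[X in _ <= _ *+ X](card_ord m) -sumr_const; apply: ler_sum => i _.
apply: (@le_trans _ _ (2 ^+ i)).
  by rewrite lerXn2r ?nnegrE ?addr_ge0//; lra.
by apply: ler_weXn2l; rewrite ?ler1n// ltnW.
Qed.

(** A positive power tends to zero at the origin. *)
Lemma powR_small (gamma H e : R) : 0 < gamma -> 0 < H -> 0 < e ->
  exists2 r0 : R, 0 < r0 & forall r, 0 < r -> r <= r0 -> H * r `^ gamma <= e.
Proof.
move=> g0 H0 e0; have eH : 0 < e / H by rewrite divr_gt0.
exists ((e / H) `^ gamma^-1); first exact: powR_gt0.
move=> r r0 rr; rewrite mulrC -ler_pdivlMr//.
have -> : e / H = ((e / H) `^ gamma^-1) `^ gamma.
  by rewrite -powRrM mulVf ?gt_eqF// powRr1// ltW.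
by apply: ge0_ler_powR; rewrite ?nnegrE ?powR_ge0// ltW.
Qed.

Lemma ler_third (a w k : R) : 0 < w -> 0 < k -> 3 * a / k < w -> a / w <= k / 3.
Proof.
move=> w0 k0; rewrite ltr_pdivrMr// ler_pdivrMr// => h.
by have : 3 * a <= w * k := ltW h; lra.
Qed.

(** With [n = 5 * w], the loss in replacing [n ^ 2] cells by the visit
frequency [(n - 1) ^ -2] is a factor [1 + 1 / w]. *)
Lemma grid_ratio_le (w : R) : 1 <= w -> (5 * w) ^+ 2 <= (1 + w^-1) * (5 * w - 1) ^+ 2.
Proof.
move=> w1; have w0 : 0 < w by lra.
rewrite -subr_ge0 (_ : _ - _ = ((15 * w - 9) * w + 1) / w); last by field; rewrite gt_eqF.
by rewrite divr_ge0 ?(ltW w0)// addr_ge0// mulr_ge0 ?(ltW w0)//; lra.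
Qed.

End LogEstimates.

Section UpperBound.
Variables (R : realType) (phi : R * R -> R) (alpha : R * R).
Variables (gamma H : R) (Sg : set (R * R)).
Hypotheses (gamma0 : 0 < gamma) (H0 : 0 < H).
Hypothesis reg : piecewise_regular phi gamma H Sg.
Variable z : R[i].
Local Notation A := (cocycle phi alpha).
Local Notation normc := (@ComplexField.Normc.normc R).
Local Notation B := (normc z + H + 2).
Implicit Types (theta x y p : R * R).

Lemma mnorm_transfer_le theta : mnorm (transfer phi theta z) <= B.
Proof.
have [hb _ _] := reg; apply: (le_trans (mnorm_transfer _ _ _)).
by have := hb theta; lra.
Qed.

Lemma B_ge1 : 1 <= B.
Proof. by have := normc_ge0 z; have := H0; lra. Qed.

Lemma mnorm_cocycle_up k theta : mnorm (A k theta z) <= 2 * B ^+ k.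
Proof. by apply: mnorm_cocycle_le => t; exact: mnorm_transfer_le. Qed.

Lemma transfer_close r theta theta' z' : 0 < r -> r <= 4^-1 ->
  torus_near r theta' theta -> (forall y, Sg y -> ~ torus_near r theta y) ->
  mnorm (transfer phi theta' z' - transfer phi theta z) <=
    normc (z' - z) + H * r `^ gamma.
Proof.
move=> r0 r4 near avoid; have [_ _ hreg] := reg.
apply: (le_trans (mnorm_transferB _ _ _ _ _)); rewrite lerD2l.
exact: hreg near avoid.
Qed.

(** For a fixed length [m] the perturbation bound with the trivial rate
suffices: points away from the jumps along the first [m] steps have nearly the
same product. *)
Lemma cocycle_oscillation m (eta : R) : 0 < eta -> exists2 r0 : R, 0 < r0 &
  forall r, 0 < r -> r <= r0 -> forall theta theta', torus_near r theta' theta ->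
  (forall j y, (j < m)%N -> Sg y -> ~ torus_near r (theta + alpha *+ j) y) ->
  mnorm (A m theta' z - A m theta z) <= eta.
Proof.
move=> eta0.
have B1 := B_ge1; have B0 : 0 <= B by lra.
pose K : R := 2 * B ^+ m * (2 * (m%:R * 2 ^+ m) + 1).
have K0 : 0 < K.
  have Bp : 0 < B by lra.
  apply: mulr_gt0; first by rewrite mulr_gt0// exprn_gt0.
  by rewrite ltr_wpDl// !mulr_ge0// exprn_ge0.
have e0 : 0 < Num.min 2^-1 (eta / K) by rewrite lt_min invr_gt0 ltr0n divr_gt0.
have [r1 r10 hr1] := powR_small gamma0 H0 e0.
exists (Num.min r1 4^-1); first by rewrite lt_min r10 invr_gt0 ltr0n.
move=> r r0; rewrite le_min => /andP[rr1 r4] theta theta' near avoid.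
set d := H * r `^ gamma.
have := hr1 r r0 rr1; rewrite -/d le_min => /andP[d2 de].
have d0 : 0 <= d by rewrite mulr_ge0 ?powR_ge0 ?(ltW H0).
apply: (le_trans (@cocycle_perturb _ _ _ 2 B d m theta theta' z z B1 _ d0 _ _)).
- by rewrite ler1n.
- exact: mnorm_cocycle_up.
- move=> j jm; have := @transfer_close r (theta + alpha *+ j) (theta' + alpha *+ j) z r0 r4.
  rewrite subrr ComplexField.Normc.normc0 add0r; apply.
    exact: torus_near_shift.
  by move=> y; exact: avoid.
clearbody d; apply: (@le_trans _ _ (2 * B ^+ m * (2 * d * (m%:R * 2 ^+ m)))).
  apply: ler_wpM2l; first by rewrite mulr_ge0// exprn_ge0.
  by apply: pow1D_le_fixed; lra.
have : K * d <= eta by rewrite mulrC -ler_pdivlMr.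
apply: le_trans; rewrite /K -!mulrA; apply: ler_wpM2l => //; apply: ler_wpM2l.
  by rewrite exprn_ge0.
by rewrite -subr_ge0 (_ : _ - _ = d)//; ring.
Qed.

Local Notation muT := (lebesgue_measure \x lebesgue_measure)%E.
Local Notation D := (@fundamental_domain R).
Local Notation I m := (Rintegral muT D (fun theta => ln (opnorm (A m theta z)))).

Lemma ln_opnorm_ge0 m theta : 0 <= ln (opnorm (A m theta z)).
Proof. by rewrite ln_ge0// opnorm_ge1// det_cocycle. Qed.

Lemma ln_opnorm_le m theta : ln (opnorm (A m theta z)) <= ln (2 * B ^+ m).
Proof.
have B1 := B_ge1.
have o1 : 1 <= opnorm (A m theta z) by rewrite opnorm_ge1// det_cocycle.
have o0 : 0 < opnorm (A m theta z) by lra.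
have Bm : 0 < 2 * B ^+ m by rewrite mulr_gt0// exprn_gt0//; lra.
rewrite ler_ln ?posrE//.
exact: le_trans (opnorm_le_mnorm _) (mnorm_cocycle_up _ _).
Qed.

Lemma ln_mnorm_le_opnorm m theta :
  ln (mnorm (A m theta z)) <= ln 4 + ln (opnorm (A m theta z)).
Proof.
have o1 : 1 <= opnorm (A m theta z) by rewrite opnorm_ge1// det_cocycle.
have m1 := mnorm_cocycle_ge1 phi alpha m theta z.
have o0 : 0 < opnorm (A m theta z) by lra.
have m0 : 0 < mnorm (A m theta z) by lra.
by rewrite -lnM ?posrE// ler_ln ?posrE ?mulr_gt0// mnorm_le_opnorm.
Qed.

Lemma grid_point (n : nat) theta : (0 < n)%N -> exists (ab : 'I_n * 'I_n) x,
  grid_square n ab.1 ab.2 x /\ torus_near 0 theta x.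
Proof.
move=> n0; have np : 0 < n%:R :> R by rewrite ltr0n.
have one (t : R) : exists (a : 'I_n) (k : int),
    a%:R / n%:R <= t - k%:~R < a.+1%:R / n%:R.
  pose k := Num.floor t; have /andP[k1 k2] := mem_rg1_floor t.
  rewrite -/k in k1 k2; set s := t - k%:~R.
  have s0 : 0 <= s by rewrite subr_ge0.
  have s1 : s < 1 by rewrite /s; lra.
  have sn : 0 <= s * n%:R by rewrite mulr_ge0.
  have /andP[i1 i2] := truncn_itv sn.
  have an : (Num.truncn (s * n%:R) < n)%N.
    rewrite -(ltr_nat R); apply: (le_lt_trans i1).
    by rewrite -[ltRHS]mul1r ltr_pM2r.
  by exists (Ordinal an), k; rewrite ler_pdivrMr// ltr_pdivlMr// i1 i2.
have [a [k hk]] := one theta.1; have [b [l hl]] := one theta.2.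
exists (a, b), (theta - lattice R k l); split.
  by split; rewrite /= in_itv/=.
by exists k, l; rewrite /= !opprB ![_ + (_ - _)]addrC !subrK !subrr normr0.
Qed.

Definition grid_center (n a b : nat) : R * R :=
  ((a%:R + 2^-1) / n%:R, (b%:R + 2^-1) / n%:R).

Lemma grid_square_center (n a b : nat) x : (0 < n)%N ->
  grid_square n a b x -> torus_near (2^-1 / n%:R) x (grid_center n a b).
Proof.
move=> n0; have np : 0 < n%:R :> R by rewrite ltr0n.
have one (c : nat) (t : R) : c%:R / n%:R <= t < c.+1%:R / n%:R ->
   `|t - (c%:R + 2^-1) / n%:R - 0%:~R| <= 2^-1 / n%:R.
  move=> /andP[h1 h2]; rewrite subr0 ler_distl mulrDl -natr1 mulrDl mul1r in h2 *.
  by move: h1 h2; set u := c%:R / _; set v := _^-1; lra.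
by move=> [h1 h2]; rewrite /= !in_itv/= in h1 h2; exists 0, 0; split; exact: one.
Qed.

Lemma grid_square_diam (n a b : nat) x y : (0 < n)%N ->
  grid_square n a b x -> grid_square n a b y -> torus_near (n%:R^-1) x y.
Proof.
move=> n0 hx hy; have -> : n%:R^-1 = 2^-1 / n%:R + 2^-1 / n%:R :> R.
  by rewrite -mulrDl [X in X * _](_ : _ = 1) ?mul1r//; field.
apply: torus_near_trans (grid_square_center n0 hx) _.
exact/torus_near_sym/grid_square_center.
Qed.

(** A majorant of the logarithm of the [m]-step cocycle that can be averaged
along orbits: a lower Darboux sum of the integral over a grid of mesh [1 / n],
plus a large constant times the number of boxes around the jump set that the
[m]-step orbit meets. The infimum over a grid square differs from the value by
the oscillation, which is at most [kappa] off these boxes. *)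
Lemma block_sum_pointwise m (w : nat) (kappa : R) (ps : seq (R * R)) (n := (5 * w)%N) :
  (0 < w)%N -> 0 <= kappa ->
  (forall x, Sg x -> exists2 p, p \in ps & torus_near n%:R^-1 x p) ->
  (forall theta theta', torus_near n%:R^-1 theta' theta ->
    (forall j y, (j < m)%N -> Sg y -> ~ torus_near n%:R^-1 (theta + alpha *+ j) y) ->
    mnorm (A m theta' z - A m theta z) <= kappa) ->
  exists c : 'I_n * 'I_n -> R, [/\ forall ab, 0 <= c ab,
    \sum_ab c ab <= n%:R ^+ 2 * I m &
    forall theta, ln (mnorm (A m theta z)) <=
      \sum_ab c ab * (`[< torus_near (2^-1 / n%:R) theta (grid_center n ab.1 ab.2) >])%:R
      + (ln 4 + kappa) +
      ln (2 * B ^+ m) * \sum_(j < m) \sum_(p <- ps)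
         (`[< torus_near (2 / n%:R) theta (p - alpha *+ j) >])%:R].
Proof.
move=> w0 kappa0 cover osc; have n0 : (0 < n)%N by rewrite muln_gt0.
have np : 0 < n%:R :> R by rewrite ltr0n.
have B1 := B_ge1.
pose V (ab : 'I_n * 'I_n) := [set ln (opnorm (A m x z)) | x in grid_square n ab.1 ab.2].
have V0 ab : lbound (V ab) 0 by move=> _ [x _ <-]; exact: ln_opnorm_ge0.
have Vn ab : V ab !=set0.
  exists (ln (opnorm (A m (ab.1%:R / n%:R, ab.2%:R / n%:R) z))).
  eexists; last reflexivity.
  by split; rewrite /= in_itv/= lexx ltr_pM2r ?invr_gt0// ltr_nat ltnSn.
have c0 ab : 0 <= inf (V ab) by apply: lb_le_inf; [exact: Vn|exact: V0].
have cle (ab : 'I_n * 'I_n) x : grid_square n ab.1 ab.2 x ->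
    inf (V ab) <= ln (opnorm (A m x z)).
  by move=> hx; apply: ge_inf; [exists 0; exact: V0|exists x].
have G0 : 0 <= ln (2 * B ^+ m).
  by rewrite ln_ge0// -[leLHS]mulr1 ler_pM// ?exprn_ege1// ler1n.
exists (fun ab => inf (V ab)); split=> //.
  have := @torus_Rintegral_ge R n (fun ab => inf (V ab)) (ln (2 * B ^+ m))
    (fun theta => ln (opnorm (A m theta z))) n0 c0 (ln_opnorm_ge0 m) (ln_opnorm_le m) cle.
  by rewrite -mulr_suml ler_pdivrMr ?exprn_gt0// mulrC.
move=> theta.
have S10 : 0 <= \sum_ab inf (V ab) * (`[< torus_near (2^-1 / n%:R) theta (grid_center n ab.1 ab.2) >])%:R.
  by apply: sumr_ge0 => ab _; rewrite mulr_ge0.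
have S20 : 0 <= \sum_(j < m) \sum_(p <- ps) (`[< torus_near (2 / n%:R) theta (p - alpha *+ j) >])%:R :> R.
  by apply: sumr_ge0 => j _; apply: sumr_ge0.
have l4 : 0 <= ln (4 : R) by rewrite ln_ge0// ler1n.
have [[j [y [jm Sy near]]]|none] := pselect (exists j y,
    [/\ (j < m)%N, Sg y & torus_near n%:R^-1 (theta + alpha *+ j) y]).
  have [p ps_p near'] := cover y Sy.
  have bad : torus_near (2 / n%:R) theta (p - alpha *+ j).
    have -> : 2 / n%:R = n%:R^-1 + n%:R^-1 :> R by ring.
    have := torus_near_shift (- (alpha *+ j)) (torus_near_trans near near').
    by rewrite addrK.
  have S21 : 1 <= \sum_(j < m) \sum_(p <- ps) (`[< torus_near (2 / n%:R) theta (p - alpha *+ j) >])%:R :> R.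
    rewrite (bigD1 (Ordinal jm))//= (big_rem _ ps_p)/= asboolT// -addrA lerDl addr_ge0//.
      exact: sumr_ge0.
    by apply: sumr_ge0 => i _; exact: sumr_ge0.
  have gG : ln (mnorm (A m theta z)) <= ln (2 * B ^+ m).
    have m1 := mnorm_cocycle_ge1 phi alpha m theta z.
    have mu := mnorm_cocycle_up m theta.
    by rewrite ler_ln ?posrE//; lra.
  apply: (le_trans gG); apply: (@le_trans _ _ (ln (2 * B ^+ m) *
      \sum_(j < m) \sum_(p <- ps) (`[< torus_near (2 / n%:R) theta (p - alpha *+ j) >])%:R)).
    exact: ler_peMr.
  by rewrite lerDr addr_ge0// addr_ge0.
have avoid j y : (j < m)%N -> Sg y -> ~ torus_near n%:R^-1 (theta + alpha *+ j) y.
  by move=> jm Sy near; apply: none; exists j, y.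
have [ab [x [hx near0]]] := grid_point theta n0.
have nearc : torus_near (2^-1 / n%:R) theta (grid_center n ab.1 ab.2).
  by rewrite -[2^-1 / _]add0r; apply: torus_near_trans near0 (grid_square_center n0 hx).
have S1 : inf (V ab) <= \sum_ab inf (V ab) * (`[< torus_near (2^-1 / n%:R) theta (grid_center n ab.1 ab.2) >])%:R.
  rewrite (bigD1 ab)//= asboolT// mulr1 lerDl.
  by apply: sumr_ge0 => i _; rewrite mulr_ge0.
suff low : ln (mnorm (A m theta z)) - (ln 4 + kappa) <= inf (V ab).
  have := mulr_ge0 G0 S20; lra.
apply: lb_le_inf; first exact: Vn.
move=> _ [x' hx' <-].
have near' : torus_near n%:R^-1 x' theta.
  rewrite -[n%:R^-1]addr0.
  by apply: torus_near_trans (grid_square_diam n0 hx' hx) (torus_near_sym near0).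
have := osc theta x' near' avoid; rewrite mnormB => close.
have m1 := mnorm_cocycle_ge1 phi alpha m theta z.
have m1' := mnorm_cocycle_ge1 phi alpha m x' z.
have le1 : ln (mnorm (A m theta z)) <= ln (mnorm (A m x' z)) + kappa.
  apply: le_trans (ln_add_le m1' kappa0); rewrite ler_ln ?posrE; [|lra|lra].
  apply: (le_trans (mnorm_le_add _ (A m x' z))); lra.
have := ln_mnorm_le_opnorm m x'; lra.
Qed.

Lemma sum_visits (beta : R * R) theta (N : nat) x (r : R) :
  \sum_(i < N) (`[< torus_near r (theta + beta *+ i) x >])%:R =
  #|visit_set beta theta N x r|%:R :> R.
Proof.
rewrite -natr_sum -sum1_card [in RHS]big_mkcond /=; congr (_%:R).
by apply: eq_bigr => i _; rewrite inE; case: asboolP.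
Qed.

Lemma visits_bound (beta : R * R) (q : nat) (r : R) : dense_orbits beta ->
  (0 < q)%N -> 2 * r < q%:R^-1 -> exists2 J : R, 0 <= J & forall theta x (N : nat),
    \sum_(i < N) (`[< torus_near r (theta + beta *+ i) x >])%:R <= (N%:R + J) / q%:R ^+ 2.
Proof.
move=> dense q0 rq; have [J hJ] := card_visit_set_le dense q0 rq.
exists J%:R => // theta x N; rewrite sum_visits ler_pdivlMr ?exprn_gt0 ?ltr0n//.
by rewrite -natrX -natrM -natrD ler_nat mulnC.
Qed.

(** Sum the majorant of [block_sum_pointwise] along the orbit of [alpha *+ m]
and exchange the sums. Each grid cell is visited with frequency at most about
[n ^ -2], so the first part is at most the integral up to [kappa / 3]. There
are [O(n)] boxes around the jump set, each visited with frequency [O(n ^ -2)],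
so the last part is [O(1 / n)] on average. *)
Lemma block_sum_growth m (kappa : R) : dense_orbits (alpha *+ m) -> 0 < kappa ->
  exists2 C : R, 0 <= C & forall theta (N : nat),
    \sum_(i < N) ln (mnorm (A m (theta + (alpha *+ m) *+ i) z)) <=
    N%:R * (I m + ln 4 + kappa) + C.
Proof.
move=> dense kappa0; have k3 : 0 < kappa / 3 by rewrite divr_gt0.
have [r0 r0_gt0 osc] := cocycle_oscillation m k3.
have [_ [Cc cover] _] := reg.
have [G GE] : exists G, G = ln (2 * B ^+ m) by eexists.
have B1 := B_ge1.
have G0 : 0 <= G.
  by rewrite GE ln_ge0// -[leLHS]mulr1 ler_pM// ?exprn_ege1// ler1n.
have I0 : 0 <= I m.
  apply: fine_ge0; apply: integral_ge0 => x _; rewrite lee_fin; exact: ln_opnorm_ge0.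
have [K KE] : exists K : R, K = G * (m%:R * Cc%:R) * 5 by eexists.
have K0 : 0 <= K by rewrite KE !mulr_ge0.
have [w [w0 wbig]] := nat_above (Num.max r0^-1 (Num.max (3 * I m / kappa) (3 * K / kappa))).
move: wbig; rewrite !gt_max => /and3P[wr wI wK].
have wp : 0 < w%:R :> R by rewrite ltr0n.
have [n nw] : exists n, n = (5 * w)%N by eexists.
have n0 : (0 < n)%N by rewrite nw muln_gt0.
have np : 0 < n%:R :> R by rewrite ltr0n.
have nE : n%:R = 5 * w%:R :> R by rewrite nw natrM.
have nr : n%:R^-1 <= r0.
  rewrite -[leRHS]invrK lef_pV2 ?posrE ?invr_gt0//; apply: (le_trans (ltW wr)).
  by rewrite nE ler_peMl// ?ltW// ltr1n.
have [ps [size_ps cov]] := cover n n0.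
have [c [c0 csum pointwise]] : exists c : 'I_n * 'I_n -> R, [/\ forall ab, 0 <= c ab,
    \sum_ab c ab <= n%:R ^+ 2 * I m &
    forall theta, ln (mnorm (A m theta z)) <=
      \sum_ab c ab * (`[< torus_near (2^-1 / n%:R) theta (grid_center n ab.1 ab.2) >])%:R
      + (ln 4 + kappa / 3) +
      G * \sum_(j < m) \sum_(p <- ps)
         (`[< torus_near (2 / n%:R) theta (p - alpha *+ j) >])%:R].
  subst n G; apply: block_sum_pointwise => //; first exact: ltW.
  by move=> theta theta'; apply: osc => //; rewrite invr_gt0.
have q0 : (0 < n.-1)%N by rewrite nw -subn1 subn_gt0 (@leq_trans 5)// leq_pmulr.
have n1E : (n.-1)%:R = n%:R - 1 :> R by rewrite -subn1 natrB.
have w1 : 1 <= w%:R :> R by rewrite ler1n.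
have q0' : 0 < (n.-1)%:R :> R by rewrite ltr0n.
(* The grid cells have radius [1 / (2 * n)], so [n - 1] replaces [n]; the jump
boxes have radius [2 / n], for which [w = n / 5] is enough. *)
have [J1 J10 v1] : exists2 J : R, 0 <= J & forall theta x (N : nat),
    \sum_(i < N) (`[< torus_near (2^-1 / n%:R) (theta + (alpha *+ m) *+ i) x >])%:R <= (N%:R + J) / (n.-1)%:R ^+ 2.
  apply: visits_bound => //; rewrite mulrA mulfV// mul1r ltf_pV2 ?posrE// n1E.
  by rewrite ltrBlDr ltrDl.
have [J2 J20 v2] : exists2 J : R, 0 <= J & forall theta x (N : nat),
    \sum_(i < N) (`[< torus_near (2 / n%:R) (theta + (alpha *+ m) *+ i) x >])%:R <= (N%:R + J) / w%:R ^+ 2.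
  apply: visits_bound => //; rewrite nE; rewrite -subr_gt0 (_ : _ - _ = (5 * w%:R)^-1) ?invr_gt0 ?mulr_gt0//.
  by field; rewrite gt_eqF.
exists (2 * J1 * I m + kappa * J2).
  by rewrite addr_ge0// !mulr_ge0// ltW.
move=> theta N; set th := fun i : 'I_N => theta + (alpha *+ m) *+ i.
apply: (le_trans (ler_sum _ (fun i _ => pointwise (th i)))).
rewrite big_split/= big_split/= [\sum_(i < N) (ln 4 + _)]sumr_const card_ord -[(ln 4 + _) *+ N]mulr_natl.
have b1 : \sum_(i < N) \sum_ab c ab * (`[< torus_near (2^-1 / n%:R) (th i) (grid_center n ab.1 ab.2) >])%:R
    <= N%:R * (I m + kappa / 3) + 2 * J1 * I m.
  rewrite exchange_big/=.
  apply: (@le_trans _ _ (\sum_ab c ab * ((N%:R + J1) / (n.-1)%:R ^+ 2))).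
    by apply: ler_sum => ab _; rewrite -mulr_sumr; apply: ler_wpM2l => //; exact: v1.
  rewrite -mulr_suml; apply: (@le_trans _ _ (n%:R ^+ 2 * I m * ((N%:R + J1) / (n.-1)%:R ^+ 2))).
    by apply: ler_wpM2r => //; rewrite divr_ge0 ?addr_ge0 ?exprn_ge0.
  have ratio : n%:R ^+ 2 / (n.-1)%:R ^+ 2 <= 1 + w%:R^-1 :> R.
    by rewrite ler_pdivrMr ?exprn_gt0// n1E nE grid_ratio_le.
  have Iw : I m / w%:R <= kappa / 3 by exact: ler_third.
  have -> : n%:R ^+ 2 * I m * ((N%:R + J1) / n.-1%:R ^+ 2) =
            (n%:R ^+ 2 / n.-1%:R ^+ 2) * (I m * (N%:R + J1)) by ring.
  apply: (@le_trans _ _ ((1 + w%:R^-1) * (I m * (N%:R + J1)))).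
    by rewrite ler_wpM2r// mulr_ge0// addr_ge0.
  have -> : (1 + w%:R^-1) * (I m * (N%:R + J1)) =
     N%:R * (I m + I m / w%:R) + (1 + w%:R^-1) * (J1 * I m) by ring.
  apply: lerD; first by rewrite ler_wpM2l// lerD2l.
  rewrite -mulrA ler_wpM2r ?mulr_ge0//.
  by rewrite -[2](_ : 1 + 1 = _)// lerD2l invf_le1.
have b2 : \sum_(i < N) G * \sum_(j < m) \sum_(p <- ps) (`[< torus_near (2 / n%:R) (th i) (p - alpha *+ j) >])%:R
    <= N%:R * (kappa / 3) + kappa * J2.
  rewrite -mulr_sumr exchange_big/=.
  apply: (@le_trans _ _ (G * \sum_(j < m) \sum_(p <- ps) ((N%:R + J2) / w%:R ^+ 2))).
    apply: ler_wpM2l => //; apply: ler_sum => j _; rewrite exchange_big/=.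
    by apply: ler_sum => p _; exact: v2.
  under eq_bigr do rewrite big_const_seq count_predT iter_addr_0.
  rewrite sumr_const card_ord -!mulrnA -[X in _ * X]mulr_natl.
  have N0 : 0 <= N%:R + J2 by rewrite addr_ge0.
  apply: (@le_trans _ _ (K / w%:R * (N%:R + J2))).
    have -> : K / w%:R * (N%:R + J2) = G * ((m%:R * (Cc%:R * n%:R)) * ((N%:R + J2) / w%:R ^+ 2)).
      by rewrite KE nE; field; rewrite gt_eqF.
    apply: ler_wpM2l => //; apply: ler_wpM2r; first by rewrite divr_ge0// exprn_ge0.
    by rewrite -!natrM ler_nat mulnC leq_mul2l size_ps orbT.
  have Kw : K / w%:R <= kappa / 3 by exact: ler_third.
  apply: (@le_trans _ _ (kappa / 3 * (N%:R + J2))); first by rewrite ler_wpM2r.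
  rewrite mulrDr [kappa / 3 * _]mulrC lerD2l ler_wpM2r//.
  by rewrite ler_piMr ?(ltW kappa0)// invf_le1 ?ler1n.
apply: (le_trans (lerD (lerD b1 (lexx _)) b2)).
by rewrite le_eqVlt; apply/orP; left; apply/eqP; field.
Qed.

Lemma cocycle_blocks m n theta :
  ln (mnorm (A (n * m)%N theta z)) <=
  ln 2 + \sum_(i < n) ln (mnorm (A m (theta + (alpha *+ m) *+ i) z)).
Proof.
elim: n => [|n IH]; first by rewrite mul0n /= mnorm1 big_ord0 addr0.
rewrite mulSn cocycleD big_ord_recr/= addrA.
rewrite -mulrnA [(m * n)%N]mulnC.
have g1 k t := mnorm_cocycle_ge1 phi alpha k t z.
have gp k t : 0 < mnorm (A k t z) by apply: lt_le_trans (g1 k t).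
apply: (@le_trans _ _ (ln (mnorm (A m (theta + alpha *+ (n * m)) z) * mnorm (A (n * m)%N theta z)))).
  rewrite ler_ln ?posrE ?mulr_gt0//; first exact: mnormM.
  by rewrite -cocycleD; exact: gp.
by rewrite lnM ?posrE// [leLHS]addrC lerD2r.
Qed.

(** The Lyapunov rate bounds the growth uniformly in the starting point: cut
[k] steps into blocks of length [m], use submultiplicativity and
[block_sum_growth], and absorb the incomplete last block in the constant. *)
Lemma cocycle_upper_bound m (kappa Lam : R) : (0 < m)%N ->
  dense_orbits (alpha *+ m) -> 0 < kappa -> I m + ln 4 + kappa <= m%:R * Lam -> 0 <= Lam ->
  exists2 M : R, 1 <= M & forall k theta, mnorm (A k theta z) <= M * expR Lam ^+ k.
Proof.
move=> m0 dense kappa0 small Lam0.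
have [C C0 growth] := block_sum_growth dense kappa0.
have B1 := B_ge1.
have Bm : 1 <= 2 * B ^+ m by rewrite -[leLHS]mulr1 ler_pM ?exprn_ege1// ler1n.
exists (expR (ln (2 * B ^+ m) + ln 2 + C)).
  have := expR_ge1Dx (ln (2 * B ^+ m) + ln 2 + C).
  have := ln_ge0 Bm; have : 0 <= ln (2 : R) by rewrite ln_ge0// ler1n.
  lra.
move=> k theta.
have g1 j t := mnorm_cocycle_ge1 phi alpha j t z.
have gp j t : 0 < mnorm (A j t z) by apply: lt_le_trans (g1 j t).
rewrite -expRM_natl -expRD -[leLHS]lnK ?posrE// ler_expR.
pose n := (k %/ m)%N; pose s := (k %% m)%N.
have ke : k = (s + n * m)%N by rewrite addnC -divn_eq.
have sm : (s < m)%N by rewrite ltn_mod.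
have l1 : ln (mnorm (A k theta z)) <= ln (2 * B ^+ m) + ln (mnorm (A (n * m)%N theta z)).
  rewrite -lnM ?posrE//; last by lra.
  rewrite ler_ln ?posrE ?mulr_gt0//; last by lra.
  rewrite {1}ke cocycleD; apply: (le_trans (mnormM _ _)).
  rewrite ler_wpM2r ?mnorm_ge0//; apply: (le_trans (mnorm_cocycle_up _ _)).
  by rewrite ler_pM2l// ler_weXn2l// ltnW.
have l2 := cocycle_blocks m n theta.
have l3 := growth theta n.
have l4 : n%:R * (I m + ln 4 + kappa) <= k%:R * Lam.
  apply: (@le_trans _ _ (n%:R * (m%:R * Lam))); first by rewrite ler_wpM2l.
  rewrite mulrA ler_wpM2r// -natrM ler_nat ke leq_addl//.
lra.
Qed.

End UpperBound.

(** * Stable growth at a good point *)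

Section GrowthEstimates.
Variable R : realType.

Lemma exp_log_dominates (c K : R) : 0 < c -> 0 <= K ->
  exists n0 : nat, forall n : nat, (n0 <= n)%N -> K * (1 + ln n%:R) <= expR (c * ln n%:R).
Proof.
move=> c0 K0; pose y0 : R := Num.max 1 (2 * K * (1 + c^-1)).
have [n0 [n00 hn0]] := nat_above (expR (y0 / c)).
exists n0 => n nn.
have n1 : n0%:R <= n%:R :> R by rewrite ler_nat.
have np : 0 < n%:R :> R by apply: lt_le_trans n1; rewrite ltr0n.
have ly : y0 / c <= ln n%:R.
  rewrite -ler_expR lnK ?posrE//; exact: le_trans (ltW hn0) n1.
move: ly; rewrite ler_pdivrMr// mulrC; move: (ln _) => l ly.
have [y yE] : exists y, y = c * l by eexists.
have lE : l = y * c^-1 by rewrite yE; field; rewrite gt_eqF.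
rewrite -yE lE in ly *.
move: ly; rewrite ge_max => /andP[y1 yK].
have ci : 0 < c^-1 by rewrite invr_gt0.
apply: (@le_trans _ _ (1 + y ^+ 2 / 2)); last by apply: (@expR_ge1Dxn _ y 1); lra.
have h1 : K * (1 + y * c^-1) <= K * ((1 + c^-1) * y).
  by apply: ler_wpM2l => //; rewrite mulrDl mul1r [c^-1 * y]mulrC lerD2r.
have h2 : 2 * K * (1 + c^-1) * y <= y * y by rewrite ler_wpM2r//; lra.
by rewrite expr2; move: h1 h2; rewrite mulrA; lra.
Qed.

Lemma pow1D_le_linear (y : R) (k : nat) : 0 <= y -> k%:R * y <= 2^-1 ->
  (1 + y) ^+ k - 1 <= 2 * (k%:R * y).
Proof.
move=> y0; have t0 : 0 <= k%:R * y by rewrite mulr_ge0.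
have le : (1 + y) ^+ k <= expR (k%:R * y).
  rewrite expRM_natl lerXn2r ?nnegrE ?expR_ge0 ?addr_ge0//; exact: expR_ge1Dx.
move: le t0; move: (k%:R * y) ((1 + y) ^+ k) => t p le t0 t2.
have : expR t * (1 - t) <= 1.
  by rewrite -ler_pdivlMl ?expR_gt0// mulr1 -expRN; exact: expR_ge1Dx.
have := expR_ge1Dx t; nra.
Qed.

Lemma near_unit_shift (s t : R) : 0 <= s < 1 -> 0 <= t < 1 -> forall (r : R) (k : int),
  r <= 2^-1 -> `|s - t - k%:~R| <= r -> k \in [:: -1; 0; 1].
Proof.
move=> hs ht r k r2; rewrite ler_distl => h.
have k1 : (-2)%:~R < k%:~R :> R by rewrite rmorphN/=; lra.
have k2 : k%:~R < 2%:~R :> R by lra.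
by move: k1 k2; rewrite !ltr_int !inE; clear; case: k => [[|[|n]]|[|[|n]]].
Qed.

End GrowthEstimates.

Section LowerBound.
Variables (R : realType) (phi : R * R -> R) (alpha : R * R).
Variables (gamma H : R) (Sg : set (R * R)).
Hypotheses (gamma0 : 0 < gamma) (gamma1 : gamma <= 1) (H0 : 0 < H).
Hypothesis reg : piecewise_regular phi gamma H Sg.
Variable z : R[i].
Local Notation A := (cocycle phi alpha).
Local Notation normc := (@ComplexField.Normc.normc R).
Local Notation B := (normc z + H + 2).
Implicit Types (theta x y p : R * R).
Local Notation muT := (lebesgue_measure \x lebesgue_measure)%E.
Local Notation D := (@fundamental_domain R).
Local Notation I m := (Rintegral muT D (fun theta => ln (opnorm (A m theta z)))).

(** If the cocycle were at most [c] at all points whose first [k] iterates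
avoid the jump set, its integral would be at most [c] plus the contribution of
the small boxes around the preimages of the jump set, of total area [O(k /
n)]. *)
Lemma good_point (C k n : nat) (c : R) (ps : seq (R * R)) : (4 <= n)%N -> 0 <= c ->
  (size ps <= C * n)%N ->
  (forall x, Sg x -> exists2 p, p \in ps & torus_near n%:R^-1 x p) ->
  c + 144 * ln (2 * B ^+ k) * k%:R * C%:R / n%:R < I k ->
  exists x, c < ln (opnorm (A k x z)) /\
    forall j y, (j < k)%N -> Sg y -> ~ torus_near n%:R^-1 (x + alpha *+ j) y.
Proof.
move=> n4 c0 sz cov; apply: contraPP => /forallNP none.
have np : 0 < n%:R :> R by rewrite ltr0n (leq_trans _ n4).
have n4' : 4 <= n%:R :> R by rewrite ler_nat.
have r2 : 2 / n%:R <= 2^-1 :> R by rewrite ler_pdivrMr//; lra.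
apply/negP; rewrite -leNgt.
pose fr (x : R * R) := x - lattice R (Num.floor x.1) (Num.floor x.2).
(* A torus box of radius at most [1 / 2] meets the fundamental domain in boxes
around at most nine lifts of its centre. *)
pose I3 : seq int := [:: -1; 0; 1].
pose s := [seq fr (jp.2 - alpha *+ jp.1) + lattice R ab.1 ab.2
           | jp <- [seq (j, p) | j <- iota 0 k, p <- ps], ab <- [seq (a, b) | a <- I3, b <- I3]].
have size_s : size s = (9 * (k * size ps))%N.
  by rewrite /s !size_allpairs size_iota /= mulnC.
have G0 : 0 <= ln (2 * B ^+ k).
  rewrite ln_ge0// -[leLHS]mulr1 ler_pM// ?ler1n// exprn_ege1//.
  exact: B_ge1.
have := @torus_Rintegral_le R s (2 / n%:R) c (ln (2 * B ^+ k))
   (fun theta => ln (opnorm (A k theta z))) _ c0 G0 (ln_opnorm_ge0 phi alpha z k).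
move=> /(_ _ _ _)/le_trans; apply.
- by rewrite divr_ge0// ltW.
- move=> x; apply: (le_trans (ln_opnorm_le alpha H0 reg z k x)).
  by rewrite lerDr.
- move=> x [Dx1 Dx2] out; rewrite leNgt; apply/negP => big.
  apply: (none x); split=> // j y jk Sy near.
  have [p ps_p near'] := cov y Sy.
  have bad : torus_near (2 / n%:R) x (p - alpha *+ j).
    have -> : 2 / n%:R = n%:R^-1 + n%:R^-1 :> R by ring.
    have := torus_near_shift (- (alpha *+ j)) (torus_near_trans near near').
    by rewrite addrK.
  set q := p - alpha *+ j in bad.
  have [k1 [l1 [h1 h2]]] := bad.
  have /andP[f1 f2] := mem_rg1_floor q.1; have /andP[f3 f4] := mem_rg1_floor q.2.
  pose a := k1 + Num.floor q.1; pose b := l1 + Num.floor q.2.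
  have e1 : `|x.1 - (fr q).1 - a%:~R| <= 2 / n%:R.
    by apply: le_trans h1; rewrite /fr /a /= rmorphD/= le_eqVlt; apply/orP; left; apply/eqP; congr Num.norm; ring.
  have e2 : `|x.2 - (fr q).2 - b%:~R| <= 2 / n%:R.
    by apply: le_trans h2; rewrite /fr /b /= rmorphD/= le_eqVlt; apply/orP; left; apply/eqP; congr Num.norm; ring.
  rewrite /= !in_itv/= in Dx1 Dx2.
  have a3 : a \in I3.
    by apply: (near_unit_shift Dx1 _ r2 e1); rewrite /fr /= subr_ge0 f1/= ltrBlDl.
  have b3 : b \in I3.
    by apply: (near_unit_shift Dx2 _ r2 e2); rewrite /fr /= subr_ge0 f3/= ltrBlDl.
  apply: (out (fr q + lattice R a b)).
    apply/allpairsP; exists ((j, p), (a, b)); split=> //.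
      by apply/allpairsP; exists (j, p); split=> //; rewrite mem_iota.
    by apply/allpairsP; exists (a, b).
  by apply/closed_boxP; rewrite /= !opprD !addrA in e1 e2 *.
rewrite lerD2l size_s.
have -> : 144 * ln (2 * B ^+ k) * k%:R * C%:R / n%:R =
  ln (2 * B ^+ k) * (9 * (k%:R * (C%:R * n%:R))) * (2 * (2 / n%:R)) ^+ 2.
  by field; rewrite gt_eqF.
rewrite ler_wpM2r ?sqr_ge0// ler_wpM2l//.
by rewrite -!natrM ler_nat !leq_mul.
Qed.

(** Near a point whose orbit avoids the jumps, the perturbation of the product
is at most [M * expR (k * lam) * 2 * k * M * d], which is below half of its
norm when the growth at the point is close to the uniform rate [lam]. *)
Lemma stable_lower_bound (M lam c d e : R) (k n : nat) x : (4 <= n)%N ->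
  1 <= M -> 0 <= lam -> 0 <= e ->
  (forall k theta, mnorm (A k theta z) <= M * expR lam ^+ k) ->
  c < ln (opnorm (A k x z)) ->
  (forall j y, (j < k)%N -> Sg y -> ~ torus_near n%:R^-1 (x + alpha *+ j) y) ->
  d = e + H * n%:R^-1 `^ gamma ->
  4 * k%:R * M ^+ 2 * d * expR (k%:R * lam) <= expR c ->
  2 * k%:R * M * d <= 1 ->
  forall x' z', torus_near n%:R^-1 x' x -> normc (z' - z) <= e ->
  expR c / 2 <= mnorm (A k x' z').
Proof.
move=> n4 M1 lam0 e0 up big avoid dE small1 small2 x' z' near close.
have np : 0 < n%:R :> R by rewrite ltr0n (leq_trans _ n4).
have r0 : 0 < n%:R^-1 :> R by rewrite invr_gt0.
have r4 : n%:R^-1 <= 4^-1 :> R by rewrite lef_pV2 ?posrE// ler_nat.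
have d0 : 0 <= d by rewrite dE addr_ge0// mulr_ge0 ?powR_ge0// ltW.
have L1 : 1 <= expR lam by rewrite -expR0 ler_expR.
have step j : (j < k)%N ->
    mnorm (transfer phi (x' + alpha *+ j) z' - transfer phi (x + alpha *+ j) z) <= d.
  move=> jk; rewrite dE.
  apply: (le_trans (@transfer_close _ _ _ _ _ reg z n%:R^-1 (x + alpha *+ j) (x' + alpha *+ j) z' r0 r4 _ _)).
  - exact: torus_near_shift.
  - by move=> y; exact: avoid.
  by rewrite lerD2r.
have := cocycle_perturb L1 M1 d0 up step.
have M0 : 0 <= M by lra.
have Md : 0 <= M * d by rewrite mulr_ge0.
have pw := @pow1D_le_linear _ (M * d) k Md.
have pw1 : (1 + M * d) ^+ k - 1 <= 2 * (k%:R * (M * d)).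
  by apply: pw; move: small2; rewrite -!mulrA; lra.
have o1 : 1 <= opnorm (A k x z) by rewrite opnorm_ge1// det_cocycle.
have big' : expR c <= opnorm (A k x z).
  by rewrite -[leRHS]lnK ?posrE ?ler_expR ?ltW//; lra.
have := opnorm_le_mnorm (A k x z).
rewrite mnormB => le1 le2.
have le3 := mnorm_le_add (A k x z) (A k x' z').
have le4 : M * expR lam ^+ k * ((1 + M * d) ^+ k - 1) <= expR c / 2.
  apply: (@le_trans _ _ (M * expR lam ^+ k * (2 * (k%:R * (M * d))))).
    by rewrite ler_wpM2l// mulr_ge0// exprn_ge0// expR_ge0.
  rewrite -expRM_natl ler_pdivlMr// (_ : _ * 2 = 4 * k%:R * M ^+ 2 * d * expR (k%:R * lam))//.
  ring.
lra.
Qed.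

End LowerBound.

Section Growth.
Variable R : realType.
Implicit Types (phi : R * R -> R) (alpha x theta : R * R).
Local Notation muT := (lebesgue_measure \x lebesgue_measure)%E.
Local Notation normc := (@ComplexField.Normc.normc R).

Definition lyap_integral phi alpha (k : nat) (z : R[i]) : R :=
  Rintegral muT (@fundamental_domain R)
    (fun theta => ln (opnorm (cocycle phi alpha k theta z))).

(** A limit that does not exist is zero by convention, so positivity of the
exponent provides the convergence. *)
Lemma lyapunov_limit phi alpha z : 0 < lyapunov phi alpha z ->
  forall e, 0 < e -> exists k0 : nat, forall k : nat, (k0 <= k)%N -> (0 < k)%N ->
    (lyapunov phi alpha z - e) * k%:R < lyap_integral phi alpha k z /\
    lyap_integral phi alpha k z < (lyapunov phi alpha z + e) * k%:R.
Proof.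
move=> L0 e e0; set u := fun k : nat => k%:R^-1 * lyap_integral phi alpha k z.
have cu : cvgn u.
  apply: contrapT => /dvgP lim0; move: L0; rewrite /lyapunov -/u lim0.
  by rewrite ltxx.
have /cvgrPdist_lt /(_ e e0) [k0 _ hk0] := cu.
exists k0 => k kk k_gt0; have kp : 0 < k%:R :> R by rewrite ltr0n.
have := hk0 k kk; rewrite /= -[lim _]/(lyapunov phi alpha z) ltr_distl.
move=> /andP[h1 h2]; rewrite /u [k%:R^-1 * _]mulrC in h1 h2.
split; first by rewrite -ltr_pdivlMr// ltrBlDr.
by rewrite -ltr_pdivrMr// -ltrBlDr.
Qed.

(** With [k] about [l / delta] steps and [l = ln n]: the product gains [n ^
(30 * D)] up to a constant, while the gap [3 * kappa * k] between the uniform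
rate and the growth at the good point costs at most [n ^ (gamma / 2)], half of
what the Hoelder bound [n ^- gamma] provides. *)
Lemma growth_parameters (L gamma : R) (D : nat) (l : R) (k : nat)
    (delta kappa : R) : (0 < D)%N -> 0 < L ->
  delta = L / (40 * D%:R) -> kappa <= gamma * delta / 6 -> kappa <= L / 8 ->
  k%:R * delta <= l -> l <= (k%:R + 1) * delta -> 0 <= gamma ->
  3 * kappa * k%:R <= gamma / 2 * l /\
  30 * D%:R * l - 3 * L / 4 <= (L - 2 * kappa) * k%:R.
Proof.
move=> D0 L0 dE k1 k2 kl lk g0.
have Dp : 0 < D%:R :> R by rewrite ltr0n.
have dp : 0 < delta by rewrite dE divr_gt0// mulr_gt0.
have LE : L = 40 * D%:R * delta by rewrite dE; field; rewrite gt_eqF.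
have k0 : 0 <= k%:R :> R by [].
split.
  apply: (@le_trans _ _ (3 * (gamma * delta / 6) * k%:R)).
    by rewrite ler_wpM2r// ler_wpM2l.
  rewrite (_ : 3 * _ * _ = gamma / 2 * (k%:R * delta)); last by field.
  by rewrite ler_wpM2l// divr_ge0.
apply: (@le_trans _ _ (3 * L / 4 * k%:R)); last by rewrite ler_wpM2r//; lra.
have : 30 * D%:R * l <= 30 * D%:R * ((k%:R + 1) * delta) by rewrite ler_wpM2l// mulr_ge0// ltW.
by rewrite LE; lra.
Qed.

(** Combine [good_point] and [stable_lower_bound] at time [k] proportional to
[ln n]. The uniform bound at rate [L + kappa] and the good point at rate [L -
2 * kappa] differ by [3 * kappa] only, so the Hoelder gain [n ^- gamma] beats
the loss in the perturbation estimate. *)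
Lemma transfer_growth phi alpha (gamma H : R) (Sg : set (R * R)) (E : R) :
  0 < gamma -> gamma <= 1 -> 0 < H -> piecewise_regular phi gamma H Sg ->
  (forall m, (0 < m)%N -> dense_orbits (alpha *+ m)) ->
  0 < lyapunov phi alpha E%:C ->
  forall D : nat, (0 < D)%N -> exists n0 : nat, forall n : nat, (n0 <= n)%N ->
    exists (k : nat) x, [/\ (0 < k)%N, (k <= n)%N &
      forall x' z', torus_near n%:R^-1 x' x -> normc (z' - E%:C) <= n%:R ^- (4 * D) ->
        8 * n%:R ^+ (28 * D) <= mnorm (cocycle phi alpha k x' z')].
Proof.
move=> gamma0 gamma1 H0 reg dense L0 D D0.
have [L LE] : exists L, L = lyapunov phi alpha E%:C by eexists.
have lim := lyapunov_limit L0; rewrite -LE in lim L0.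
have Dp : 0 < D%:R :> R by rewrite ltr0n.
have D1 : 1 <= D%:R :> R by rewrite ler1n.
have [delta dE] : exists delta, delta = L / (40 * D%:R) by eexists.
have dp : 0 < delta by rewrite dE divr_gt0// mulr_gt0.
have [kappa kE] : exists kappa, kappa = Num.min (gamma * delta / 6) (L / 8) by eexists.
have kp : 0 < kappa by rewrite kE lt_min !divr_gt0// mulr_gt0.
have k1 : kappa <= gamma * delta / 6 by rewrite kE ge_min lexx.
have k2 : kappa <= L / 8 by rewrite kE ge_min lexx orbT.
set z := E%:C in lim *.
have [M M1 up] : exists2 M : R, 1 <= M & forall k theta,
    mnorm (cocycle phi alpha k theta z) <= M * expR (L + kappa) ^+ k.
  have k3 : 0 < kappa / 3 by rewrite divr_gt0.
  have [m0 hm0] := lim _ k3.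
  have [m1 [m1_gt0 m1big]] := nat_above (3 * (ln 4 + 1) / (2 * kappa)).
  pose m := maxn m0 m1.
  have mgt0 : (0 < m)%N by rewrite (leq_trans m1_gt0)// leq_maxr.
  have mm1 : m1%:R <= m%:R :> R by rewrite ler_nat leq_maxr.
  have [_ Im] := hm0 m (leq_maxl _ _) mgt0.
  apply: (cocycle_upper_bound gamma0 H0 reg mgt0 (dense m mgt0) ltr01); last by lra.
  have : 3 * (ln 4 + 1) / (2 * kappa) < m%:R by apply: lt_le_trans mm1.
  rewrite ltr_pdivrMr ?mulr_gt0// => h.
  move: Im h; rewrite /lyap_integral; move: (Rintegral _ _ _) (ln 4) (m%:R : R) => I l4 mr.
  lra.
have [_ [Cc cover] _] := reg.
have [k0 hk0] := lim _ kp.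
have [B BE] : exists B, B = normc z + H + 2 by eexists.
have B1 : 1 <= B by rewrite BE; exact: B_ge1.
have lB0 : 0 <= ln B by rewrite ln_ge0.
have l20 : 0 <= ln (2 : R) by rewrite ln_ge0// ler1n.
have Cc0 : 0 <= Cc%:R :> R by [].
(* Only finitely many comparisons between a logarithm and a power of [n] are
needed, one for each smallness condition below. *)
have [K1 K1E] : exists K, K = (144 * Cc%:R * (ln 2 + ln B / delta) + 1) / kappa by eexists.
have K10 : 0 <= K1.
  by rewrite K1E divr_ge0 ?ltW// ltr_wpDl// !mulr_ge0// addr_ge0// divr_ge0// ltW.
have [n1 hn1] := exp_log_dominates ltr01 K10.
have [K2 K2E] : exists K, K = 4 * M ^+ 2 * (1 + H) / delta by eexists.
have K20 : 0 <= K2.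
  rewrite K2E divr_ge0 ?(ltW dp)// !mulr_ge0 ?sqr_ge0//; lra.
have g2 : 0 < gamma / 2 by rewrite divr_gt0.
have [n2 hn2] := exp_log_dominates g2 K20.
have [K3 K3E] : exists K, K = 16 * expR (3 * L / 4) by eexists.
have K30 : 0 <= K3 by rewrite K3E mulr_ge0// expR_ge0.
have D2 : 0 < 2 * D%:R :> R by rewrite mulr_gt0.
have [n3 hn3] := exp_log_dominates D2 K30.
have dinv : 0 <= delta^-1 by rewrite invr_ge0 ltW.
have [n4 hn4] := exp_log_dominates ltr01 dinv.
have [n5 [n5_gt0 hn5]] := nat_above (expR ((k0%:R + 1) * delta)).
exists (maxn (maxn n1 n2) (maxn (maxn n3 n4) (maxn n5 4))) => n.
rewrite !geq_max -!andbA => /and5P[nn1 nn2 nn3 nn4 /andP[nn5 n_ge4]].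
have n_gt0 : (0 < n)%N by apply: leq_trans n_ge4.
have np : 0 < n%:R :> R by rewrite ltr0n.
have {}hn1 := hn1 n nn1; have {}hn2 := hn2 n nn2.
have {}hn3 := hn3 n nn3; have {}hn4 := hn4 n nn4.
have [l lE] : exists l, l = ln (n%:R : R) by eexists.
have nE : n%:R = expR l by rewrite lE lnK// posrE.
rewrite -lE !mul1r in hn1 hn2 hn3 hn4.
have l0 : 0 <= l by rewrite lE ln_ge0// ler1n.
have lk0 : (k0%:R + 1) * delta <= l.
  rewrite -ler_expR -nE (le_trans (ltW hn5))// ler_nat//.
pose k := Num.truncn (l / delta).
have ld0 : 0 <= l / delta by rewrite divr_ge0// ltW.
have /andP[kl lk] := truncn_itv ld0.
rewrite -/k ler_pdivlMr// in kl; rewrite -/k ltr_pdivrMr// -natr1 in lk.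
have kk0 : (k0 < k)%N.
  rewrite -(ltr_nat R); have : (k0%:R + 1) * delta < (k%:R + 1) * delta by apply: le_lt_trans lk.
  by rewrite ltr_pM2r// ltrD2r.
have k_gt0 : (0 < k)%N by apply: leq_ltn_trans kk0.
have kgt0 : 0 < k%:R :> R by rewrite ltr0n.
have kn : (k <= n)%N.
  rewrite -(ler_nat R) nE; apply: (le_trans _ hn4); rewrite mulrC.
  by rewrite ler_pdivlMr//; lra.
have [par1 par2] := growth_parameters D0 L0 dE k1 k2 kl (ltW lk) (ltW gamma0).
have [Ik _] := hk0 k (ltnW kk0) k_gt0.
have [ps [size_ps cov]] := cover n n_gt0.
have c0 : 0 <= (L - 2 * kappa) * k%:R by rewrite mulr_ge0//; lra.
have GE : ln (2 * B ^+ k) = ln 2 + k%:R * ln B.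
  have Bp : 0 < B by lra.
  by rewrite lnM ?posrE ?exprn_gt0// lnXn// mulr_natl.
have room : (L - 2 * kappa) * k%:R + 144 * ln (2 * B ^+ k) * k%:R * Cc%:R / n%:R
    < lyap_integral phi alpha k z.
  apply: le_lt_trans Ik; rewrite -lerBrDl.
  have -> : (L - kappa) * k%:R - (L - 2 * kappa) * k%:R = kappa * k%:R by ring.
  rewrite ler_pdivrMr// GE.
  have e1 : k%:R * ln B <= ln B / delta * l.
    rewrite mulrC -mulrA ler_wpM2l// mulrC ler_pdivlMr//.
  have e2 : ln 2 + k%:R * ln B <= (ln 2 + ln B / delta) * (1 + l).
    have := mulr_ge0 l20 l0; have : 0 <= ln B / delta by rewrite divr_ge0// ltW.
    move: e1; move: (k%:R * ln B) (ln B / delta) (ln 2) => a b t; lra.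
  have e3 : 144 * Cc%:R * (ln 2 + k%:R * ln B) <= kappa * n%:R.
    apply: (@le_trans _ _ (kappa * (K1 * (1 + l)))); last first.
      by rewrite nE ler_wpM2l// ltW.
    rewrite K1E mulrA [kappa * _]mulrC mulfVK ?gt_eqF// [(_ + 1) * _]mulrDl [1 * (1 + l)]mul1r.
    apply: (@le_trans _ _ (144 * Cc%:R * ((ln 2 + ln B / delta) * (1 + l)))).
      by rewrite ler_wpM2l// mulr_ge0.
    by rewrite mulrA lerDl; lra.
  have -> : 144 * (ln 2 + k%:R * ln B) * k%:R * Cc%:R =
     144 * Cc%:R * (ln 2 + k%:R * ln B) * k%:R by ring.
  by rewrite [leRHS]mulrAC ler_wpM2r.
rewrite BE in room.
have [x [xbig avoid]] := good_point H0 reg n_ge4 c0 size_ps cov room.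
exists k, x; split=> // x' z' near close.
have [e eE] : exists e, e = n%:R ^- (4 * D) :> R by eexists.
have e0 : 0 <= e by rewrite eE invr_ge0 exprn_ge0.
have [d dE'] : exists d, d = e + H * n%:R^-1 `^ gamma by eexists.
have rE : n%:R^-1 `^ gamma = expR (- (gamma * l)).
  by rewrite nE -expRN -expRM mulrC mulrN.
have eG : e <= expR (- (gamma * l)).
  rewrite eE nE -expRM_natl -expRN ler_expR lerN2 ler_wpM2r//.
  by rewrite (le_trans gamma1)// ler1n muln_gt0.
have d0 : 0 <= d by rewrite dE' addr_ge0// mulr_ge0 ?powR_ge0// ltW.
have dle : d <= (1 + H) * expR (- (gamma * l)).
  by rewrite dE' rE mulrDl mul1r lerD2r.
have M0 : 0 <= M by lra.
have main : 4 * k%:R * M ^+ 2 * d * expR (3 * kappa * k%:R) <= 1.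
  apply: (@le_trans _ _ (4 * (l / delta) * M ^+ 2 * ((1 + H) * expR (- (gamma * l))) * expR (gamma / 2 * l))).
    have M20 : 0 <= M ^+ 2 := sqr_ge0 M.
    apply: ler_pM; [by rewrite !mulr_ge0 | exact: expR_ge0 | | by rewrite ler_expR].
    apply: ler_pM; [by rewrite !mulr_ge0 | by [] | | exact: dle].
    by rewrite ler_wpM2r// ler_wpM2l// ler_pdivlMr.
  have -> : 4 * (l / delta) * M ^+ 2 * ((1 + H) * expR (- (gamma * l))) * expR (gamma / 2 * l) =
     K2 * l * expR (- (gamma / 2 * l)).
    have -> : - (gamma * l) = - (gamma / 2 * l) + - (gamma / 2 * l) by field.
    rewrite expRD K2E [expR (gamma / 2 * l)](_ : _ = (expR (- (gamma / 2 * l)))^-1); last by rewrite expRN invrK.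
    have : expR (- (gamma / 2 * l)) != 0 by rewrite gt_eqF// expR_gt0.
    have dn : delta != 0 by rewrite gt_eqF.
    by move: (expR _) => X X0; field; rewrite X0 dn.
  rewrite expRN ler_pdivrMr ?expR_gt0// mul1r; apply: le_trans hn2.
  by rewrite ler_wpM2l//; lra.
have e3 : 1 <= expR (3 * kappa * k%:R) by rewrite -expR0 ler_expR !mulr_ge0// ltW.
have small1 : 4 * k%:R * M ^+ 2 * d * expR (k%:R * (L + kappa)) <= expR ((L - 2 * kappa) * k%:R).
  have -> : k%:R * (L + kappa) = 3 * kappa * k%:R + (L - 2 * kappa) * k%:R by ring.
  by rewrite expRD mulrA ler_piMl// expR_ge0.
have kMd : 0 <= k%:R * M * d by rewrite !mulr_ge0.
have small2 : 2 * k%:R * M * d <= 1.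
  apply: le_trans main; apply: (@le_trans _ _ (4 * k%:R * M ^+ 2 * d)).
    have -> : 4 * k%:R * M ^+ 2 * d = 4 * M * (k%:R * M * d) by ring.
    have -> : 2 * k%:R * M * d = 2 * (k%:R * M * d) by ring.
    by rewrite ler_wpM2r//; lra.
  by rewrite ler_peMr// !mulr_ge0 ?sqr_ge0.
have Lk0 : 0 <= L + kappa by lra.
rewrite -eE in close.
apply: le_trans (stable_lower_bound H0 reg n_ge4 M1 Lk0 e0 up xbig avoid dE' small1 small2 near close).
rewrite ler_pdivlMr//; apply: (@le_trans _ _ (expR (30 * D%:R * l - 3 * L / 4))); last by rewrite ler_expR.
rewrite expRD expRN ler_pdivlMr ?expR_gt0//.
have -> : 8 * n%:R ^+ (28 * D) * 2 * expR (3 * L / 4) = K3 * expR (28 * D%:R * l).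
  by rewrite nE -expRM_natl natrM K3E; ring.
have -> : 30 * D%:R * l = 2 * D%:R * l + 28 * D%:R * l by ring.
rewrite expRD ler_wpM2r ?expR_ge0//; apply: le_trans hn3.
by rewrite ler_peMr//; lra.
Qed.

End Growth.

(** * Currents and decay on a half-line *)

Section Currents.
Variable R : realType.
Local Notation C := R[i].
Local Notation normc := (@ComplexField.Normc.normc R).
Implicit Types (x y w v : C).

(** The imaginary part of [x * conj y]. For a solution [w] of the difference
equation with a real potential, [current (w n) (w n.+1)] changes only through
the imaginary part of the energy. *)
Definition current x y : R := complex.Im x * complex.Re y - complex.Re x * complex.Im y.

Lemma normc_sqrE x : normc x ^+ 2 = complex.Re x ^+ 2 + complex.Im x ^+ 2.
Proof. by case: x => a b; rewrite /= sqr_sqrtr// addr_ge0 ?sqr_ge0. Qed.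

Lemma norm_current_le x y : `|current x y| <= normc x * normc y.
Proof.
have -> : current x y = complex.Im (x * y^*).
  by case: x y => a b [c d]; rewrite /current /=; ring.
apply: (le_trans (normc_Im _)); rewrite normcM.
by case: y => c d; rewrite /= sqrrN.
Qed.

Lemma current_step (z : C) (V : R) x y y' :
  y' = (z - V%:C) * y - x ->
  current y y' = current x y - complex.Im z * normc y ^+ 2.
Proof.
rewrite normc_sqrE => ->; case: z x y => e f [a b] [c d].
by rewrite /current /=; ring.
Qed.

(** Two solutions with Wronskian [W]: dividing by [v1 * w1] relates the two
ratios whose imaginary parts are the currents up to positive factors. *)
Lemma current_wronskian wb w1 vb v1 W : wb * v1 - w1 * vb = W ->
  current wb w1 * normc v1 ^+ 2 = normc w1 ^+ 2 * current vb v1 + current W (w1 * v1).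
Proof.
move=> <-; rewrite !normc_sqrE; case: wb w1 vb v1 => a b [c d] [e f] [g h].
by rewrite /current /=; ring.
Qed.

End Currents.

Section HalfLine.
Variable R : realType.
Local Notation C := R[i].
Local Notation normc := (@ComplexField.Normc.normc R).
Variables (z : C) (V : nat -> R).
Hypothesis eps0 : 0 < complex.Im z.
Local Notation eps := (complex.Im z).

Definition solves (w : nat -> C) : Prop :=
  forall n, w n.+2 = (z - (V n)%:C) * w n.+1 - w n.

Variable w : nat -> C.
Hypothesis solw : solves w.
Hypothesis wlim : forall e : R, 0 < e -> exists N, forall n, (N <= n)%N -> normc (w n) <= e.
Local Notation J n := (current (w n) (w n.+1)).

Lemma current_rec n : J n.+1 = J n - eps * normc (w n.+1) ^+ 2.
Proof. exact: current_step (solw n). Qed.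

Lemma current_nonincreasing m n : (m <= n)%N -> J n <= J m.
Proof.
elim: n => [|n IH]; first by rewrite leqn0 => /eqP ->.
rewrite leq_eqVlt => /orP[/eqP -> //|mn]; apply: le_trans (IH mn).
by rewrite current_rec lerBlDr lerDl mulr_ge0 ?sqr_ge0// ltW.
Qed.

(** The current is nonincreasing and tends to zero. *)
Lemma current_ge0 n : 0 <= J n.
Proof.
rewrite leNgt; apply/negP => neg.
pose e := Num.min 1 (- J n / 2).
have e0 : 0 < e by rewrite lt_min ltr01 divr_gt0// oppr_gt0.
have [N hN] := wlim e0.
have h1 := hN _ (leq_maxr n N); have h2 := hN _ (leqW (leq_maxr n N)).
have le1 := current_nonincreasing (leq_maxl n N).
have le2 := norm_current_le (w (maxn n N)) (w (maxn n N).+1).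
have e1 : e <= 1 by rewrite ge_min lexx.
have e2 : e <= - J n / 2 by rewrite ge_min lexx orbT.
have le3 : normc (w (maxn n N)) * normc (w (maxn n N).+1) <= e * 1.
  by apply: ler_pM; rewrite ?normc_ge0// (le_trans h2).
have := ler_norm (- current (w (maxn n N)) (w (maxn n N).+1)); rewrite normrN.
lra.
Qed.

Lemma current_ge_site n x : (n < x)%N -> eps * normc (w x) ^+ 2 <= J n.
Proof.
case: x => // x; rewrite ltnS => nx; apply: le_trans (current_nonincreasing nx).
by have := current_rec x; have := current_ge0 x.+1; lra.
Qed.

(** The dissipated current is the mass of the solution times the imaginary
part of the energy. *)
Lemma current_sum n : J 0 = eps * (\sum_(i < n) normc (w i.+1) ^+ 2) + J n.
Proof.
elim: n => [|n ->]; first by rewrite big_ord0 mulr0 add0r.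
by rewrite big_ord_recr/= current_rec; ring.
Qed.

(** A solution [v] that starts without current, for instance from real data,
keeps a nonpositive current. The Wronskian identity then bounds the current of
[w] at [b] by [|W| * |w b.+1| / |v b.+1|], and that current controls [w] at
all later sites. *)
Lemma halfline_decay v b x : solves v -> current (v 0%N) (v 1%N) = 0 -> (b < x)%N ->
  eps * normc (w x) ^+ 2 * normc (v b.+1) <=
  normc (w 0%N * v 1%N - w 1%N * v 0%N) * normc (w b.+1).
Proof.
move=> solv v0 bx.
set W := w 0%N * _ - _.
have wr n : w n * v n.+1 - w n.+1 * v n = W.
  elim: n => // n <-; rewrite (solv n) (solw n); ring.
have Jv n : current (v n) (v n.+1) <= 0.
  elim: n => [|n IH]; first by rewrite v0.
  rewrite (current_step (solv n)); apply: le_trans IH.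
  by rewrite lerBlDr lerDl mulr_ge0 ?sqr_ge0// ltW.
have [z0|vn0] := eqVneq (normc (v b.+1)) 0.
  by rewrite z0 mulr0 mulr_ge0// normc_ge0.
have vp : 0 < normc (v b.+1) by rewrite lt0r vn0 normc_ge0.
rewrite -(ler_pM2r vp).
apply: (@le_trans _ _ (J b * normc (v b.+1) ^+ 2)).
  have -> : eps * normc (w x) ^+ 2 * normc (v b.+1) * normc (v b.+1) =
            eps * normc (w x) ^+ 2 * normc (v b.+1) ^+ 2 by ring.
  rewrite ler_wpM2r ?sqr_ge0//.
  exact: current_ge_site.
rewrite (current_wronskian (wr b)).
have := ler_norm (current W (w b.+1 * v b.+1)).
have := norm_current_le W (w b.+1 * v b.+1); rewrite normcM mulrA.
have : normc (w b.+1) ^+ 2 * current (v b) (v b.+1) <= 0.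
  by rewrite mulr_ge0_le0 ?sqr_ge0.
lra.
Qed.

End HalfLine.

Section MatrixProducts.
Variable R : realType.
Local Notation C := R[i].
Local Notation normc := (@ComplexField.Normc.normc R).
Implicit Types (c : nat -> C).

(** The transfer matrix with an abstract diagonal entry, so that products over
a reversed block or a half-line need not refer to the rotation. *)
Definition tmx (c : C) : 'M[C]_2 :=
  \matrix_(i, j) (if i == 0 then (if j == 0 then c else -1) else (if j == 0 then 1 else 0)).

Fixpoint mprod c (k : nat) : 'M[C]_2 :=
  if k is l.+1 then tmx (c l) *m mprod c l else 1%:M.

Lemma mprod_ext c c' k : (forall j, (j < k)%N -> c j = c' j) -> mprod c k = mprod c' k.
Proof.
elim: k => // k IH e; rewrite /= IH; last by move=> j jk; apply: e; exact: ltnW.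
by rewrite e.
Qed.

Lemma mprodSr c k : mprod c k.+1 = mprod (fun j => c j.+1) k *m tmx (c 0%N).
Proof.
elim: k => [|k IH]; first by rewrite /= mul1mx mulmx1.
by rewrite -[LHS]/(tmx (c k.+1) *m mprod c k.+1) IH mulmxA.
Qed.

Lemma cocycle_mprod (phi : R * R -> R) alpha k theta z :
  cocycle phi alpha k theta z = mprod (fun j => z - (phi (theta + alpha *+ j))%:C) k.
Proof. by elim: k => // k IH; rewrite cocycleS IH. Qed.

(** Conjugation by this sign matrix turns a transfer matrix into its
transpose, hence a product into the reversed product. *)
Definition sgmx : 'M[C]_2 := \matrix_(i, j) (if i == j then (if i == 0 then 1 else -1) else 0).

Lemma mul2mxE (A B : 'M[C]_2) i j :
  (A *m B) i j = A i ord0 * B ord0 j + A i (lift ord0 ord0) * B (lift ord0 ord0) j.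
Proof. by rewrite mxE !big_ord_recl big_ord0 addr0. Qed.

Lemma matrix2P (A B : 'M[C]_2) : (let i1 := lift ord0 ord0 : 'I_2 in
  A ord0 ord0 = B ord0 ord0 -> A ord0 i1 = B ord0 i1 -> A i1 ord0 = B i1 ord0 ->
  A i1 i1 = B i1 i1 -> A = B).
Proof.
move=> i1 h1 h2 h3 h4; apply/matrixP => i j.
have two (k : 'I_2) : k = ord0 \/ k = i1.
  by case: k => -[|[|//]] lt; [left|right]; apply/val_inj.
by case: (two i) => ->; case: (two j) => ->.
Qed.

Lemma tmx_tr (c : C) : (tmx c)^T = sgmx *m tmx c *m sgmx.
Proof. by apply: matrix2P; rewrite !mul2mxE !mxE /=; ring. Qed.

Lemma sgmxK : sgmx *m sgmx = 1%:M.
Proof. by apply: matrix2P; rewrite !mul2mxE !mxE /=; ring. Qed.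

Lemma mprod_rev c k : mprod (fun j => c (k - j.+1)%N) k = sgmx *m (mprod c k)^T *m sgmx.
Proof.
elim: k c => [|k IH] c; first by rewrite /= trmx1 mulmx1 sgmxK.
rewrite mprodSr [mprod c _.+1]/= trmx_mul.
rewrite (@mprod_ext _ (fun j => c (k - j.+1)%N)) => [|j _]; last by rewrite subSS.
by rewrite IH tmx_tr subSS subn0 -!mulmxA sgmxK mulmx1.
Qed.

Lemma mnorm_sg_tr (A : 'M[C]_2) : mnorm (sgmx *m A^T *m sgmx) = mnorm A.
Proof.
rewrite !mnorm_mx22 !mul2mxE !mxE /=.
rewrite !(mul0r, mulr0, addr0, add0r, mul1r, mulr1, mulrN1, mulN1r, opprK).
rewrite !(@normcN R); ring.
Qed.

(** The left half-line is read backwards, and a block read backwards is as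
large as the original. *)
Lemma mnorm_mprod_rev c k : mnorm (mprod (fun j => c (k - j.+1)%N) k) = mnorm (mprod c k).
Proof. by rewrite mprod_rev mnorm_sg_tr. Qed.

End MatrixProducts.

Section HalfLineDecay.
Variable R : realType.
Local Notation C := R[i].
Local Notation normc := (@ComplexField.Normc.normc R).

(** The columns of the transfer products are two solutions with real initial
data; the decay bound with each of them at two consecutive sites covers all
four entries. *)
Lemma halfline_decay_mx (z : C) (V : nat -> R) (w : nat -> C) (Bd : R) k x :
  0 < complex.Im z -> solves z V w ->
  (forall e : R, 0 < e -> exists N, forall n, (N <= n)%N -> normc (w n) <= e) ->
  (forall n, normc (w n) <= Bd) -> (0 < k)%N -> (k < x)%N ->
  complex.Im z * normc (w x) ^+ 2 * mnorm (mprod (fun j => z - (V j)%:C) k) <= 4 * Bd ^+ 2.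
Proof.
move=> eps0 solw wlim wB k0 kx.
pose c j := z - (V j)%:C; pose i1 : 'I_2 := lift ord0 ord0.
pose v (j : 'I_2) n := mprod c n i1 j.
have top j n : mprod c n ord0 j = v j n.+1.
  by rewrite /v /= mul2mxE !mxE /= mul1r mul0r addr0.
have solv j : solves z V (v j).
  by move=> n; rewrite -top /= mul2mxE !mxE /= mulN1r -/(v j n) top.
have B0 : 0 <= Bd by apply: le_trans (normc_ge0 _) (wB 0%N).
have v0 j : v j 0%N = (j == i1)%:R by rewrite /v /= mxE eq_sym.
have v1 j : v j 1%N = (j == ord0)%:R by rewrite -top /= mxE eq_sym.
have two (j : 'I_2) : j = ord0 \/ j = i1.
  by case: j => -[|[|//]] lt; [left|right]; apply/val_inj.
have cur j : current (v j 0%N) (v j 1%N) = 0.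
  by rewrite v0 v1; case: (two j) => ->; rewrite /current /=; ring.
have one j b : (b < x)%N -> complex.Im z * normc (w x) ^+ 2 * normc (v j b.+1) <= Bd ^+ 2.
  move=> bx; apply: (le_trans (halfline_decay eps0 solw wlim (solv j) (cur j) bx)).
  rewrite expr2; apply: ler_pM; rewrite ?normc_ge0//.
  rewrite v0 v1; case: (two j) => ->; rewrite !eqxx /=.
    by rewrite mulr1 mulr0 subr0.
  by rewrite mulr0 mulr1 sub0r (@normcN R).
rewrite mnorm_mx22 -/i1 !top -/(v ord0 k) -/(v i1 k).
have e1 := one ord0 k kx; have e2 := one i1 k kx.
have [k' kE] : exists k', k = k'.+1 by case: (k) k0 => // k' _; exists k'.
have kx' : (k' < x)%N by rewrite (leq_trans _ kx)// kE.
have e3 := one ord0 k' kx'; have e4 := one i1 k' kx'.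
rewrite -kE in e3 e4; move: e1 e2 e3 e4.
lra.
Qed.

End HalfLineDecay.

(** * The Green function *)

Section SquareSummable.
Variable R : realType.
Local Notation C := R[i].
Local Notation normc := (@ComplexField.Normc.normc R).
Implicit Types (u : int -> C).

Lemma l2_partial_sums u (f : nat -> int) : l2 u -> injective f ->
  exists S : R, forall N : nat, \sum_(i < N) normc (u (f i)) ^+ 2 <= S.
Proof.
rewrite /l2; set a := fun n : int => (normc (u n) ^+ 2)%:E => fin finj.
have a0 n : (0 <= a n)%E by rewrite lee_fin sqr_ge0.
have sub : (\esum_(n in range f) a n <= \esum_(n in [set: int]) a n)%E.
  by apply: ereal_sup_le => _ [X [fX _] <-]; exists X.
rewrite esum_image in sub; last by move=> x y _ _; exact: finj.
rewrite -nneseries_esumT in sub; last by move=> n; exact: a0.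
have s0 : (0 <= \esum_(n in [set: int]) a n)%E by apply: esum_ge0 => n _; exact: a0.
exists (fine (\esum_(n in [set: int]) a n)) => N.
rewrite -lee_fin fineK ?ge0_fin_numE//; apply: le_trans sub.
rewrite -sumEFin -(big_mkord xpredT (fun i => a (f i))).
by apply: nneseries_lim_ge => n _ _; exact: a0.
Qed.

Lemma l2_vanishing u (f : nat -> int) : l2 u -> injective f ->
  forall e : R, 0 < e -> exists N, forall n, (N <= n)%N -> normc (u (f n)) <= e.
Proof.
move=> lu finj e e0; have [S hS] := l2_partial_sums lu finj.
pose b n := normc (u (f n)) ^+ 2.
have cb : cvgn (series b).
  apply: nondecreasing_is_cvgn.
    apply/nondecreasing_seqP => n; rewrite /series/= big_nat_recr//= lerDl.
    exact: sqr_ge0.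
  by exists S => _ [n _ <-]; rewrite /series/= big_mkord; exact: hS.
have /cvgrPdist_lt /(_ (e ^+ 2)) := cvg_series_cvg_0 cb.
rewrite exprn_gt0// => /(_ isT) [N _ hN]; exists N => n nN.
have := hN n nN; rewrite /= sub0r normrN /b ger0_norm ?sqr_ge0// => h.
by rewrite -(@ler_pXn2r _ 2) ?nnegrE ?normc_ge0// ltW.
Qed.

End SquareSummable.

Section GreenFunction.
Variable R : realType.
Local Notation C := R[i].
Local Notation normc := (@ComplexField.Normc.normc R).
Variables (z : C) (V : int -> R) (u : int -> C).
Local Notation eps := (complex.Im z).
Hypothesis eps0 : 0 < eps.
Hypothesis lu : l2 u.
Hypothesis equ : forall n : int, u (n + 1) + u (n - 1) + (V n)%:C * u n - z * u n = (n == 0)%:R.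

Definition right_branch (n : nat) := u n%:Z.
Definition left_branch (n : nat) := u (- n%:Z).
Definition right_potential (n : nat) := V n.+1%:Z.
Definition left_potential (n : nat) := V (- n.+1%:Z).
Local Notation JR n := (current (right_branch n) (right_branch n.+1)).
Local Notation JL n := (current (left_branch n) (left_branch n.+1)).

Lemma right_solves : solves z right_potential right_branch.
Proof.
move=> n; have := equ n.+1%:Z.
have -> : (n.+1%:Z + 1 = n.+2%:Z)%R by lia.
have -> : (n.+1%:Z - 1 = n%:Z)%R by lia.
have -> : (n.+1%:Z == 0)%:R = 0 :> C by [].
rewrite /right_branch /right_potential => e.
apply/eqP; rewrite -subr_eq0; apply/eqP; rewrite -[RHS]e; ring.
Qed.

Lemma left_solves : solves z left_potential left_branch.
Proof.
move=> n; have := equ (- n.+1%:Z).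
have -> : (- n.+1%:Z + 1 = - n%:Z)%R by lia.
have -> : (- n.+1%:Z - 1 = - n.+2%:Z)%R by lia.
have -> : (- n.+1%:Z == 0)%:R = 0 :> C by [].
rewrite /left_branch /left_potential => e.
apply/eqP; rewrite -subr_eq0; apply/eqP; rewrite -[RHS]e; ring.
Qed.

Lemma right_vanishing e : 0 < e -> exists N, forall n, (N <= n)%N -> normc (right_branch n) <= e.
Proof. by apply: (l2_vanishing (f := fun n => n%:Z) lu) => m n []. Qed.

Lemma left_vanishing e : 0 < e -> exists N, forall n, (N <= n)%N -> normc (left_branch n) <= e.
Proof. by apply: (l2_vanishing (f := fun n => - n%:Z) lu) => m n /oppr_inj []. Qed.

(** The equation at the origin writes the source as a combination of [u 0] and
its neighbours; taking imaginary parts against [u 0] leaves the currents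
flowing to both sides. *)
Lemma Im_green : complex.Im (u 0) = eps * normc (u 0) ^+ 2 + JR 0%N + JL 0%N.
Proof.
have e := equ 0; rewrite add0r sub0r eqxx in e.
rewrite -addrA.
have -> : JR 0%N + JL 0%N = current (u 0) (1 - ((V 0)%:C - z) * u 0).
  rewrite -[1]/(1%:R) -e /right_branch /left_branch oppr0.
  rewrite (_ : _ - ((V 0)%:C - z) * u 0 = u 1 + u (- 1)); last by ring.
  by case: (u 0) (u 1) (u (-1)) => a b [c d] [f g]; rewrite /current /=; ring.
rewrite normc_sqrE; case: (z) (u 0) => a b [c d]; rewrite /current /=; ring.
Qed.

Lemma Im_green_box N : complex.Im (u 0) =
  eps * (normc (u 0) ^+ 2 + \sum_(i < N) normc (right_branch i.+1) ^+ 2 +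
         \sum_(i < N) normc (left_branch i.+1) ^+ 2) + JR N + JL N.
Proof.
rewrite Im_green (current_sum right_solves N) (current_sum left_solves N); ring.
Qed.

Lemma green_site_le n : eps * normc (u n) ^+ 2 <= complex.Im (u 0).
Proof.
have JR0 := current_ge0 eps0 right_solves right_vanishing 0.
have JL0 := current_ge0 eps0 left_solves left_vanishing 0.
have u00 : 0 <= eps * normc (u 0) ^+ 2 by rewrite mulr_ge0 ?sqr_ge0// ltW.
rewrite Im_green; case: n => [[|n]|n]; first by lra.
  have := current_ge_site eps0 right_solves right_vanishing (ltn0Sn n).
  by rewrite {1}/right_branch; lra.
have := current_ge_site eps0 left_solves left_vanishing (ltn0Sn n).
by rewrite NegzE {1}/left_branch; lra.
Qed.

(** The bound on the resolvent by the inverse of the imaginary part of the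
energy, from the current identity alone: [eps * |u n| ^ 2 <= Im (u 0) <= |u
0|], applied first at [n = 0]. *)
Lemma green_bound n : normc (u n) <= eps^-1.
Proof.
have im := le_trans (ler_norm _) (normc_Im (u 0)).
have n0 := normc_ge0 (u 0).
have u0 : normc (u 0) <= eps^-1.
  have [->|ne] := eqVneq (normc (u 0)) 0; first by rewrite invr_ge0 ltW.
  have p : 0 < normc (u 0) by rewrite lt0r ne n0.
  rewrite -[leRHS]mul1r ler_pdivlMr// -(ler_pM2r p) mul1r.
  by have := le_trans (green_site_le 0) im; rewrite expr2; lra.
have := le_trans (green_site_le n) im => h.
rewrite -(@ler_pXn2r _ 2) ?nnegrE ?normc_ge0 ?invr_ge0 ?(ltW eps0)//.
have : eps * normc (u n) ^+ 2 <= eps^-1 by apply: le_trans u0.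
by rewrite mulrC -ler_pdivlMr// expr2.
Qed.

End GreenFunction.

Section GreenDecay.
Variable R : realType.
Local Notation C := R[i].
Local Notation normc := (@ComplexField.Normc.normc R).

Lemma solves_shift (z : C) (V : nat -> R) (w : nat -> C) a :
  solves z V w -> solves z (fun j => V (a + j)%N) (fun j => w (a + j)%N).
Proof. by move=> h n; rewrite !addnS; exact: h. Qed.

Lemma shifted_decay (z : C) (V : nat -> R) (w : nat -> C) (Bd X : R) a k x :
  0 < complex.Im z -> solves z V w ->
  (forall e : R, 0 < e -> exists N, forall n, (N <= n)%N -> normc (w n) <= e) ->
  (forall n, normc (w n) <= Bd) -> (0 < k)%N -> (a + k < x)%N ->
  X <= mnorm (mprod (fun j => z - (V (a + j)%N)%:C) k) ->
  complex.Im z * normc (w x) ^+ 2 * X <= 4 * Bd ^+ 2.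
Proof.
move=> e0 sol lim wB k0 akx hX.
have kx : (k < x - a)%N by rewrite ltn_subRL.
have ax : (a <= x)%N by rewrite ltnW// (leq_ltn_trans _ akx)// leq_addr.
have lim' e : 0 < e -> exists N, forall n, (N <= n)%N -> normc (w (a + n)%N) <= e.
  by move=> /lim [N hN]; exists N => n nN; apply: hN; rewrite (leq_trans nN)// leq_addl.
have := halfline_decay_mx e0 (solves_shift a sol) lim' (fun n => wB (a + n)%N) k0 kx.
rewrite subnKC//; apply: le_trans.
by apply: ler_wpM2l => //; rewrite mulr_ge0 ?sqr_ge0// ltW.
Qed.

(** With [y = n ^ (4 * D)], the product bound reads [y^-1 * t ^ 2 * 8 * y ^ 7
<= 4 * y ^ 2]. *)
Lemma decay_exponents (n D : nat) (t : R) : (0 < n)%N -> 0 <= t ->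
  n%:R ^- (4 * D) * t ^+ 2 * (8 * n%:R ^+ (28 * D)) <= 4 * (n%:R ^- (4 * D))^-1 ^+ 2 ->
  t <= n%:R ^- (8 * D).
Proof.
move=> n0 t0; have np : 0 < n%:R :> R by rewrite ltr0n.
have [y yE] : exists y : R, y = n%:R ^+ (4 * D) by eexists.
have y1 : 1 <= y by rewrite yE exprn_ege1// ler1n.
have -> : n%:R ^+ (28 * D) = y ^+ 7 :> R by rewrite yE -exprM; congr (_ ^+ _); lia.
have -> : n%:R ^+ (8 * D) = y ^+ 2 :> R by rewrite yE -exprM; congr (_ ^+ _); lia.
rewrite -yE invrK => h; have yp : 0 < y by lra.
rewrite -(@ler_pXn2r _ 2) ?nnegrE ?invr_ge0 ?exprn_ge0 ?(ltW yp)//.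
have h2 : t ^+ 2 * y ^+ 4 <= 1.
  have y2 : 0 < 8 * y ^+ 2 by rewrite mulr_gt0// exprn_gt0.
  rewrite -(ler_pM2r y2) mul1r.
  have -> : t ^+ 2 * y ^+ 4 * (8 * y ^+ 2) = y^-1 * t ^+ 2 * (8 * y ^+ 7).
    by field; rewrite gt_eqF.
  by apply: (le_trans h); have := sqr_ge0 y; lra.
by rewrite exprVn -exprM -[leRHS]mul1r ler_pdivlMr// exprn_gt0.
Qed.

(** Both half-lines meet, within [n ^ C' + n] sites of the origin, a block on
which the transfer matrices are huge; the Green function has died out beyond.
*)
Lemma green_decay (phi : R * R -> R) alpha (E : R) (n D C' : nat) theta (u : int -> C) :
  (0 < n)%N ->
  (forall theta x, exists i, (i < n ^ C')%N /\ torus_near n%:R^-1 (theta + alpha *+ i) x) ->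
  (exists (k : nat) x, [/\ (0 < k)%N, (k <= n)%N &
      forall x' z', torus_near n%:R^-1 x' x -> normc (z' - E%:C) <= n%:R ^- (4 * D) ->
        8 * n%:R ^+ (28 * D) <= mnorm (cocycle phi alpha k x' z')]) ->
  l2 u ->
  (forall m : int, schroedinger phi alpha theta u m - (E +i* n%:R ^- (4 * D)) * u m
     = delta0 R m) ->
  forall X : nat, (n ^ C' + n < X)%N ->
    normc (u X%:Z) <= n%:R ^- (8 * D) /\ normc (u (- X%:Z)) <= n%:R ^- (8 * D).
Proof.
move=> n0 hits [k [x0 [k0 kn growth]]] lu equ X PX.
have np : 0 < n%:R :> R by rewrite ltr0n.
pose z : C := E +i* n%:R ^- (4 * D).
have eps0 : 0 < complex.Im z by rewrite /= invr_gt0 exprn_gt0.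
pose V (m : int) := phi (rot_iter alpha m theta).
have equ' (m : int) : u (m + 1) + u (m - 1) + (V m)%:C * u m - z * u m = (m == 0)%:R.
  exact: equ.
have zE : normc (z - E%:C) <= n%:R ^- (4 * D).
  rewrite /= subrr subr0 expr0n add0r sqrtr_sqr ger0_norm// ltW//.
have bound := green_bound eps0 lu equ'.
have key (w V' : nat -> _) a theta' i :
    solves z V' w ->
    (forall e : R, 0 < e -> exists N, forall n, (N <= n)%N -> normc (w n) <= e) ->
    (forall n, normc (w n) <= (complex.Im z)^-1) -> (a + k < X)%N ->
    torus_near n%:R^-1 (theta' + alpha *+ i) x0 ->
    mnorm (mprod (fun j => z - (V' (a + j)%N)%:C) k) = mnorm (cocycle phi alpha k (theta' + alpha *+ i) z) ->
    normc (w X) <= n%:R ^- (8 * D).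
  move=> sol lim wB aX near mn; apply: decay_exponents => //; first exact: normc_ge0.
  by apply: (shifted_decay eps0 sol lim wB k0 aX); rewrite mn; exact: growth.
split.
- have [i [iP near]] := hits (theta + alpha) x0.
  apply: (key (right_branch u) (right_potential V) i (theta + alpha) i) => //.
  + exact: right_solves.
  + exact: right_vanishing.
  + by move=> m; exact: bound.
  + by apply: leq_ltn_trans PX; rewrite leq_add// ltnW.
  rewrite cocycle_mprod; congr mnorm; apply: mprod_ext => j _; congr (z - (phi _)%:C).
  rewrite rot_iter_nat -!addrA; congr (_ + _).
  by rewrite mulrS mulrnDr.
(* On the left the sites run through the orbit backwards: start the search at
the far end [theta - alpha *+ P] and reverse the block that is found. *)
pose P := (n ^ C' + n)%N.
have [i [iP near]] := hits (theta - alpha *+ P) x0.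
have iP' : (i + k <= P)%N by rewrite leq_add// ltnW.
apply: (key (left_branch u) (left_potential V) (P - i - k)%N (theta - alpha *+ P) i) => //.
- exact: left_solves.
- exact: left_vanishing.
- by move=> m; exact: bound.
- by apply: leq_ltn_trans PX; rewrite -/P; lia.
rewrite cocycle_mprod -mnorm_mprod_rev; congr mnorm; apply: mprod_ext => j jk.
congr (z - (phi _)%:C).
rewrite /rot_iter -!addrA; congr (_ + _).
rewrite mulrNz -pmulrn -mulrnDr.
have [m mE] : exists m, m = (P - i - k + (k - j.+1)).+1 by eexists.
have Pe : P = (i + j + m)%N by lia.
by rewrite -mE Pe [alpha *+ (_ + _ + _)]mulrnDr opprD addrAC addNr add0r.
Qed.

End GreenDecay.

(** * Finite boxes *)

Section SpectralBox.
Local Open Scope sesquilinear_scope.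
Variable R : realType.
Local Notation C := R[i].
Local Notation normc := (@ComplexField.Normc.normc R).

Definition sqn n (v : 'cV[C]_n) : R := \sum_i normc (v i 0) ^+ 2.

Lemma conjE (x : C) : Num.conj x = conjc x.
Proof. by []. Qed.

Lemma mul_conj_normc (x : C) : conjc x * x = (normc x ^+ 2)%:C.
Proof.
rewrite normc_sqrE; case: x => a b; apply/eqP; rewrite eq_complex /=.
by apply/andP; split; apply/eqP; ring.
Qed.

Lemma sqnE n (v : 'cV[C]_n) : (sqn v)%:C = (v ^t* *m v) 0 0.
Proof.
rewrite mxE /sqn rmorph_sum/=; apply: eq_bigr => i _.
by rewrite !mxE conjE mul_conj_normc.
Qed.

Lemma sqn_unitary n (P : 'M[C]_n) v : P \is unitarymx -> sqn (P *m v) = sqn v.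
Proof.
move=> Pu; suff : (sqn (P *m v))%:C = (sqn v)%:C by move=> [].
rewrite !sqnE trmx_mul map_mxM mulmxA -(mulmxA _ (P ^t*)).
by rewrite -(invmx_unitary Pu) mulVmx ?unitarymx_unit// mulmx1.
Qed.

(** Diagonalize: in the eigenbasis each coordinate is divided by [d i - E - i
e], of modulus at least [eta]. The eigenvalues come first because one choice
must serve all energies. *)
Lemma hermitian_resolvent_bound n (A : 'M[C]_n) : A ^t* = A ->
  exists d : 'I_n -> R, forall (E e eta : R) (w g : 'cV[C]_n),
    A *m w - (E +i* e) *: w = g -> 0 <= eta -> (forall i, eta <= `|E - d i|) ->
    eta ^+ 2 * sqn w <= sqn g.
Proof.
move=> herm; have normA : A \is normalmx by apply/normalmxP; rewrite herm.
have /orthomx_spectralP := normA.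
set P := spectralmx A; set sp := spectral_diag A => AE.
have Pu : P \is unitarymx := spectral_unitarymx A.
exists (fun i => complex.Re (sp 0 i)) => E e eta w g eqg eta0 far.
rewrite -(sqn_unitary w Pu) -(sqn_unitary g Pu) -eqg mulmxBr -scalemxAr.
have -> : P *m (A *m w) = diag_mx sp *m (P *m w).
  by rewrite [in LHS]AE !mulmxA mulmxV ?unitarymx_unit// mul1mx.
move: (P *m w) => v; rewrite /sqn mulr_sumr; apply: ler_sum => i _.
rewrite mul_diag_mx !mxE -mulrBl normcM exprMn ler_wpM2r ?sqr_ge0//.
apply: (@le_trans _ _ (`|E - complex.Re (sp 0 i)| ^+ 2)).
  by rewrite lerXn2r ?nnegrE.
rewrite lerXn2r ?nnegrE ?normc_ge0//; apply: le_trans (normc_Re _).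
by rewrite distrC; case: (sp 0 i).
Qed.

End SpectralBox.

Section BoxHamiltonian.
Local Open Scope sesquilinear_scope.
Variable R : realType.
Local Notation C := R[i].
Local Notation normc := (@ComplexField.Normc.normc R).
Variables (V : int -> R) (N : nat).
Hypothesis N0 : (0 < N)%N.

Definition site (i : nat) : int := i%:Z - N%:Z.

(** The operator restricted to the sites [-N, ..., N]. *)
Definition box_matrix : 'M[C]_(N + N.+1) := \matrix_(i, j)
  (V (site i) *+ (val i == val j) + ((i : nat).+1 == j)%:R + ((j : nat).+1 == i)%:R)%:C.

Lemma box_matrix_hermitian : box_matrix ^t* = box_matrix.
Proof.
apply/matrixP => i j; rewrite !mxE conjE conjc_real; congr (_%:C).
rewrite addrAC eq_sym; congr (_ + _ + _).
by case: eqP => // ->.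
Qed.

(** The out of range case corresponds to a neighbour outside the box. *)
Lemma sum_ord_delta (n m : nat) (f : nat -> C) :
  \sum_(j < n) (m == j)%:R * f j = if (m < n)%N then f m else 0.
Proof.
case: ltnP => mn.
  rewrite (bigD1 (Ordinal mn))//= eqxx mul1r big1 ?addr0// => j jm.
  rewrite (_ : (m == j) = false) ?mul0r//; apply/eqP => e.
  by move/eqP: jm; apply; apply/val_inj.
rewrite big1// => j _; rewrite (_ : (m == j) = false) ?mul0r//.
by apply/eqP => e; move: (ltn_ord j); rewrite -e ltnNge mn.
Qed.

Variables (z : C) (u : int -> C).
Hypothesis equ : forall n : int, u (n + 1) + u (n - 1) + (V n)%:C * u n - z * u n = (n == 0)%:R.

Definition box_restriction : 'cV[C]_(N + N.+1) := \col_i u (site i).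

(** The delta at the origin, corrected by the two couplings that are cut off
at the ends of the box. *)
Definition box_source : 'cV[C]_(N + N.+1) := \col_i
  (((i : nat) == N)%:R - ((i : nat) == (N + N)%N)%:R * u (N.+1)%:Z - ((i : nat) == 0%N)%:R * u (- N.+1%:Z)).

Lemma box_equation : box_matrix *m box_restriction - z *: box_restriction = box_source.
Proof.
apply/colP => i; rewrite !mxE.
have -> : \sum_j box_matrix i j * box_restriction j 0 =
   (V (site i))%:C * u (site i)
   + (if (i.+1 < N + N.+1)%N then u (site i.+1) else 0)
   + (if (i == 0%N :> nat) then 0 else u (site i.-1)).
  under eq_bigr do rewrite !mxE !rmorphD/= !rmorph_nat !mulrDl.
  rewrite !big_split /=; congr (_ + _ + _).
  - rewrite (bigD1 i)//= eqxx mulr1n big1 ?addr0// => j ji.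
    rewrite (_ : (val i == val j) = false) ?mulr0n ?mul0r//.
    by apply/negbTE; rewrite eq_sym.
  - exact: (sum_ord_delta _ _ (fun j => u (site j))).
  case: (nat_of_ord i) (ltn_ord i) => [|m] hm /=.
    by rewrite big1// => j _; rewrite mul0r.
  have := sum_ord_delta (N + N.+1) m (fun j => u (site j)); rewrite (ltnW hm) => <-.
  by apply: eq_bigr => j _; rewrite eqSS eq_sym.
have := equ (site i).
have -> : (site i == 0) = ((i : nat) == N) by rewrite /site subr_eq0 eqz_nat.
move=> <-.
have -> : site i + 1 = site i.+1 by rewrite /site; lia.
have i2 := ltn_ord i.
have up : (if (i.+1 < N + N.+1)%N then u (site i.+1) else 0) =
   u (site i.+1) - ((i : nat) == (N + N)%N)%:R * u N.+1%:Z.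
  case: ltnP => h.
    by rewrite (_ : (_ == _) = false) ?mul0r ?subr0//; apply/eqP => e; move: h; rewrite e; lia.
  have e : (i : nat) = (N + N)%N by lia.
  by rewrite e eqxx mul1r (_ : site _ = N.+1%:Z) ?subrr// /site; lia.
have down : (if (i == 0%N :> nat) then 0 else u (site i.-1)) =
   u (site i - 1) - ((i : nat) == 0%N)%:R * u (- N.+1%:Z).
  case: eqP => [e|/eqP e].
    by rewrite mul1r (_ : site i - 1 = - N.+1%:Z) ?subrr// e /site; lia.
  by rewrite mul0r subr0; congr u; rewrite /site; lia.
rewrite up down; ring.
Qed.

Lemma sqn_box_source (s : R) : s <= 1 -> normc (u N.+1%:Z) <= s -> normc (u (- N.+1%:Z)) <= s ->
  sqn box_source <= 3.
Proof.
move=> s1 h1 h2.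
have N00 : (N == 0)%N = false by rewrite gtn_eqF.
have NN : (N == N + N)%N = false by rewrite -{1}[N]addn0 eqn_add2l eq_sym.
have NN0 : (N + N == 0)%N = false by rewrite addn_eq0 N00.
have pt (i : 'I_(N + N.+1)) : normc (box_source i 0) ^+ 2 <=
    ((i : nat) == N)%:R + ((i : nat) == (N + N)%N)%:R + ((i : nat) == 0%N)%:R.
  rewrite mxE.
  have lt1 (t : C) : normc t <= s -> normc t ^+ 2 <= 1.
    by move=> ht; rewrite exprn_ile1 ?normc_ge0// (le_trans ht).
  have [e|ne] := eqVneq (i : nat) N.
    rewrite e NN N00 /=.
    by rewrite !mul0r !subr0 ComplexField.Normc.normc1 expr1n !addr0.
  have [e|ne'] := eqVneq (i : nat) (N + N)%N.
    rewrite e NN0 /=.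
    by rewrite mul0r subr0 sub0r mul1r (@normcN R) add0r addr0 lt1.
  have [e|ne''] := eqVneq (i : nat) 0%N.
    by rewrite mul0r !sub0r oppr0 add0r mul1r (@normcN R) !add0r lt1.
  by rewrite !mul0r !subr0 ComplexField.Normc.normc0 expr0n !addr0.
apply: (le_trans (ler_sum _ (fun i _ => pt i))); rewrite !big_split/=.
have one (m : nat) : \sum_(i < N + N.+1) ((i : nat) == m)%:R <= 1 :> R.
  case: (ltnP m (N + N.+1)) => mn.
    rewrite (bigD1 (Ordinal mn))//= eqxx big1 ?addr0// => j jm.
    rewrite (_ : (_ == _) = false)//; apply/eqP => e.
    by move/eqP: jm; apply; apply/val_inj.
  rewrite big1// => j _; rewrite (_ : (_ == _) = false)//.
  by apply/eqP => e; move: (ltn_ord j); rewrite e ltnNge mn.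
by have := one N; have := one (N + N)%N; have := one 0%N; lra.
Qed.

Lemma sqn_box_restriction : sqn box_restriction =
  normc (u 0) ^+ 2 + \sum_(i < N) normc (u i.+1%:Z) ^+ 2 + \sum_(i < N) normc (u (- i.+1%:Z)) ^+ 2.
Proof.
rewrite /sqn big_split_ord /= addrC big_ord_recl; congr (_ + _ + _).
- by rewrite mxE /site /= addn0 subrr.
- by apply: eq_bigr => i _; rewrite mxE /site /= /bump /= add1n PoszD addrC addKr.
rewrite (reindex_inj rev_ord_inj) /=; apply: eq_bigr => i _.
by rewrite mxE /site /=; congr (normc (u _) ^+ 2); have := ltn_ord i; lia.
Qed.

End BoxHamiltonian.

(** * Hausdorff measure *)

Section HausdorffNull.
Variable R : realType.
Local Open Scope ereal_scope.

Lemma diam_pow_ge0 (s : R) (U : set R) : 0 <= diam_pow (@real_dist R) s U.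
Proof. by rewrite /diam_pow; case: ifP => // _; exact: poweR_ge0. Qed.

Definition center_ball (c r : R) : set R := [set x | (`|x - c| <= r)%R].

Lemma diameter_ball (c r : R) : diameter (@real_dist R) (center_ball c r) <= (2 * r)%:E.
Proof.
apply: ge_ereal_sup => _ [[x y] /= [hx hy] <-]; rewrite lee_fin /real_dist.
have := ler_distD c x y; rewrite [(`|c - y|)%R]distrC /center_ball /= in hx hy *.
by move=> h; apply: (le_trans h); lra.
Qed.

(** The centre of the ball makes the diameter nonnegative, as monotonicity of
the power requires. *)
Lemma diam_pow_ball (s c r : R) : (0 <= s)%R -> (0 <= r)%R ->
  diam_pow (@real_dist R) s (center_ball c r) <= ((2 * r) `^ s)%:E.
Proof.
move=> s0 r0; rewrite /diam_pow; case: ifP => _; first by rewrite lee_fin powR_ge0.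
rewrite -poweR_EFin; apply: gt0_ler_poweR => //; last exact: diameter_ball.
- rewrite in_itv/= leey andbT; apply: ereal_sup_ubound; exists (c, c) => //=.
    by split; rewrite /center_ball /= subrr normr0.
  by rewrite /real_dist subrr normr0.
- by rewrite in_itv/= leey andbT lee_fin mulr_ge0.
Qed.

(** A family indexed by pairs is listed along the enumeration of pairs, with
zeros at the unused codes. *)
Lemma nneseries_pairs (a : nat -> nat -> \bar R) : (forall i l, 0 <= a i l) ->
  \sum_(j <oo) (if @unpickle (nat * nat)%type j is Some p then
                  if pickle p == j then a p.1 p.2 else 0 else 0) =
  \sum_(i <oo) \sum_(l <oo) a i l.
Proof.
move=> a0; pose b j := if @unpickle (nat * nat)%type j is Some p then
                  if pickle p == j then a p.1 p.2 else 0 else 0.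
have b0 j : 0 <= b j by rewrite /b; case: unpickle => // p; case: ifP.
rewrite nneseries_esumT; last by move=> j; exact: b0.
rewrite nneseries_esumT; last by move=> i; apply: nneseries_ge0.
have -> : \esum_(i in [set: nat]) \sum_(l <oo) a i l =
    \esum_(i in [set: nat]) \esum_(l in [set: nat]) a i l.
  by apply: eq_esum => i _; rewrite nneseries_esumT.
rewrite esum_esum; last by move=> i j _ _; exact: a0.
have -> : [set: nat] `*`` (fun=> [set: nat]) = [set: nat * nat].
  by apply/seteqP; split=> [[x y]|[x y]].
have inj : set_inj [set: nat * nat] (@pickle (nat * nat)%type).
  by move=> x y _ _; apply: (pcan_inj pickleK).
have bp p : b (pickle p) = a p.1 p.2 by rewrite /b pickleK eqxx.
transitivity (\esum_(j in range (@pickle (nat * nat)%type)) b j).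
  rewrite [RHS]esum_mkcond; apply: eq_esum => j _; case: ifPn => // jr.
  rewrite /b; case e: unpickle => [p|//]; case: eqP => // pe.
  by move: jr; rewrite notin_setE => -[]; exists p.
by rewrite esum_image//; apply: eq_esum => p _; exact: bp.
Qed.

(** A set whose points belong to all but finitely many of the finite families
is covered by the union, over [i], of one late family for each [i]: the [i]-th
term of the union starts from an index [g i >= i], so that a point covered
from some index on lies in a chosen family, and [g i] is so late that the
family contributes at most [e / 2 ^ i.+1]. *)
Lemma hausdorff_null (s : R) (S : set R) (num : nat -> nat) (ctr : nat -> nat -> R)
    (eta : nat -> R) : (0 <= s)%R ->
  (forall i, 0 <= eta i)%R ->
  (forall x, S x -> exists m, forall i, (m <= i)%N -> exists2 l, (l < num i)%N &
     center_ball (ctr i l) (eta i) x) ->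
  (forall e : R, (0 < e)%R -> exists k, forall i, (k <= i)%N -> (eta i <= e)%R) ->
  (forall e : R, (0 < e)%R -> exists k, forall i, (k <= i)%N ->
     ((num i)%:R * (2 * eta i) `^ s <= e)%R) ->
  hausdorff_measure (@real_dist R) s S = 0.
Proof.
move=> s0 eta0 cover eta_small sum_small.
have pre delta : (0 < delta)%R -> hausdorff_premeasure (@real_dist R) s delta S = 0.
  move=> delta0; apply/eqP; rewrite eq_le; apply/andP; split; last first.
    apply: le_ereal_inf_tmp => _ [U _ <-]; apply: nneseries_ge0 => i _ _; exact: diam_pow_ge0.
  apply/lee_addgt0Pr => e e0; rewrite add0e.
  have ei i : (0 < e / (2 ^ i.+1)%:R)%R by rewrite divr_gt0// ltr0n expn_gt0.
  have /choice [g hg] : forall i, exists k : nat, [/\ (i <= k)%N, (2 * eta k <= delta)%R &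
      ((num k)%:R * (2 * eta k) `^ s <= e / (2 ^ i.+1)%:R)%R].
    move=> i; have [k1 h1] := eta_small (delta / 2)%R (divr_gt0 delta0 (ltr0n _ 2)).
    have [k2 h2] := sum_small _ (ei i).
    exists (maxn i (maxn k1 k2)); split; first exact: leq_maxl.
      by have := h1 _ (leq_trans (leq_maxl k1 k2) (leq_maxr i _)); lra.
    exact: h2 _ (leq_trans (leq_maxr k1 k2) (leq_maxr i _)).
  pose W (p : nat * nat) : set R :=
    if (p.2 < num (g p.1))%N then center_ball (ctr (g p.1) p.2) (eta (g p.1)) else set0.
  pose U j : set R := if @unpickle (nat * nat)%type j is Some p then
                  if pickle p == j then W p else set0 else set0.
  pose a i l := diam_pow (@real_dist R) s (W (i, l)).
  have dp0 : diam_pow (@real_dist R) s set0 = 0 by rewrite /diam_pow eqxx.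
  have diam0 : diameter (@real_dist R) set0 <= delta%:E.
    by apply: ge_ereal_sup => _ [p [[]]].
  apply: (@le_trans _ _ (\sum_(j <oo) diam_pow (@real_dist R) s (U j))).
    apply: ereal_inf_lbound; exists U => //; split.
      move=> x /cover [m hm]; have [gm _ _] := hg m.
      have [l lnum xl] := hm (g m) gm.
      exists (pickle (m, l)) => //; rewrite /U pickleK eqxx /W /= lnum; exact: xl.
    move=> j; rewrite /U; case: unpickle => // p; case: ifP => // _.
    rewrite /W; case: ifP => // _; apply: (le_trans (diameter_ball _ _)).
    by rewrite lee_fin; have [] := hg p.1.
  have -> : \sum_(j <oo) diam_pow (@real_dist R) s (U j) =
     \sum_(j <oo) (if @unpickle (nat * nat)%type j is Some p then
                  if pickle p == j then a p.1 p.2 else 0 else 0).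
    apply: eq_eseriesr => j _; rewrite /U /a.
    by case: unpickle => [[i l]|//]; case: ifP.
  rewrite nneseries_pairs; last by move=> i l; exact: diam_pow_ge0.
  apply: le_trans (epsilon_trick0 xpredT (ltW e0)).
  apply: lee_nneseries => i _; first by move=> _; apply: nneseries_ge0 => l _ _; exact: diam_pow_ge0.
  have [_ _ hi] := hg i.
  rewrite (nneseries_split 0 (num (g i))); last by move=> l _; exact: diam_pow_ge0.
  rewrite [X in _ + X]eseries0 ?adde0; last first.
    by move=> l; rewrite add0n => ln _; rewrite /a /W /= ltnNge ln /= dp0.
  apply: (@le_trans _ _ (\sum_(0 <= l < num (g i)) ((2 * eta (g i)) `^ s)%:E)).
    rewrite add0n; apply: lee_sum => l _; rewrite /a /W /=; case: ifP => _.
      exact: diam_pow_ball.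
    by rewrite dp0 lee_fin powR_ge0.
  rewrite sumEFin lee_fin sumr_const_nat subn0 -[leLHS]mulr_natl; exact: hi.
apply/eqP; rewrite eq_le; apply/andP; split.
  by apply: ge_ereal_sup => _ [delta /= d0 <-]; rewrite pre.
by rewrite -(pre 1%R ltr01); apply: ereal_sup_ubound; exists 1%R => //=; exact: ltr01.
Qed.

Lemma hausdorff_dim_ge0 (S : set R) : 0 <= hausdorff_dim (@real_dist R) S.
Proof. by apply: le_ereal_inf_tmp => _ [s [s0 _] <-]; rewrite lee_fin. Qed.

Lemma hausdorff_dim_le (s : R) (S : set R) : (0 <= s)%R ->
  hausdorff_measure (@real_dist R) s S = 0 -> hausdorff_dim (@real_dist R) S <= s%:E.
Proof. by move=> s0 h; apply: ereal_inf_lbound; exists s. Qed.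

End HausdorffNull.

(** * From the Green function to the spectral measure *)

Section SpectralMeasure.
Variable R : realType.
Local Notation C := R[i].
Local Notation normc := (@ComplexField.Normc.normc R).
Variable mu : {finite_measure set (measurableTypeR R) -> \bar R}.

Lemma Im_resolvent_kernel (x E e : R) :
  complex.Im ((x%:C - (E +i* e))^-1) = e / ((x - E) ^+ 2 + e ^+ 2).
Proof. by rewrite /= sub0r sqrrN mulNr opprK. Qed.

(** The Poisson kernel [e / ((x - E) ^ 2 + e ^ 2)] is at least [1 / (2 * e)]
on the interval. *)
Lemma stieltjes_ball (E e : R) : 0 < e ->
  (mu `](E - e)%R, (E + e)%R[%classic <= (2 * e * complex.Im (stieltjes mu (E +i* e)))%:E)%E.
Proof.
move=> e0; set I := `]E - e, E + e[%classic.
have mI : measurable (I : set (measurableTypeR R)) by exact: measurable_itv.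
have finI : mu I \is a fin_num by exact: fin_num_measure.
have mT : measurable ([set: measurableTypeR R]) by exact: measurableT.
have := @Rintegral_ge_step _ _ R mu setT mT unit [:: tt]
  (fun=> (2 * e)^-1) (fun=> fine (mu I)) (fun=> I)
  (fun x => complex.Im ((x%:C - (E +i* e))^-1)) e^-1.
rewrite !big_seq1 => h.
have {h} le : (2 * e)^-1 * fine (mu I) <= complex.Im (stieltjes mu (E +i* e)).
  apply: h.
  - by move=> _; rewrite invr_ge0 mulr_ge0// ltW.
  - by move=> _.
  - by move=> _; rewrite setIT fineK.
  - by rewrite ltey_eq fin_num_measure.
  - move=> x _; rewrite Im_resolvent_kernel ler_pdivrMr; last by rewrite ltr_wpDl ?sqr_ge0 ?exprn_gt0.
    by rewrite mulrDr [e ^+ 2]expr2 mulKf ?gt_eqF// lerDr mulr_ge0 ?invr_ge0 ?sqr_ge0// ltW.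
  move=> x _; rewrite big_seq1 indicE Im_resolvent_kernel; case: (boolP (x \in I)) => [|_] /=; last first.
    by rewrite mulr0 divr_ge0 ?addr_ge0 ?sqr_ge0// ltW.
  rewrite inE /I /= in_itv/= => /andP[x1 x2]; rewrite mulr1.
  have xe : (x - E) ^+ 2 <= e ^+ 2.
    rewrite -[leLHS]real_normK ?num_real// lerXn2r ?nnegrE ?(ltW e0)//.
    by rewrite ler_norml; lra.
  have p : 0 < (x - E) ^+ 2 + e ^+ 2 by rewrite ltr_wpDl ?sqr_ge0 ?exprn_gt0.
  rewrite ler_pdivlMr// mulrC ler_pdivrMr ?mulr_gt0//.
  have -> : e * (2 * e) = 2 * e ^+ 2 by ring.
  by lra.
rewrite -(fineK finI) lee_fin.
by rewrite -ler_pdivrMl ?mulr_gt0.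
Qed.

Lemma Im_inner_delta0 (u : int -> C) : complex.Im (inner u (@delta0 R)) = complex.Im (u 0).
Proof.
rewrite /inner /=; have e (N : nat) :
    \sum_(k < N.*2.+1) u (k%:Z - N%:Z) * ((@delta0 R) (k%:Z - N%:Z))^* = u 0.
  have NN : (N < N.*2.+1)%N by rewrite ltnS -addnn leq_addr.
  rewrite (bigD1 (Ordinal NN))//= subrr /delta0 eqxx conjC_nat mulr1 big1 ?addr0// => k kN.
  have kf : (k%:Z - N%:Z == 0) = false.
    rewrite subr_eq0 eqz_nat; apply/negbTE; apply: contra kN => /eqP kN.
    by apply/eqP/val_inj.
  by rewrite kf conjC_nat mulr0.
under eq_fun do rewrite e.
exact: lim_cst.
Qed.

(** Off the eigenvalues of the box the restriction of [u] has norm at most a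
constant times [n ^ D]; in the current identity for the box this is multiplied
by [n ^- (4 * D)], and the currents through the ends of the box are negligible
because [u] has decayed there. *)
Lemma Im_green_small (V : int -> R) (u : int -> C) (E : R) (n D N : nat) (d : 'I_(N + N.+1) -> R) :
  (0 < n)%N -> (0 < N)%N -> l2 u ->
  (forall m : int, u (m + 1) + u (m - 1) + (V m)%:C * u m - (E +i* n%:R ^- (4 * D)) * u m = (m == 0)%:R) ->
  (forall X : nat, (N <= X)%N -> normc (u X%:Z) <= n%:R ^- (8 * D) /\ normc (u (- X%:Z)) <= n%:R ^- (8 * D)) ->
  (forall (E e eta : R) (w g : 'cV[C]_(N + N.+1)),
    box_matrix V N *m w - (E +i* e) *: w = g -> 0 <= eta -> (forall i, eta <= `|E - d i|) ->
    eta ^+ 2 * sqn w <= sqn g) ->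
  (forall i, n%:R ^- D <= `|E - d i|) ->
  complex.Im (u 0) <= 5 * n%:R ^- (2 * D).
Proof.
move=> n0 N0 lu equ decay box far.
have np : 0 < n%:R :> R by rewrite ltr0n.
have [y yE] : exists y : R, y = n%:R ^- D by eexists.
have y0 : 0 < y by rewrite yE invr_gt0 exprn_gt0.
have y1 : y <= 1 by rewrite yE invf_le1 ?exprn_gt0// exprn_ege1// ler1n.
have yX k : n%:R ^- (k * D) = y ^+ k :> R by rewrite yE exprVn mulnC exprM.
rewrite !yX in equ decay *; rewrite -yE in far.
have eps0 : 0 < complex.Im (E +i* y ^+ 4) by rewrite /= exprn_gt0.
have bound := green_bound eps0 lu equ.
have y81 : y ^+ 8 <= 1 by rewrite exprn_ile1// ltW.
have [r1 l1] := decay N.+1 (leqnSn N).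
have src := sqn_box_source N0 y81 r1 l1.
have eqb := box_equation N0 equ.
have := box E (y ^+ 4) y _ _ eqb (ltW y0) far => small.
have sq3 : y ^+ 2 * sqn (box_restriction N u) <= 3 by apply: le_trans src.
have JRs := le_trans (ler_norm _) (norm_current_le (right_branch u N) (right_branch u N.+1)).
have JLs := le_trans (ler_norm _) (norm_current_le (left_branch u N) (left_branch u N.+1)).
have b4 (a b : R) : 0 <= a -> 0 <= b -> a <= (y ^+ 4)^-1 -> b <= y ^+ 8 -> a * b <= y ^+ 4.
  move=> a0 b0 ha hb; apply: (@le_trans _ _ ((y ^+ 4)^-1 * y ^+ 8)); first exact: ler_pM.
  by rewrite (exprD _ 4 4) mulKf// gt_eqF// exprn_gt0.
have JR := le_trans JRs (b4 _ _ (normc_ge0 _) (normc_ge0 _) (bound _) r1).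
have JL := le_trans JLs (b4 _ _ (normc_ge0 _) (normc_ge0 _) (bound _) l1).
rewrite (Im_green_box eps0 equ N) /=.
have -> : normc (u 0) ^+ 2 + \sum_(i < N) normc (right_branch u i.+1) ^+ 2 +
   \sum_(i < N) normc (left_branch u i.+1) ^+ 2 = sqn (box_restriction N u).
  by rewrite sqn_box_restriction.
have y2 : 0 <= y ^+ 2 by rewrite exprn_ge0// ltW.
have y42 : y ^+ 4 <= y ^+ 2 by rewrite (exprD _ 2 2) ler_piMl// exprn_ile1// ltW.
have : y ^+ 4 * sqn (box_restriction N u) <= y ^+ 2 * 3.
  by rewrite (exprD _ 2 2) -mulrA ler_wpM2l.
lra.
Qed.

End SpectralMeasure.

(** * Conclusion *)

Section Multiples.
Variable R : realType.
Implicit Types alpha : R * R.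

Lemma int_independent_mulrn alpha m : (0 < m)%N ->
  int_independent alpha -> int_independent (alpha *+ m).
Proof.
case: m => // m _ indep m1 m2 p e.
have [e1 e2] := pair_mulrn alpha m.+1.
have := indep (m1 * m.+1%:Z) (m2 * m.+1%:Z) p.
rewrite !intrM -!mulrA -[m.+1%:~R]/(m.+1%:R) !mulr_natl -e1 -e2 => /(_ e).
by move=> [/eqP + /eqP +]; rewrite !mulf_eq0 !orbF => /eqP -> /eqP ->.
Qed.

Lemma simult_dioph_mulrn alpha c t m : (0 < m)%N ->
  simult_dioph c t alpha -> simult_dioph (c / m%:R ^+ t) t (alpha *+ m).
Proof.
move=> m0 dioph h k1 k2 h0.
have [-> ->] := pair_mulrn alpha m.
have hm0 : h * m%:Z != 0 by rewrite mulf_neq0// eqz_nat -lt0n.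
have := dioph (h * m%:Z) k1 k2 hm0.
rewrite intrM -[m%:~R]/(m%:R) -!mulrA !mulr_natl normrM exprMn normr_nat.
by rewrite ler_pdivrMr ?exprn_gt0 ?ltr0n// mulrAC.
Qed.

(** The multiples of [alpha] satisfy the same hypotheses with a smaller
constant; the upper bound on the cocycle needs them because it advances by
blocks. *)
Lemma multiples_dense alpha c t : 0 < c -> int_independent alpha ->
  simult_dioph c t alpha -> forall m, (0 < m)%N -> dense_orbits (alpha *+ m).
Proof.
move=> c0 indep dioph m m0.
apply: (@orbit_dense _ _ (c / m%:R ^+ t) t).
- by rewrite divr_gt0// exprn_gt0// ltr0n.
- exact: int_independent_mulrn.
- exact: simult_dioph_mulrn.
Qed.

End Multiples.

Section Cells.
Variable R : realType.
Variable mu : {measure set (measurableTypeR R) -> \bar R}.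

(** Cut the range of the energies into [M] cells of length [eps]; a cell that
contains a light energy is contained in the light interval around it. *)
Lemma cell_cover (B : set R) (a eps q : R) (M : nat) : 0 < eps -> 0 <= q ->
  (forall E, B E -> 0 <= E + a < M%:R * eps) ->
  (forall E, B E -> (mu `](E - eps)%R, (E + eps)%R[%classic <= q%:E)%E) ->
  exists O : set (measurableTypeR R),
    [/\ measurable O, B `<=` O & (mu O <= (M%:R * q)%:E)%E].
Proof.
move=> eps0 q0 Bbd Bmu.
pose cell (k : nat) : set (measurableTypeR R) :=
  `[(k%:R * eps - a)%R, (k.+1%:R * eps - a)%R[%classic.
pose O k := if `[< exists2 E, B E & cell k E >] then cell k else set0.
have mO k : measurable (O k).
  by rewrite /O; case: asboolP => _; [exact: measurable_itv|exact: measurable0].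
exists (\big[setU/set0]_(k < M) O k); split.
- exact: bigsetU_measurable.
- move=> E BE; have /andP[E0 E1] := Bbd E BE.
  have x0 : 0 <= (E + a) / eps by rewrite divr_ge0// ltW.
  have /andP[k1 k2] := truncn_itv x0.
  rewrite ler_pdivlMr// in k1; rewrite ltr_pdivrMr// in k2.
  have kM : (Num.truncn ((E + a) / eps) < M)%N.
    by rewrite -(ltr_nat R) -(ltr_pM2r eps0); apply: le_lt_trans E1.
  rewrite -bigcup_mkord; exists (Num.truncn ((E + a) / eps)) => //=.
  have cE : cell (Num.truncn ((E + a) / eps)) E.
    by rewrite /cell /= in_itv/=; apply/andP; split; lra.
  by rewrite /O; case: asboolP => // -[]; exists E.
- apply: le_trans (Boole_inequality _ _) _ => //.
  apply: (@le_trans _ _ (\sum_(k < M) q%:E)%E); last first.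
    by rewrite sumEFin sumr_const card_ord mulr_natl.
  apply: lee_sum => k _; rewrite /O; case: asboolP => [[E BE]|_]; last by rewrite measure0 lee_fin.
  rewrite /cell /= in_itv/= => /andP[E1 E2].
  apply: le_trans (Bmu E BE); apply: le_measure; rewrite ?inE; do ?exact: measurable_itv.
  move=> x /=; rewrite !in_itv/= => /andP[x1 x2].
  by move: E2 x2; rewrite -natr1 mulrDl mul1r => E2 x2; apply/andP; split; lra.
Qed.

End Cells.

Lemma l2_delta0 (R : realType) : l2 (@delta0 R).
Proof.
rewrite /l2; have -> : \esum_(n in [set: int]) (ComplexField.Normc.normc (@delta0 R n) ^+ 2)%:E
   = \esum_(n in [set 0 : int]) (1%:E : \bar R).
  rewrite [RHS]esum_mkcond; apply: eq_esum => n _; rewrite /delta0.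
  case: ifPn; rewrite ?inE ?notin_setE /= => n0.
    by rewrite n0 eqxx ComplexField.Normc.normc1 expr1n.
  by move/eqP/negbTE: n0 => ->; rewrite ComplexField.Normc.normc0 expr0n.
by rewrite esum_set1// ltry.
Qed.

Section Dichotomy.
Variable R : realType.
Variables (phi : R * R -> R) (alpha : R * R) (gamma H : R) (Sg : set (R * R)).
Hypotheses (gamma0 : 0 < gamma) (gamma1 : gamma <= 1) (H0 : 0 < H).
Hypothesis reg : piecewise_regular phi gamma H Sg.
Hypothesis dense : forall m, (0 < m)%N -> dense_orbits (alpha *+ m).
Hypothesis lyapunov_pos : forall E : R, 0 < lyapunov phi alpha E%:C.
Variables (theta : R * R) (mu : {finite_measure set (measurableTypeR R) -> \bar R}).
Hypothesis spec : is_spectral_measure (schroedinger phi alpha theta) mu.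

(** One more than the distance beyond which the Green function has decayed. *)
Definition half_width (C' n : nat) : nat := (n ^ C' + n).+1.

Definition hitting (C' n : nat) : Prop := forall (theta x : R * R),
  exists i, (i < n ^ C')%N /\ torus_near n%:R^-1 (theta + alpha *+ i) x.

(** The centres are the eigenvalues of the box, chosen once for all energies;
the threshold [n0] depends on [E] through the rate of convergence to the
Lyapunov exponent. *)
Lemma ball_or_light (D C' : nat) : (0 < D)%N ->
  exists ctr : nat -> nat -> R, forall E : R, exists n0 : nat,
  forall n, (n0 <= n)%N -> hitting C' n ->
  (exists2 l, (l < half_width C' n + (half_width C' n).+1)%N &
      center_ball (ctr n l) (n%:R ^- D) E) \/
  (mu `](E - n%:R ^- (4 * D))%R, (E + n%:R ^- (4 * D))%R[%classic
     <= (10 * n%:R ^- (6 * D))%:E)%E.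
Proof.
move=> D0.
pose V (m : int) := phi (rot_iter alpha m theta).
have ex : forall n, exists d : 'I_(half_width C' n + (half_width C' n).+1) -> R,
   forall (E e eta : R) (w g : 'cV[R[i]]_(half_width C' n + (half_width C' n).+1)),
    box_matrix V (half_width C' n) *m w - (E +i* e) *: w = g -> 0 <= eta ->
    (forall i, eta <= `|E - d i|) -> eta ^+ 2 * sqn w <= sqn g.
  by move=> n; apply: hermitian_resolvent_bound; exact: box_matrix_hermitian.
pose d n := sval (cid (ex n)).
exists (fun n l => if insub l is Some i then d n i else 0) => E.
have [n0 growth] := transfer_growth gamma0 gamma1 H0 reg dense (lyapunov_pos E) D0.
exists (maxn n0 1) => n; rewrite geq_max => /andP[nn0 n1] hits.
have [[i near]|far] := pselect (exists i, `|E - d n i| < n%:R ^- D).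
  by left; exists i => //; rewrite valK; exact: ltW.
right; have np : 0 < n%:R :> R by rewrite ltr0n.
have eps0 : 0 < n%:R ^- (4 * D) :> R by rewrite invr_gt0 exprn_gt0.
have [G [res _] st] : exists2 G, is_resolvent (schroedinger phi alpha theta) (E +i* n%:R ^- (4 * D)) G &
    inner (G (@delta0 R)) (@delta0 R) = stieltjes mu (E +i* n%:R ^- (4 * D)).
  by apply: spec; rewrite /= gt_eqF.
have [lu equ] := res _ (l2_delta0 R).
apply: (le_trans (stieltjes_ball mu E eps0)).
rewrite -st Im_inner_delta0 lee_fin.
have small : complex.Im (G (@delta0 R) 0) <= 5 * n%:R ^- (2 * D).
  apply: (Im_green_small (V := V) (N := half_width C' n) (d := d n) n1 _ lu equ _ (svalP (cid (ex n)))) => //.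
    move=> X NX.
    exact: (green_decay n1 hits (growth n nn0) lu equ).
  by move=> i; rewrite leNgt; apply/negP => near; apply: far; exists i.
have -> : 10 * n%:R ^- (6 * D) = 2 * n%:R ^- (4 * D) * (5 * n%:R ^- (2 * D)) :> R.
  have -> : (6 * D = 4 * D + 2 * D)%N by rewrite -mulnDl.
  by rewrite exprD invfM; ring.
by rewrite ler_pM2l// mulr_gt0.
Qed.

(** Light energies at scale [q i] are covered by a union [U i] of cells of
mass at most [60 / 2 ^ i.+1]. Almost every energy leaves these sets, hence is
close to a box eigenvalue at all late scales, and the balls around the
eigenvalues satisfy [hausdorff_null]. *)
Lemma hausdorff_null_support (s : R) (D C' : nat) (q : nat -> nat) : 0 < s ->
  (0 < D)%N -> C'.+2%:R <= D%:R * s ->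
  (forall i, (2 ^ i <= q i)%N) -> (forall i, hitting C' (q i)) ->
  exists S : set (measurableTypeR R),
    [/\ measurable S, mu (~` S) = 0%E & hausdorff_measure (@real_dist R) s S = 0%E].
Proof.
move=> s0 D0 Ds q2 hits.
have [ctr dich] := ball_or_light C' D0.
have q0 i : (0 < q i)%N by apply: leq_trans (q2 i); rewrite expn_gt0.
have qp i : 0 < (q i)%:R :> R by rewrite ltr0n.
have q1 i : 1 <= (q i)%:R :> R by rewrite ler1n.
have iq i : (i <= q i)%N by apply: ltnW; apply: leq_trans (q2 i); exact: ltn_expl.
pose B i : set R := [set E | `|E| <= (q i)%:R /\
   (mu `](E - (q i)%:R ^- (4 * D))%R, (E + (q i)%:R ^- (4 * D))%R[%classic
     <= (10 * (q i)%:R ^- (6 * D))%:E)%E].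
have /choice [U hU] : forall i, exists U : set (measurableTypeR R),
    [/\ measurable U, B i `<=` U & (mu U <= ((3 * q i ^ (4 * D).+1)%N%:R * (10 * (q i)%:R ^- (6 * D)))%:E)%E].
  move=> i; apply: (@cell_cover _ _ _ (q i)%:R ((q i)%:R ^- (4 * D))).
  - by rewrite invr_gt0 exprn_gt0.
  - by rewrite mulr_ge0// invr_ge0 exprn_ge0.
  - move=> E [Eq _]; rewrite natrM natrX exprS -!mulrA mulfV ?gt_eqF ?exprn_gt0// mulr1.
    move: Eq; rewrite ler_norml => /andP[E1 E2]; have := qp i.
    by move=> qi; apply/andP; split; lra.
  - by move=> E [].
have mU i : measurable (U i) by have [] := hU i.
exists (~` lim_sup_set U); split.
- by apply: measurableC; apply: bigcap_measurable => // n _; exact: bigcup_measurable.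
- rewrite setCK; apply: lim_sup_set_cvg0 => //.
  apply: (@le_lt_trans _ _ 60%:E); last exact: ltry.
  apply: le_trans (epsilon_trick0 xpredT (ler0n R 60)).
  apply: lee_nneseries => [i _ _|i _]; first exact: measure_ge0.
  have [_ _ h] := hU i; apply: (le_trans h); rewrite lee_fin.
  rewrite natrM natrX mulrACA -natrM.
  have -> : (3 * 10)%:R = 30 :> R by [].
  have yle : (q i)%:R ^+ (4 * D).+1 / (q i)%:R ^+ (6 * D) <= ((2 ^ i)%:R)^-1 :> R.
    have -> : (6 * D = (4 * D).+1 + (2 * D).-1)%N by lia.
    rewrite exprD invfM mulrA mulfV ?gt_eqF ?exprn_gt0// mul1r.
    rewrite lef_pV2 ?posrE ?exprn_gt0 ?ltr0n ?expn_gt0//.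
    apply: (@le_trans _ _ (q i)%:R); first by rewrite ler_nat.
    by rewrite -[leLHS]expr1 ler_weXn2l//; lia.
  have -> : 60 / (2 ^ i.+1)%:R = 30 * ((2 ^ i)%:R)^-1 :> R.
    rewrite expnS natrM invfM mulrA; congr (_ * _).
    by rewrite -[60]/((30 * 2)%:R) natrM mulfK.
  by rewrite ler_pM2l.
apply: (@hausdorff_null _ s _ (fun i => (half_width C' (q i) + (half_width C' (q i)).+1)%N)
   (fun i => ctr (q i)) (fun i => (q i)%:R ^- D)); first exact: ltW.
- by move=> i; rewrite invr_ge0 exprn_ge0.
- move=> E ES; have [n0 hn0] := dich E.
  have [m hm] : exists m, forall i, (m <= i)%N -> ~ U i E.
    apply: contrapT => /forallNP nO; apply: ES => m _.
    have /existsNP [i /not_implyP[mi /contrapT Oi]] := nO m.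
    by exists i.
  have [b [_ Eb]] := nat_above `|E|.
  exists (maxn (maxn m n0) b) => i; rewrite !geq_max => /andP[/andP[mi n0i] bi].
  have [//|light] := hn0 (q i) (leq_trans n0i (iq i)) (hits i).
  have [_ BO _] := hU i; have [] := hm i mi; apply: BO; split=> //.
  apply: (le_trans (ltW Eb)); rewrite ler_nat; exact: leq_trans (iq i).
- move=> e e0; have [b [b0 eb]] := nat_above e^-1; exists b => i bi.
  have bq : b%:R <= (q i)%:R :> R by rewrite ler_nat (leq_trans bi (iq i)).
  rewrite -[leRHS]invrK lef_pV2 ?posrE ?invr_gt0 ?exprn_gt0//.
  apply: (le_trans (ltW eb)); apply: (le_trans bq).
  by rewrite -[leLHS]expr1 ler_weXn2l.
move=> e e0; have [K [K0 eK]] := nat_above (7 * 2 `^ s / e); exists K => i Ki.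
have [y yE] : exists y : R, y = (q i)%:R by eexists.
have yp : 0 < y by rewrite yE.
have y1 : 1 <= y by rewrite yE.
have Ky : K%:R <= y by rewrite yE ler_nat (leq_trans Ki (iq i)).
have num_le : (half_width C' (q i) + (half_width C' (q i)).+1)%:R <= 7 * y ^+ C'.+1.
  rewrite yE -natrX -natrM ler_nat /half_width.
  have h1 : (q i <= q i ^ C'.+1)%N by rewrite -[leqLHS]expn1 leq_pexp2l.
  have h2 : (q i ^ C' <= q i ^ C'.+1)%N by rewrite leq_pexp2l.
  by move: (q i) (q i ^ C')%N (q i ^ C'.+1)%N (q0 i) h1 h2 => a b e'; clear; lia.
have pow_le : (2 * (q i)%:R ^- D) `^ s <= 2 `^ s * y ^- C'.+2.
  rewrite powRM ?invr_ge0 ?exprn_ge0// ler_wpM2l ?powR_ge0// -yE.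
  have -> : y ^- D = y `^ (- D%:R) by rewrite powRN powR_mulrn// ltW.
  have -> : y ^- C'.+2 = y `^ (- C'.+2%:R) by rewrite powRN powR_mulrn// ltW.
  by rewrite -powRrM ler_powR// mulNr lerN2.
apply: (@le_trans _ _ (7 * 2 `^ s / y)); last first.
  rewrite ler_pdivrMr// -ler_pdivrMl// mulrC.
  by apply: le_trans Ky; exact: ltW.
apply: (le_trans (ler_pM _ _ num_le pow_le)); rewrite ?ler0n ?powR_ge0//.
rewrite mulrACA [y ^+ C'.+2]exprS invfM [y^-1 * _]mulrC [y ^+ _ * _]mulrA.
by rewrite mulfV ?gt_eqF ?exprn_gt0// mul1r.
Qed.

End Dichotomy.

Theorem corollary1p4 (R : realType) (alpha : R * R) (phi : R * R -> R)
  (alpha_indep : rationally_independent alpha)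
  (phi_periodic : periodic_fun phi)
  (phi_pw : piecewise_Holder phi)
  (lyapunov_cont : continuous (fun E : R => lyapunov phi alpha E%:C))
  (lyapunov_pos : forall E : R, 0 < lyapunov phi alpha E%:C)
  (alpha_wdc : exists2 tau : R, 1 < tau & WDC tau alpha) :
  forall (theta : R * R)
    (mu : {finite_measure set (measurableTypeR R) -> \bar R}),
    is_spectral_measure (schroedinger phi alpha theta) mu ->
    dimH_measure mu = 0%E.
Proof.
move=> theta mu spec.
have indep := int_independent_of_rational alpha_indep.
have [c [t [c0 dioph]]] := simult_dioph_of_WDC alpha_wdc.
have dense := multiples_dense c0 indep dioph.
have [gamma [H [Sg [gamma0 gamma1 H0 reg]]]] :=
  piecewise_Holder_regular phi_periodic phi_pw.
have [C scales] := nonresonant_scales c0 indep dioph.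
have [C' [Q0 hits]] := orbit_hits alpha C.
have /choice [q hq] : forall i, exists q : nat, (2 ^ i <= q)%N /\ hitting alpha C' q.
  move=> i; have [q [qi nonres]] := scales (maxn (2 ^ i) Q0).
  by move: qi; rewrite geq_max => /andP[iq qQ0]; exists q; split=> //; exact: hits.
apply/eqP; rewrite eq_le; apply/andP; split; last first.
  by apply: le_ereal_inf_tmp => _ [S _ <-]; exact: hausdorff_dim_ge0.
apply/lee_addgt0Pr => s s0; rewrite add0e.
have [D [D0 hD]] := nat_above (C'.+2%:R / s).
have Ds : C'.+2%:R <= D%:R * s by rewrite -ler_pdivrMr// ltW.
have [S [mS muS nullS]] := hausdorff_null_support gamma0 gamma1 H0 reg dense
  lyapunov_pos spec s0 D0 Ds (fun i => (hq i).1) (fun i => (hq i).2).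
apply: (@le_trans _ _ (hausdorff_dim (@real_dist R) S)).
  by apply: ereal_inf_lbound; exists S.
by apply: hausdorff_dim_le => //; exact: ltW.
Qed.
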